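(* Let $Y$ be a Lévy process in $\mathbb{R}^d$ with generating triplet $(A,N,b)$ and with $h(0^+)=\infty$. The following four conditions are equivalent. (D1) There are $T_1,c_1>0$ such that the density $p(t,x)$ of $Y_t$ exists for all $t>T_1$ and, for all $t>T_1$, $$\sup_{x\in\mathbb{R}^d}p(t,x)\le c_1[h^{-1}(1/t)]^{-d}.$$ (D2) There are $T_2,c_2>0$ such that for all $t>T_2$, $$\int_{\mathbb{R}^d}e^{-t\,\mathrm{Re}[\Psi(z)]}\,dz\le c_2[h^{-1}(1/t)]^{-d}.$$ (D3) There are $T_3>0$, $c_3\in(0,1]$ and $\alpha_3\in(0,2]$ such that $c_3\Psi^*(|x|)\le\mathrm{Re}[\Psi(x)]$ for all $|x|<1/T_3$, and $\Psi^*(\lambda r)\le(1/c_3)\lambda^{\alpha_3}\Psi^*(r)$ for all $0<\lambda\le1$, $0<r<1/T_3$; moreover $e^{-t_0\Psi}\in L^1(\mathbb{R}^d)$ for some $t_0>0$. (D4) There are $T_4>0$, $c_4\in[1,\infty)$ such that for all $|x|<1/T_4$, $$\Psi^*(|x|)\le c_4\Big(\langle x,Ax\rangle+\int_{|\langle x,z\rangle|<1}|\langle x,z\rangle|^2N(dz)\Big);$$ moreover $e^{-t_0\Psi}\in L^1(\mathbb{R}^d)$ for some $t_0>0$.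
   Context: $Y=(Y_t)_{t\ge0}$ is a Lévy process in $\mathbb{R}^d$, $d\in\mathbb{N}$, with generating triplet $(A,N,b)$: $A$ is a symmetric non-negative definite $d\times d$ matrix, $b\in\mathbb{R}^d$, and $N$ is a Lévy measure (Borel measure with $N(\{0\})=0$, $\int(1\wedge|z|^2)N(dz)<\infty$). The characteristic exponent $\Psi$ is given by $\mathbb{E}e^{i\langle x,Y_t\rangle}=e^{-t\Psi(x)}$, $$\Psi(x)=\langle x,Ax\rangle-i\langle x,b\rangle-\int_{\mathbb{R}^d}\big(e^{i\langle x,z\rangle}-1-i\langle x,z\rangle\mathbf{1}_{|z|<1}\big)N(dz).$$ For $r>0$, $h(r)=r^{-2}\|A\|+\int_{\mathbb{R}^d}\big(1\wedge\frac{|x|^2}{r^2}\big)N(dx)$ and $\Psi^*(r)=\sup_{|z|\le r}\mathrm{Re}[\Psi(z)]$ (with $\Psi^*(0)=0$). Standing assumption: $h(0^+)=\infty$; then $h$ is a continuous strictly decreasing bijection of $(0,\infty)$ onto $(0,\infty)$ with inverse $h^{-1}$. $p(t,\cdot)$ is the density of the law of $Y_t$ with respect to Lebesgue measure (if $e^{-t\Psi}$ is integrable, it is the continuous one given by Fourier inversion). *)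

(* Defs.v *)
From HB Require Import structures.
From mathcomp Require Import all_boot all_order all_algebra.
From mathcomp Require Import all_classical all_reals all_analysis.
From mathcomp Require Import complex.

Set Implicit Arguments.
Unset Strict Implicit.
Unset Printing Implicit Defensive.

Import Order.TTheory GRing.Theory Num.Theory.
Import numFieldNormedType.Exports.

Local Open Scope classical_set_scope.
Local Open Scope ring_scope.
Local Open Scope complex_scope.

(* As for n.-tuple T in MathComp-Analysis, 'rV[R]_n carries the sigma-algebra
   generated by the coordinates; it is the Borel sigma-algebra of R^n, see
   measurable_rVE below. *)
Definition measure_rV_display : measure_display.
Proof. exact: default_measure_display. Qed.

Section measurable_rV.
Context (R : realType) (n : nat).

Definition rV_coord (i : 'I_n) (x : 'rV[R]_n) : R := x ord0 i.

Let rV_set0 : g_sigma_preimage rV_coord set0.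
Proof. exact: sigma_algebra0. Qed.

Let rV_setC B : g_sigma_preimage rV_coord B -> g_sigma_preimage rV_coord (~` B).
Proof. exact: sigma_algebraC. Qed.

Let rV_bigcup (F : _^nat) : (forall i, g_sigma_preimage rV_coord (F i)) ->
  g_sigma_preimage rV_coord (\bigcup_i (F i)).
Proof. exact: sigma_algebra_bigcup. Qed.

HB.instance Definition _ := @isMeasurable.Build measure_rV_display
  'rV[R]_n (g_sigma_preimage rV_coord) rV_set0 rV_setC rV_bigcup.

End measurable_rV.

Lemma measurable_rV_coord (R : realType) n (i : 'I_n) :
  measurable_fun [set: 'rV[R]_n] (rV_coord i).
Proof.
move=> _ B mB; rewrite setTI; apply: sub_sigma_algebra => /=.
rewrite -bigcup_seq/=; exists i => /=; first by rewrite mem_index_enum.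
by exists B => //; rewrite setTI.
Qed.

Lemma measurable_fun_rVP disp (T : measurableType disp) (R : realType) n
    (f : T -> 'rV[R]_n) :
  measurable_fun setT f <->
  forall i, measurable_fun setT (fun t => f t ord0 i).
Proof.
split=> [mf i|mf].
  exact: (measurableT_comp (measurable_rV_coord i) mf).
apply: (@measurability _ _ _ _ setT f
  (\big[setU/set0]_(i < n) preimage_set_system setT (@rV_coord R n i) measurable)).
  by [].
move=> _ [B + <-]; rewrite -bigcup_seq => -[i _ [C mC <-]].
by rewrite !setTI -[X in _ X]setTI; exact: mf.
Qed.

Lemma measurable_rV_box (R : realType) n (B : 'I_n -> set R) :
  (forall i, measurable (B i)) ->
  measurable [set x : 'rV[R]_n | forall i, B i (x ord0 i)].
Proof.
move=> mB.
have -> : [set x : 'rV[R]_n | forall i, B i (x ord0 i)] =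
    \bigcap_(i in [set: 'I_n]) (rV_coord i @^-1` B i).
  by apply/seteqP; split => x /= xB i *; exact: xB.
apply: fin_bigcap_measurable => // i _.
by rewrite -[X in _ X]setTI; exact: measurable_rV_coord.
Qed.

Lemma measurable_rVE (R : realType) n :
  @measurable _ 'rV[R]_n = <<s (@open 'rV[R]_n) >>.
Proof.
apply/seteqP; split.
  apply: smallest_sub; first exact: smallest_sigma_algebra.
  move=> B; rewrite -bigcup_seq => -[i _ [C mC <-]].
  have : measurable_fun (setT : set (g_sigma_algebraType (@open 'rV[R]_n)))
      (fun x : 'rV[R]_n => x ord0 i).
    apply: (measurability _ (measurable_realfun.RGenOpens.measurableE R)).
    move=> _ [_ [a [b ->]] <-]; rewrite setTI; apply: sub_sigma_algebra.
    by apply: open_comp; [move=> x _; exact: coord_continuous|exact: interval_open].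
  by move/(_ measurableT C mC).
apply: smallest_sub; first exact: sigma_algebra_measurable.
move=> U oU.
pose box (q : 'rV[rat]_n * 'rV[rat]_n) := [set x : 'rV[R]_n |
  forall i, `]ratr (q.1 ord0 i), ratr (q.2 ord0 i)[%classic (x ord0 i)].
have -> : U = \bigcup_q (if `[< box q `<=` U >] then box q else set0).
  apply/seteqP; split => [x Ux|x [q _]]; last first.
    by case: ifPn => [/asboolP|_ []]; apply.
  have /nbhs_ballP[e /= e0 eU] : nbhs x U by exact: open_nbhs_nbhs.
  have /choice[f fP] : forall i, exists q : rat * rat,
      x ord0 i - e < ratr q.1 < x ord0 i /\ x ord0 i < ratr q.2 < x ord0 i + e.
    move=> i.
    have [|q1 /=] := @rat_in_itvoo R (x ord0 i - e) (x ord0 i).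
      by rewrite ltrBlDr ltrDl.
    rewrite in_itv/= => q1P.
    have [|q2 /=] := @rat_in_itvoo R (x ord0 i) (x ord0 i + e).
      by rewrite ltrDl.
    by rewrite in_itv/= => q2P; exists (q1, q2).
  exists (\row_i (f i).1, \row_i (f i).2) => //; rewrite ifT.
    move=> i /=; rewrite !mxE in_itv/=.
    by have [/andP[_ ->] /andP[-> _]] := fP i.
  apply/asboolP => y yb; apply: eU; split => // i j.
  rewrite (ord1 i) /ball/= ltr_distlC.
  have := yb j; rewrite /= !mxE in_itv/= => /andP[y1 y2].
  have [/andP[f1 f2] /andP[f3 f4]] := fP j.
  by rewrite (lt_trans f1 y1) (lt_trans y2 f4).
apply: countable_bigcupT_measurable => [|q]; first exact: countableP.
case: ifP => // _.
pose B i : set R := `]ratr (q.1 ord0 i), ratr (q.2 ord0 i)[%classic.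
by apply: (@measurable_rV_box _ _ B) => i; exact: measurable_itv.
Qed.

Section lebesgue_rV.
Context (R : realType).

Definition rV_cons n (p : 'rV[R]_n * measurableTypeR R) : 'rV[R]_n.+1 :=
  \row_i oapp (p.1 ord0) p.2 (unlift ord0 i).

Definition rV_uncons n (x : 'rV[R]_n.+1) : 'rV[R]_n * measurableTypeR R :=
  (\row_j x ord0 (lift ord0 j), x ord0 ord0).

Lemma rV_cons0 n p : @rV_cons n p ord0 ord0 = p.2.
Proof. by rewrite mxE unlift_none. Qed.

Lemma rV_consS n p i : @rV_cons n p ord0 (lift ord0 i) = p.1 ord0 i.
Proof. by rewrite mxE liftK. Qed.

Lemma rV_consK n : cancel (@rV_cons n) (@rV_uncons n).
Proof.
move=> [v a]; rewrite /rV_uncons rV_cons0; congr pair.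
by apply/rowP => j; rewrite mxE rV_consS.
Qed.

Lemma measurable_rV_cons n : measurable_fun setT (@rV_cons n).
Proof.
apply/measurable_fun_rVP => i; case: (unliftP ord0 i) => [j ->|->].
  under eq_fun do rewrite rV_consS.
  exact: measurableT_comp (measurable_rV_coord j) measurable_fst.
by under eq_fun do rewrite rV_cons0; exact: measurable_snd.
Qed.

Lemma measurable_rV_uncons n : measurable_fun setT (@rV_uncons n).
Proof.
apply/measurable_fun_pairP; split => /=; last exact: measurable_rV_coord.
apply/measurable_fun_rVP => i; under eq_fun do rewrite mxE.
exact: measurable_rV_coord.
Qed.

Section rV_cons_measure.
Context n (m : {sigma_finite_measure set 'rV[R]_n -> \bar R}).

Let mu := pushforward (m \x (@lebesgue_measure R))%E (@rV_cons n).

Let mu0 : mu set0 = 0%E.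
Proof. by rewrite /mu /pushforward preimage_set0 measure0. Qed.

Let mu_ge0 B : (0 <= mu B)%E.
Proof. exact: (measure_ge0 (m \x (@lebesgue_measure R))%E). Qed.

Let mu_sigma_additive : semi_sigma_additive mu.
Proof.
exact: (@measure_semi_sigma_additive _ _ _
  (measure_function_pushforward__canonical__measure_function_Measure
     (m \x (@lebesgue_measure R))%E (@measurable_rV_cons n))).
Qed.

HB.instance Definition _ := isMeasure.Build _ _ _ mu
  mu0 mu_ge0 mu_sigma_additive.

Let mu_sigma_finite : sigma_finite setT mu.
Proof.
have /sigma_finiteP[F [TF ndF Foo]] := sigma_finiteT m.
have /sigma_finiteP[G [TG ndG Goo]] := sigma_finiteT (@lebesgue_measure R).
exists (fun k => @rV_uncons n @^-1` (F k `*` G k)) => [|k].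
  apply/esym; rewrite -subTset => x _.
  have : setT (rV_uncons x).1 by []; rewrite TF => -[i _ Fi].
  have : setT (rV_uncons x).2 by []; rewrite TG => -[j _ Gj].
  exists (maxn i j) => //; split.
    by apply: (subsetPset _ _ (ndF _ _ (leq_maxl i j))).
  by apply: (subsetPset _ _ (ndG _ _ (leq_maxr i j))).
have [[mF Fk] [mG Gk]] := (Foo k, Goo k); split.
  rewrite -[X in _ X]setTI; apply: measurable_rV_uncons => //.
  exact: measurableX.
rewrite /mu /pushforward -comp_preimage (_ : _ \o _ = id) ?preimage_id.
  by rewrite product_measure1E// lte_mul_pinfty// ge0_fin_numE.
by apply/funext => x /=; rewrite rV_consK.
Qed.

HB.instance Definition _ := Measure_isSigmaFinite.Build _ _ _ mu
  mu_sigma_finite.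

Definition rV_cons_measure : {sigma_finite_measure set 'rV[R]_n.+1 -> \bar R} :=
  mu.

End rV_cons_measure.

Fixpoint lebesgue_rV (n : nat) : {sigma_finite_measure set 'rV[R]_n -> \bar R} :=
  if n is m.+1 then rV_cons_measure (lebesgue_rV m)
  else dirac (0 : 'rV[R]_0).

Lemma lebesgue_rV_box n (B : 'I_n -> set R) :
  (forall i, measurable (B i)) ->
  lebesgue_rV n [set x | forall i, B i (x ord0 i)] =
  (\prod_(i < n) lebesgue_measure (B i))%E.
Proof.
elim: n B => [|n IH] B mB /=.
  rewrite big_ord0 diracE mem_set//= => -[]//.
rewrite /pushforward (_ : _ @^-1` _ =
    [set x : 'rV[R]_n | forall i, B (lift ord0 i) (x ord0 i)] `*` B ord0).
  have mH := @measurable_rV_box R n (fun i => B (lift ord0 i)) (fun i => mB _).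
  rewrite product_measure1E//=; last exact: mB.
  by rewrite (IH (fun i => B (lift ord0 i)))// big_ord_recl muleC.
apply/seteqP; split => -[v a] /= H.
  by split=> [i|]; [rewrite -[v _ _](rV_consS (v, a))|
                    rewrite -[a](rV_cons0 (v, a))].
move=> i; case: (unliftP ord0 i) => [j ->|->].
  by rewrite rV_consS; exact: H.1.
by rewrite rV_cons0; exact: H.2.
Qed.

End lebesgue_rV.
Arguments lebesgue_rV {R} n.

Section euclidean.
Context (R : realType) (d : nat).
Implicit Types (x y : 'rV[R]_d) (M : 'M[R]_d).

Definition dotrV x y : R := \sum_(i < d) x ord0 i * y ord0 i.

(* The library's norm `|x| on 'rV[R]_d is the sup norm. *)
Definition enorm x : R := Num.sqrt (dotrV x x).

Definition mxact M x : 'rV[R]_d := x *m M^T.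

Definition opnorm M : R := sup [set enorm (mxact M x) | x in [set x | enorm x <= 1]].

Definition nonneg_definite M := forall x, 0 <= dotrV x (mxact M x).

End euclidean.

Section complex_valued.
Context (R : realType).

Definition cexp (z : R[i]) : R[i] :=
  (expR (complex.Re z) * cos (complex.Im z)) +i*
  (expR (complex.Re z) * sin (complex.Im z)).

Context (disp : measure_display) (T : measurableType disp)
  (mu : {measure set T -> \bar R}).

Definition cintegrable (f : T -> R[i]) : Prop :=
  mu.-integrable setT (EFin \o (@complex.Re R \o f)) /\
  mu.-integrable setT (EFin \o (@complex.Im R \o f)).

Definition cintegral (f : T -> R[i]) : R[i] :=
  (\int[mu]_x complex.Re (f x))%R +i* (\int[mu]_x complex.Im (f x))%R.

End complex_valued.

Section levy_process.
Context (R : realType) (d : nat) (disp : measure_display)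
  (Omega : measurableType disp) (P : probability Omega R).

Definition mutually_independent n (X : 'I_n -> Omega -> 'rV[R]_d) : Prop :=
  forall B : 'I_n -> set 'rV[R]_d, (forall i, measurable (B i)) ->
  P (\bigcap_(i in [set: 'I_n]) (X i @^-1` B i)) =
  (\prod_(i < n) P (X i @^-1` B i))%E.

(* Only the times t >= 0 matter; the values of Y at negative times are
   unconstrained. *)
Record levy_process (Y : R -> Omega -> 'rV[R]_d) : Prop := LevyProcess {
  levy_measurable : forall t, 0 <= t -> measurable_fun setT (Y t) ;
  levy_start : {ae P, forall w, Y 0 w = 0} ;
  levy_independent_increments : forall (n : nat) (t : nat -> R),
    0 <= t 0%N -> (forall i, (i < n)%N -> t i < t i.+1) ->
    mutually_independent (fun (i : 'I_n) w => Y (t i.+1) w - Y (t i) w) ;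
  levy_stationary_increments : forall s t, 0 <= s -> 0 <= t ->
    forall B : set 'rV[R]_d, measurable B ->
    P [set w | B (Y (s + t) w - Y s w)] = P [set w | B (Y t w - Y 0 w)] ;
  levy_stochastically_continuous : forall t e, 0 <= t -> 0 < e ->
    P [set w | e < enorm (Y s w - Y t w)]
      @[s --> within [set s | 0 <= s] (nbhs t)] --> 0%E ;
  levy_cadlag : {ae P, forall w,
    (forall t, 0 <= t -> Y s w @[s --> t^'+] --> Y t w) /\
    (forall t, 0 < t -> cvg (Y s w @[s --> t^'-]))} }.

End levy_process.

Definition levy_measure (R : realType) (d : nat)
    (N : {measure set 'rV[R]_d -> \bar R}) : Prop :=
  N [set 0] = 0%E /\
  (\int[N]_z (Num.min 1 (enorm z ^+ 2))%:E < +oo)%E.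

Section triplet.
Context (R : realType) (d : nat) (A : 'M[R]_d)
  (N : {measure set 'rV[R]_d -> \bar R}) (b : 'rV[R]_d).

(* 'i%C is Complex 0 1; a bare 'i would be the Num.imaginary of R[i]. *)
Definition char_exponent (x : 'rV[R]_d) : R[i] :=
  (dotrV x (mxact A x))%:C - 'i%C * (dotrV x b)%:C
  - cintegral N (fun z => cexp ('i%C * (dotrV x z)%:C) - 1
      - 'i%C * (dotrV x z * \1_[set z | enorm z < 1] z)%:C).

Definition re_char_exponent (x : 'rV[R]_d) : R := complex.Re (char_exponent x).

Definition char_exponent_max (r : R) : R :=
  sup [set re_char_exponent z | z in [set z | enorm z <= r]].

Definition exp_char_exponent (t : R) (z : 'rV[R]_d) : R[i] :=
  cexp (- (t%:C * char_exponent z)).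

Definition concentration (r : R) : R :=
  r ^- 2 * opnorm A +
  (\int[N]_x Num.min 1 (enorm x ^+ 2 / r ^+ 2))%R.

Definition concentration_inv : R -> R :=
  'pinv_(fun=> 0) [set r | 0 < r] concentration.

End triplet.

Definition levy_process_with_triplet (R : realType) (d : nat)
    (disp : measure_display) (Omega : measurableType disp)
    (P : probability Omega R) (Y : R -> Omega -> 'rV[R]_d)
    (A : 'M[R]_d) (N : {measure set 'rV[R]_d -> \bar R}) (b : 'rV[R]_d) : Prop :=
  [/\ levy_process P Y, A^T = A /\ nonneg_definite A, levy_measure N &
      forall t x, 0 <= t ->
      cintegral P (fun w => cexp ('i%C * (dotrV x (Y t w))%:C)) =
      exp_char_exponent A N b t x].

(* p is a density of the law of X, where phi z = E e^{i<z, X>}; when phi is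
   integrable, p is moreover required to be the continuous version given
   everywhere by Fourier inversion. *)
Definition is_density (R : realType) (d : nat)
    (disp : measure_display) (Omega : measurableType disp)
    (P : probability Omega R) (X : Omega -> 'rV[R]_d)
    (phi : 'rV[R]_d -> R[i]) (p : 'rV[R]_d -> R) : Prop :=
  [/\ measurable_fun setT p, forall x, 0 <= p x,
      forall B, measurable B ->
        P (X @^-1` B) = (\int[lebesgue_rV d]_(x in B) (p x)%:E)%E &
      cintegrable (lebesgue_rV d) phi -> forall x,
        (p x)%:C = ((2 * pi) ^- d)%:C *
          cintegral (lebesgue_rV d) (fun z => cexp (- ('i%C * (dotrV x z)%:C)) * phi z)].

(* Main.v *)
(* Write psi = Re Psi, g(t) = h^-1(1/t) and dir(x) = <x,Ax> + int min(1, <x,z>^2) N(dz).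
   Up to constants psi(x) <= dir(x) <= h(1/|x|), h(1/r) and Psi^*(r) are comparable, and the
   truncated integral of (D4) is at most psi(x).
   (D1) => (D2): Plancherel's inequality bounds the integral of |e^{-t Psi}|^2 = e^{-2t psi} by
   sup p(t,.); integrating only over |z| <= 1/g(t/2), where t psi is bounded, shows
   g(t) <= C g(t/2), which replaces 2t by t.
   (D2) => (D3): the same doubling inequality says h(Cr) <= h(r)/2 for large r, hence the power
   scaling.  If psi(x) were much smaller than h(1/|x|), then by psi(kx) <= 4^k psi(x) it would
   be small near many multiples of x, and disjoint cubes around them would violate (D2).
   (D3) => (D4): the scaling gives dir(lx) <= dir(x)/2 for some l, so at lx the truncated part
   of dir carries at least a fixed proportion.
   (D4) => (D1): the truncated part dominates dir, so dir(x/2) <= q dir(x) with q < 1; this is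
   a power scaling of h, whence t psi(x) >= c (g(t)|x|)^alpha near 0.  Away from 0, psi is
   bounded below because some e^{-t0 psi} is integrable (again by packing cubes).  Thus
   e^{-t psi} is integrable with the bound of (D2), and the density is given by inversion. *)

From HB Require Import structures.
Require Import Defs.
From mathcomp Require Import all_boot all_order all_algebra.
From mathcomp Require Import all_classical all_reals all_analysis.
From mathcomp Require Import measurable_realfun complex ring lra.

Set Implicit Arguments.
Unset Strict Implicit.
Unset Printing Implicit Defensive.

Import Order.TTheory GRing.Theory Num.Theory.
Import numFieldNormedType.Exports.

Local Open Scope classical_set_scope.
Local Open Scope ring_scope.

(** * One-dimensional kernels *)

(** Along a ray [psi] need not be monotone, because cosines oscillate. The estimates therefore run
    on two better behaved quantities: [dir_conc], monotone along rays with derivative governed by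
    [dir_trunc], and h, decreasing with r^2 h(r) nondecreasing. Two facts lead back to [psi].
    Averaging along the axes bounds h(1/r) by d^3 + 24 d times the maximum of [psi] on the ball of
    radius r. The inequality psi(x + y) <= 2 psi(x) + 2 psi(y) turns one very small value of [psi]
    into a whole arithmetic progression of small values; its length K is fixed beforehand by the
    constant to be contradicted, so a loss of 4^K is harmless. The Fourier analysis is regularised
    by exp(- e sum |z_i|). This kernel and its transform, a product of Cauchy kernels, are
    nonnegative, factor over the coordinates and have elementary primitives, so Plancherel's
    inequality and inversion both reduce to one-dimensional integrals and a limit e -> 0. Cauchy
    products return in (D4) => (D1) as majorants whose integral over R^d is computed without polar
    coordinates. *)

Section integral_oppr.
Context {R : realType}.
Local Notation mu := lebesgue_measure.

Let ge0_integral_split0 (g : R -> \bar R) :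
  measurable_fun [set: R] g -> (forall r, 0 <= g r)%E ->
  (\int[mu]_r g r = \int[mu]_(r in `]-oo, 0%R]) g r + \int[mu]_(r in `[0%R, +oo[) g r)%E.
Proof.
move=> mg g0.
rewrite -(setUv `[0%R, +oo[%classic) ge0_integral_setU//=; last 3 first.
- exact: measurableC.
- by rewrite setUv.
- exact/disj_setPCl.
rewrite addeC setCitvr integral_itv_bndo_bndc//.
exact: measurable_funTS.
Qed.

Lemma ge0_integral_oppr (f : R -> \bar R) :
  measurable_fun [set: R] f -> (forall r, 0 <= f r)%E ->
  (\int[mu]_r f r = \int[mu]_r f (- r)%R)%E.
Proof.
move=> mf f0.
have mfN : measurable_fun [set: R] (fun r => f (- r)) by exact: measurableT_comp.
rewrite ge0_integral_split0// [RHS]ge0_integral_split0// addeC.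
congr (_ + _)%E; first exact: ge0_integration_by_substitution0.
rewrite [RHS]ge0_integration_by_substitution0//.
by apply: eq_integral => r _; rewrite opprK.
Qed.

End integral_oppr.

Section laplace_density.
Context {R : realType}.
Implicit Types (e x z : R).
Local Notation mu := lebesgue_measure.

(** The regularising kernel: its Fourier transform is twice [cauchy e], so both sides of the
    smoothed inversion formula are explicit. *)
Definition laplace e z : R := expR (- (e * `|z|)).

Lemma laplace_ge0 e z : 0 <= laplace e z. Proof. exact: expR_ge0. Qed.

Lemma laplace_le1 e z : 0 <= e -> laplace e z <= 1.
Proof. by move=> e0; rewrite expR_le1 oppr_le0 mulr_ge0. Qed.

Lemma continuous_laplace e : continuous (laplace e).
Proof.
move=> z; apply: continuous_comp; last exact: continuous_expR.
apply: (@continuousN _ R^o); apply: (@continuousM _ R^o); first exact: cst_continuous.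
exact: norm_continuous.
Qed.

Lemma measurable_laplace e : measurable_fun [set: R] (laplace e).
Proof. by apply: continuous_measurable_fun; exact: continuous_laplace. Qed.

Lemma cvg_expRM_bounded e (f : R -> R) : 0 < e -> (exists M, forall z, `|f z| <= M) ->
  expR (- (e * z)) * f z @[z --> +oo] --> 0.
Proof.
move=> e0 [M fM]; apply/cvgr0Pnorm_lt => /= r r0.
have M0 : 0 <= M by apply: le_trans (fM 0).
near=> z.
have z0 : 0 < z by near: z; exact: nbhs_pinfty_gt.
rewrite normrM ger0_norm ?expR_ge0// expRN mulrC ltr_pdivrMr ?expR_gt0//.
apply: (le_lt_trans (fM z)).
apply: (@lt_le_trans _ _ (r * (e * z))).
  rewrite mulrA mulrC -ltr_pdivrMr ?mulr_gt0//.
  by near: z; apply: nbhs_pinfty_gt; rewrite num_real.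
rewrite ler_pM2l//; apply: le_trans (expR_ge1Dx _).
by rewrite lerDr.
Unshelve. all: by end_near. Qed.

(** The summand 1 keeps the integrand nonnegative, so the fundamental theorem on a half-line applies
    before integrability is known. The case x = 0 gives the mass of [laplace e], and subtracting it
    leaves the cosine transform. *)
Lemma integral_laplace_1cos e x : 0 < e ->
  (\int[mu]_z (laplace e z * (1 + cos (x * z)))%:E =
   (2 * (e^-1 + e / (e ^+ 2 + x ^+ 2)))%:E)%E.
Proof.
move=> e0; have s0 : e ^+ 2 + x ^+ 2 != 0.
  by rewrite gt_eqF// ltr_pwDl ?exprn_gt0 ?sqr_ge0.
have ccos : continuous (fun z : R => 1 + cos (x * z)).
  move=> z; apply: (@continuousD _ R^o R^o); first exact: cst_continuous.
  apply: continuous_comp; last exact: continuous_cos.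
  by apply: (@continuousM _ R^o); [exact: cst_continuous|].
rewrite ge0_symfun_integralT; last 3 first.
- move=> z; rewrite mulr_ge0 ?laplace_ge0//.
- by move=> z; apply: (@continuousM _ R^o); [exact: continuous_laplace|exact: ccos].
- by move=> z /=; rewrite /laplace normrN mulrN cosN.
rewrite EFinM; congr (_ * _)%E.
rewrite -set_itvcy.
(* A primitive, written as exp(- e z) times a bounded factor so that it visibly tends to 0 at
   infinity; the integral is then [- F 0]. *)
pose F z : R := expR (- (e * z)) *
  ((x * sin (x * z) - e * cos (x * z)) / (e ^+ 2 + x ^+ 2) - e^-1).
under eq_integral => z.
  rewrite inE/= in_itv/= andbT => z0.
  rewrite /laplace ger0_norm//. over.
have cf : continuous (fun z : R => expR (- (e * z)) * (1 + cos (x * z))).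
  by move=> z; apply/differentiable_continuous/derivable1_diffP/ex_derive.
rewrite (@ge0_continuous_FTC2y _ _ F _ 0).
- rewrite /F !mulr0 oppr0 expR0 sin0 cos0 mul1r -EFinB; congr EFin.
  by field; rewrite s0 gt_eqF.
- by move=> z _; rewrite mulr_ge0 ?expR_ge0//.
- apply: continuous_subspaceT; exact: cf.
- apply: cvg_expRM_bounded => //.
  exists ((`|x| + e) / (e ^+ 2 + x ^+ 2) + e^-1) => z.
  apply: (le_trans (ler_normB _ _)); apply: lerD; last by rewrite ger0_norm// invr_ge0 ltW.
  rewrite normrM [X in _ * X]ger0_norm; last by rewrite invr_ge0 addr_ge0 ?sqr_ge0.
  rewrite ler_wpM2r// ?invr_ge0 ?addr_ge0 ?sqr_ge0//.
  apply: (le_trans (ler_normB _ _)); apply: lerD; rewrite normrM.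
    rewrite ler_piMr// ler_norml; apply/andP; split; [exact: sin_geN1|exact: sin_le1].
  rewrite (gtr0_norm e0) ler_piMr ?(ltW e0)// ler_norml; apply/andP; split;
    [exact: cos_geN1|exact: cos_le1].
- by move=> z _; rewrite /F; apply: ex_derive.
- by apply/cvg_at_right_filter/differentiable_continuous/derivable1_diffP/ex_derive.
- move=> z _; rewrite derive1E /F; apply: derive_val.
  apply: is_derive_eq; rewrite /GRing.scale /=.
  by field; rewrite s0 gt_eqF.
Qed.

Lemma integral_laplace e : 0 < e -> (\int[mu]_z (laplace e z)%:E = (2 / e)%:E)%E.
Proof.
move=> e0; have := integral_laplace_1cos 0 e0.
under eq_integral do rewrite mul0r cos0 mulrC EFinM.
rewrite ge0_integralZl_EFin//; last 2 first.
- by move=> z _; rewrite lee_fin laplace_ge0.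
- by apply/measurable_EFinP; exact: measurable_laplace.
case: (integral _ _ _) => [r|//|//].
- rewrite -EFinM => -[] h; congr EFin.
  have : (1 + 1) * r = (1 + 1) * (2 / e) by rewrite h; field; rewrite gt_eqF.
  by move/mulfI; apply; lra.
- by rewrite mulry gtr0_sg ?mul1e//; lra.
- by rewrite mulrNy gtr0_sg ?mul1e//; lra.
Qed.

Lemma integrable_laplace e : 0 < e -> mu.-integrable setT (EFin \o laplace e).
Proof.
move=> e0; apply/integrableP; split; first by apply/measurable_EFinP; exact: measurable_laplace.
under eq_integral => z _.
  rewrite /= ger0_norm ?laplace_ge0//. over.
by rewrite integral_laplace// ltry.
Qed.

Lemma integrable_laplaceM e (f : R -> R) : 0 < e -> measurable_fun setT f ->
  (forall z, `|f z| <= 1) -> mu.-integrable setT (fun z => (laplace e z * f z)%:E).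
Proof.
move=> e0 mf f1; apply: (le_integrable _ _ _ (integrable_laplace e0)) => //.
  apply/measurable_EFinP; apply: measurable_funM => //; exact: measurable_laplace.
by move=> z _ /=; rewrite lee_fin normrM ler_piMr.
Qed.

Lemma measurable_cosM x : measurable_fun setT (fun z : R => cos (x * z)).
Proof.
apply: continuous_measurable_fun.
by move=> z; apply/differentiable_continuous/derivable1_diffP/ex_derive.
Qed.

Lemma measurable_sinM x : measurable_fun setT (fun z : R => sin (x * z)).
Proof.
apply: continuous_measurable_fun.
by move=> z; apply/differentiable_continuous/derivable1_diffP/ex_derive.
Qed.

Lemma norm_cos_le1 x : `|cos x| <= 1.
Proof. by rewrite ler_norml cos_geN1 cos_le1. Qed.

Lemma norm_sin_le1 x : `|sin x| <= 1.
Proof. by rewrite ler_norml sin_geN1 sin_le1. Qed.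

Lemma Rintegral_laplace_cos e x : 0 < e ->
  \int[mu]_z (laplace e z * cos (x * z)) = 2 * e / (e ^+ 2 + x ^+ 2).
Proof.
move=> e0; have := integral_laplace_1cos x e0.
under eq_integral do rewrite mulrDr mulr1 EFinD.
rewrite integralD//; last 2 first.
- exact: integrable_laplace.
- by apply: integrable_laplaceM => // [|z]; [exact: measurable_cosM|exact: norm_cos_le1].
rewrite integral_laplace// /Rintegral.
have /integrable_fin_num : mu.-integrable setT (fun z => (laplace e z * cos (x * z))%:E).
  by apply: integrable_laplaceM => // [|z]; [exact: measurable_cosM|exact: norm_cos_le1].
move=> /(_ measurableT) /fineK {1}<-; rewrite -EFinD => -[] h.
have s0 : e ^+ 2 + x ^+ 2 != 0.
  by rewrite gt_eqF// ltr_pwDl ?exprn_gt0 ?sqr_ge0.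
apply: (addrI (2 / e)); rewrite h.
by field; rewrite s0 gt_eqF.
Qed.

Lemma Rintegral_odd (f : R -> R) : mu.-integrable setT (EFin \o f) ->
  (forall z, f (- z) = - f z) -> \int[mu]_z f z = 0.
Proof.
move=> fi fodd; have mf := measurable_int _ fi.
rewrite /Rintegral integralE ge0_integral_oppr//; last first.
  by apply: measurable_funepos; exact: mf.
rewrite [X in (X - _)%E](_ : _ = \int[mu]_x (EFin \o f)^\- x)%E; last first.
  by apply: eq_integral => r _; rewrite funeposE funenegE /= fodd EFinN.
rewrite subee//; apply: integrable_fin_num => //; exact: integrable_funeneg.
Qed.

Lemma Rintegral_laplace_sin e x : 0 < e ->
  \int[mu]_z (laplace e z * sin (x * z)) = 0.
Proof.
move=> e0; apply: Rintegral_odd.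
  by apply: integrable_laplaceM => // [|z]; [exact: measurable_sinM|exact: norm_sin_le1].
by move=> z; rewrite /laplace normrN mulrN sinN mulrN.
Qed.

End laplace_density.

(** * The Cauchy kernel *)

Section cauchy_density.
Context {R : realType}.
Implicit Types (e x y a b : R).
Local Notation mu := lebesgue_measure.

Definition cauchy e x : R := e / (e ^+ 2 + x ^+ 2).

Lemma cauchy_ge0 e x : 0 <= e -> 0 <= cauchy e x.
Proof. by move=> e0; rewrite divr_ge0// addr_ge0 ?sqr_ge0. Qed.

Let den_neq0 e x : 0 < e -> e ^+ 2 + x ^+ 2 != 0.
Proof. by move=> e0; rewrite gt_eqF// ltr_pwDl ?exprn_gt0 ?sqr_ge0. Qed.

Lemma continuous_cauchy e y : 0 < e -> continuous (fun x => cauchy e (x - y)).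
Proof.
move=> e0 x; apply/differentiable_continuous/derivable1_diffP.
have h := den_neq0 (x - y) e0.
rewrite /cauchy.
by apply: derivableM => //; apply: derivableV.
Qed.

Lemma measurable_cauchy e y : 0 < e ->
  measurable_fun [set: R] (fun x => cauchy e (x - y)).
Proof. by move=> e0; apply: continuous_measurable_fun; exact: continuous_cauchy. Qed.

Lemma integral_cauchy_itv e y a b : 0 < e -> a < b ->
  (\int[mu]_(x in `[a, b]) (cauchy e (x - y))%:E =
   (atan ((b - y) / e) - atan ((a - y) / e))%:E)%E.
Proof.
move=> e0 ab.
have dF x : is_derive x 1 (fun x => atan ((x - y) / e)) (cauchy e (x - y)).
  apply: is_derive_eq; rewrite /GRing.scale/= /cauchy.
  have h := den_neq0 (x - y) e0.
  have e1 : e != 0 by rewrite gt_eqF.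
  by field; rewrite e1 h.
rewrite (@continuous_FTC2 _ _ (fun x => atan ((x - y) / e)))// ?EFinB//.
- by apply: continuous_subspaceT; exact: continuous_cauchy.
- split=> [x _||]; first exact: ex_derive.
    by apply/cvg_at_right_filter/differentiable_continuous/derivable1_diffP/ex_derive.
  by apply/cvg_at_left_filter/differentiable_continuous/derivable1_diffP/ex_derive.
- by move=> x _; rewrite derive1E; exact: derive_val.
Qed.

(** Each interval of an exhaustion contributes a difference of two arctangents, hence less than pi;
    no limit at infinity has to be computed. *)
Lemma integral_cauchy_le e y : 0 < e ->
  (\int[mu]_x (cauchy e (x - y))%:E <= pi%:E)%E.
Proof.
move=> e0.
have mc : measurable_fun [set: R] (fun x => (cauchy e (x - y))%:E).
  by apply/measurable_EFinP; exact: measurable_cauchy.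
pose F (i : nat) : set (measurableTypeR R) := `[(- i.+1%:R)%R, i.+1%:R%R]%classic.
have UF : \bigcup_i F i = [set: R].
  rewrite -subTset => x _; exists (Num.truncn `|x|) => //=.
  by rewrite /F /= in_itv/= -ler_norml ltW// truncnS_gt.
have ndF : nondecreasing_seq F.
  move=> i j ij; apply/subsetPset => x; rewrite /F /= !in_itv/= => /andP[h1 h2].
  have ij' : i.+1%:R <= j.+1%:R :> R by rewrite ler_nat.
  by apply/andP; split; lra.
rewrite -[X in (\int[_]_(_ in X) _)%E]UF.
have := @ge0_nondecreasing_set_cvg_integral _ _ R F
  (fun x => (cauchy e (x - y))%:E) mu ndF.
move=> /(_ _ _ _)/cvg_lim <-//; last 3 first.
- by move=> i; exact: measurable_itv.
- by move=> i; exact: measurable_funTS.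
- by move=> i x _; rewrite lee_fin cauchy_ge0// ltW.
apply: lime_le.
  apply: ereal_nondecreasing_is_cvgn.
  apply: ge0_nondecreasing_set_nondecreasing_integral => //.
  - by move=> i; exact: measurable_itv.
  - by move=> i; exact: measurable_funTS.
  - by move=> i x _; rewrite lee_fin cauchy_ge0// ltW.
apply: nearW => i; rewrite integral_cauchy_itv//; last first.
  by apply: (@lt_le_trans _ _ 0); rewrite ?oppr_lt0.
rewrite lee_fin; have := atan_ltpi2 ((i.+1%:R - y) / e).
have := atan_gtNpi2 ((- i.+1%:R - y) / e); lra.
Qed.

End cauchy_density.

(** * Integration on R^d *)

Section dominated_fubini.
Context {d1 d2 : measure_display} {T1 : measurableType d1} {T2 : measurableType d2}
  {R : realType} (m1 : {sigma_finite_measure set T1 -> \bar R})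
  (m2 : {sigma_finite_measure set T2 -> \bar R}).
Variables (f : T1 * T2 -> R) (k : T1 -> R) (l : T2 -> R).
Hypothesis mf : measurable_fun setT f.
Hypothesis ik : m1.-integrable setT (EFin \o k).
Hypothesis il : m2.-integrable setT (EFin \o l).
Hypothesis fkl : forall p, `|f p| <= k p.1 * l p.2.

Let mEf : measurable_fun setT (EFin \o f).
Proof. exact/measurable_EFinP. Qed.

Lemma dominated_integrable_prod : (m1 \x m2)%E.-integrable setT (EFin \o f).
Proof.
apply/integrable12ltyP => //.
have ik' : m1.-integrable setT (EFin \o (fun x => `|k x|)) by exact: integrable_norm.
have il' : m2.-integrable setT (EFin \o (fun x => `|l x|)) by exact: integrable_norm.
have lfin : (\int[m2]_y (`|l y|)%:E)%E \is a fin_num by exact: integrable_fin_num.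
apply: (@le_lt_trans _ _ (\int[m1]_x ((`|k x|)%:E * \int[m2]_y (`|l y|)%:E))%E).
  apply: ge0_le_integral => //.
  - by move=> x _; exact: integral_ge0.
  - have mA : measurable_fun setT (abse \o (EFin \o f)) by exact: measurableT_comp.
    apply: (measurable_fun_fubini_tonelli_F (m2 := m2) (abse \o (EFin \o f)) mA).
    by move=> ?; exact: abse_ge0.
  - by apply: emeasurable_funM => //; exact: (measurable_int _ ik').
  move=> x _; rewrite -ge0_integralZl_EFin//; last first.
    exact: (measurable_int _ il').
  apply: ge0_le_integral => //.
  - apply: (measurableT_comp (f := abse)) => //.
    apply: (measurableT_comp (f := EFin \o f)) => //; exact: pair1_measurable.
  - apply: emeasurable_funM => //; exact: (measurable_int _ il').
  - move=> y _; rewrite -EFinM lee_fin -normrM.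
    by apply: (le_trans (fkl (x, y))); exact: ler_norm.
rewrite ge0_integralZr//; last 2 first.
- exact: (measurable_int _ ik').
- exact: integral_ge0.
by rewrite lte_mul_pinfty//; [exact: integral_ge0|exact: integrable_fin_num|exact: integrable_lty].
Qed.

Lemma dominated_integrable1 x : m2.-integrable setT (fun y => (f (x, y))%:E).
Proof.
apply: (@le_integrable _ _ _ _ _ _ _ (fun y => (k x)%:E * (l y)%:E)%E) => //.
- apply: (measurableT_comp (f := EFin \o f)) => //; exact: pair1_measurable.
- move=> y _; rewrite -EFinM lee_fin.
  by apply: (le_trans (fkl (x, y))); exact: ler_norm.
- exact: integrableZl.
Qed.

Lemma dominated_integrable2 y : m1.-integrable setT (fun x => (f (x, y))%:E).
Proof.
apply: (@le_integrable _ _ _ _ _ _ _ (fun x => (l y)%:E * (k x)%:E)%E) => //.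
- apply: (measurableT_comp (f := EFin \o f)) => //; exact: pair2_measurable.
- move=> x _; rewrite -EFinM lee_fin.
  by apply: (le_trans (fkl (x, y))); rewrite mulrC; exact: ler_norm.
- exact: integrableZl.
Qed.

Let FE : fubini_F m2 (EFin \o f) = EFin \o (fun x => \int[m2]_y f (x, y)).
Proof.
apply/funext => x; rewrite /fubini_F /Rintegral /= fineK//.
exact/integrable_fin_num/dominated_integrable1.
Qed.

Let GE : fubini_G m1 (EFin \o f) = EFin \o (fun y => \int[m1]_x f (x, y)).
Proof.
apply/funext => y; rewrite /fubini_G /Rintegral /= fineK//.
exact/integrable_fin_num/dominated_integrable2.
Qed.

Lemma dominated_integrable_F :
  m1.-integrable setT (EFin \o (fun x => \int[m2]_y f (x, y))).
Proof. by rewrite -FE; exact/integrable_fubini_F/dominated_integrable_prod. Qed.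

Lemma dominated_measurable_F : measurable_fun setT (fun x => \int[m2]_y f (x, y)).
Proof. exact/measurable_EFinP/(measurable_int _ dominated_integrable_F). Qed.

Lemma dominated_measurable_G : measurable_fun setT (fun y => \int[m1]_x f (x, y)).
Proof.
apply/measurable_EFinP; rewrite -/(comp _ _) -GE.
exact/measurable_fubini_G/dominated_integrable_prod.
Qed.

Lemma Rintegral12_prod :
  \int[m1]_x (\int[m2]_y f (x, y)) = \int[(m1 \x m2)%E]_z f z.
Proof.
rewrite /Rintegral -(integral12_prod_meas1 dominated_integrable_prod).
by congr fine; rewrite FE.
Qed.

Lemma Rintegral_fubini :
  \int[m1]_x (\int[m2]_y f (x, y)) = \int[m2]_y (\int[m1]_x f (x, y)).
Proof.
rewrite Rintegral12_prod {1}/Rintegral.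
by rewrite -(integral21_prod_meas1 dominated_integrable_prod) GE.
Qed.

End dominated_fubini.

Section Rintegral_dominated_convergence.
Context {d : measure_display} {T : measurableType d} {R : realType}
  (mu : {measure set T -> \bar R}).

Lemma Rintegral_dominated_cvg (f_ : nat -> T -> R) (f g : T -> R) :
  (forall n, measurable_fun setT (f_ n)) -> (forall x, f_ n x @[n --> \oo] --> f x) ->
  mu.-integrable setT (EFin \o g) -> (forall n x, `|f_ n x| <= g x) ->
  mu.-integrable setT (EFin \o f) /\
  \int[mu]_x f_ n x @[n --> \oo] --> \int[mu]_x f x.
Proof.
move=> mf_ f_f ig f_g.
have mf : measurable_fun setT f.
  by apply: (measurable_fun_cvg _ (fun x _ => f_f x)) => n; exact: mf_.
have [|||||fi _] := @dominated_convergence _ _ _ mu setT measurableT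
  (fun n => EFin \o f_ n) (EFin \o f) (EFin \o g).
- by move=> n; apply/measurable_EFinP; exact: mf_.
- exact/measurable_EFinP.
- apply: aeW => x _; apply: cvg_EFin; last exact: f_f.
  by apply: nearW => n.
- exact: ig.
- by apply: aeW => x n _; rewrite /= lee_fin.
rewrite -[X in _ --> X](@fineK _ (\int[mu]_x (f x)%:E)%E) => [h|].
  by split => //; exact: (fine_cvg h).
exact: integrable_fin_num.
Qed.

End Rintegral_dominated_convergence.

Section lebesgue_rV_integral.
Context {R : realType}.
Local Notation mu := (@lebesgue_measure R).

Lemma ge0_integral_rVS n (f : 'rV[R]_n.+1 -> \bar R) :
  measurable_fun setT f -> (forall x, 0 <= f x)%E ->
  (\int[lebesgue_rV n.+1]_x f x =
   \int[lebesgue_rV n]_v \int[mu]_a f (rV_cons (v, a)))%E.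
Proof.
move=> mf f0.
transitivity (\int[(lebesgue_rV n \x mu)%E]_p (f \o @rV_cons R n) p)%E.
  rewrite -[in RHS](preimage_setT (@rV_cons R n)).
  rewrite -ge0_integral_pushforward//.
  exact: measurable_rV_cons.
rewrite (fubini_tonelli1 (f \o @rV_cons R n))//.
  exact: (measurableT_comp mf (@measurable_rV_cons R n)).
by move=> p; exact: f0.
Qed.

Lemma integrable_rVS n (f : 'rV[R]_n.+1 -> R) k l :
  measurable_fun setT f ->
  (lebesgue_rV n).-integrable setT (EFin \o k) -> mu.-integrable setT (EFin \o l) ->
  (forall v a, `|f (rV_cons (v, a))| <= k v * l a) ->
  \int[lebesgue_rV n.+1]_x f x =
  \int[lebesgue_rV n]_v (\int[mu]_a f (rV_cons (v, a))).
Proof.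
move=> mf ik il fkl.
have mfc : measurable_fun setT (f \o @rV_cons R n).
  exact: (measurableT_comp mf (@measurable_rV_cons R n)).
have fkl' p : `|(f \o @rV_cons R n) p| <= k p.1 * l p.2.
  by case: p => v a; exact: fkl.
rewrite (Rintegral12_prod mfc ik il fkl') /Rintegral; congr fine.
rewrite -[in RHS](preimage_setT (@rV_cons R n)).
rewrite -[RHS]/(\int[_]_(x in _) ((EFin \o f) \o @rV_cons R n) x)%E.
rewrite -integral_pushforward//; last 3 first.
- exact: measurable_rV_cons.
- exact/measurable_EFinP.
- by rewrite preimage_setT; exact: (dominated_integrable_prod mfc ik il fkl').
Qed.

Lemma measurable_rV_prod n (f : 'I_n -> R -> R) :
  (forall i, measurable_fun setT (f i)) ->
  measurable_fun setT (fun x : 'rV[R]_n => \prod_(i < n) f i (x ord0 i)).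
Proof.
move=> mf; apply: (measurable_prod (h := fun i (x : 'rV[R]_n) => f i (x ord0 i))) => i _.
exact: (measurableT_comp (mf i) (measurable_rV_coord i)).
Qed.

Lemma ge0_integral_rV_prod n (f : 'I_n -> R -> R) :
  (forall i, measurable_fun setT (f i)) -> (forall i x, 0 <= f i x) ->
  (\int[lebesgue_rV n]_x (\prod_(i < n) f i (x ord0 i))%:E =
   \prod_(i < n) \int[mu]_x (f i x)%:E)%E.
Proof.
elim: n f => [|n IH] f mf f0.
  rewrite big_ord0; under eq_integral do rewrite big_ord0.
  by rewrite integral_dirac// diracT mul1e.
rewrite ge0_integral_rVS; last 2 first.
- by apply/measurable_EFinP; exact: measurable_rV_prod.
- by move=> x; rewrite lee_fin; apply: prodr_ge0 => i _; exact: f0.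
transitivity (\int[lebesgue_rV n]_v ((\prod_(i < n) f (lift ord0 i) (v ord0 i))%:E *
    \int[mu]_a (f ord0 a)%:E))%E.
  apply: eq_integral => v _; rewrite -ge0_integralZl_EFin//; last 3 first.
  - by move=> a _; rewrite lee_fin.
  - by apply/measurable_EFinP; exact: mf.
  - by apply: prodr_ge0 => i _; exact: f0.
  apply: eq_integral => a _; rewrite big_ord_recl rV_cons0 mulrC EFinM.
  by under eq_bigr do rewrite rV_consS.
rewrite ge0_integralZr//; last 3 first.
- by apply/measurable_EFinP; exact: (measurable_rV_prod (fun i => mf (lift ord0 i))).
- by move=> x _; rewrite lee_fin; apply: prodr_ge0 => i _; exact: f0.
- by apply: integral_ge0 => x _; rewrite lee_fin.
by rewrite (IH (fun i => f (lift ord0 i)))// big_ord_recl muleC.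
Qed.

(** This is exp(- e |z|_1) for the l^1 norm; the product form lets its Fourier transform be computed
    one coordinate at a time. *)
Definition laplaceV n (e : R) (z : 'rV[R]_n) : R := \prod_(i < n) laplace e (z ord0 i).

Lemma laplaceV_ge0 n e (z : 'rV[R]_n) : 0 <= laplaceV e z.
Proof. by apply: prodr_ge0 => i _; exact: laplace_ge0. Qed.

Lemma measurable_laplaceV n e : measurable_fun setT (@laplaceV n e).
Proof.
by apply: (measurable_rV_prod (f := fun=> laplace e)) => i; exact: measurable_laplace.
Qed.

Lemma integrable_laplaceV n e : 0 < e ->
  (lebesgue_rV n).-integrable setT (EFin \o @laplaceV n e).
Proof.
move=> e0; apply/integrableP; split.
  by apply/measurable_EFinP; exact: measurable_laplaceV.
under eq_integral do rewrite /= ger0_norm ?laplaceV_ge0//.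
rewrite (ge0_integral_rV_prod (f := fun=> laplace e)); last 2 first.
- by move=> i; exact: measurable_laplace.
- by move=> i x; exact: laplace_ge0.
under eq_bigr do rewrite integral_laplace//.
by rewrite prodEFin ltry.
Qed.

Lemma dotrV_rV_cons n (x : 'rV[R]_n.+1) v a :
  dotrV x (rV_cons (v, a)) = x ord0 ord0 * a + dotrV (rV_uncons x).1 v.
Proof.
rewrite /dotrV big_ord_recl rV_cons0; congr (_ + _).
by apply: eq_bigr => i _; rewrite rV_consS mxE.
Qed.

Lemma laplaceV_rV_cons n e (v : 'rV[R]_n) a :
  laplaceV e (rV_cons (v, a)) = laplaceV e v * laplace e a.
Proof.
rewrite /laplaceV big_ord_recl rV_cons0 mulrC; congr (_ * _).
by apply: eq_bigr => i _; rewrite rV_consS.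
Qed.

Lemma measurable_dotrV d (T : measurableType d) n (f g : T -> 'rV[R]_n) :
  measurable_fun setT f -> measurable_fun setT g ->
  measurable_fun setT (fun t => dotrV (f t) (g t)).
Proof.
move=> /measurable_fun_rVP mf /measurable_fun_rVP mg.
apply: (@measurable_sum _ _ _ _ _ _ (fun i t => f t ord0 i * g t ord0 i)) => i.
exact: measurable_funM.
Qed.

Let mtrig n (x : 'rV[R]_n) : measurable_fun setT (fun z => cos (dotrV x z)) /\
  measurable_fun setT (fun z => sin (dotrV x z)).
Proof.
have mx : measurable_fun setT (dotrV x) by exact: measurable_dotrV.
split; [apply: (measurableT_comp (f := @cos R)) => //|
        apply: (measurableT_comp (f := @sin R)) => //];
  by apply: continuous_measurable_fun; [exact: continuous_cos || exact: continuous_sin].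
Qed.

(** Induction on the dimension with the addition formulas. In the first coordinate the sine integral
    vanishes by parity, so real and imaginary parts do not mix and each step contributes one Cauchy
    factor. *)
Lemma Rintegral_laplaceV_trig n e (x : 'rV[R]_n) : 0 < e ->
  \int[lebesgue_rV n]_z (laplaceV e z * cos (dotrV x z)) =
    \prod_(i < n) (2 * cauchy e (x ord0 i)) /\
  \int[lebesgue_rV n]_z (laplaceV e z * sin (dotrV x z)) = 0.
Proof.
move=> e0.
have icos y : mu.-integrable setT (fun a => (laplace e a * cos (y * a))%:E).
  by apply: integrable_laplaceM => // [|a]; [exact: measurable_cosM|exact: norm_cos_le1].
have isin y : mu.-integrable setT (fun a => (laplace e a * sin (y * a))%:E).
  by apply: integrable_laplaceM => // [|a]; [exact: measurable_sinM|exact: norm_sin_le1].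
have ilin y r s : \int[mu]_a (r * (laplace e a * cos (y * a)) +
    s * (laplace e a * sin (y * a))) = r * (2 * e / (e ^+ 2 + y ^+ 2)).
  rewrite RintegralD//; last 2 first.
  - by have := integrableZl measurableT r (icos y).
  - by have := integrableZl measurableT s (isin y).
  rewrite (@RintegralZl _ _ _ _ _ (fun a : measurableTypeR R => laplace e a * cos (y * a)))//;
    last exact: (icos y).
  rewrite (@RintegralZl _ _ _ _ _ (fun a : measurableTypeR R => laplace e a * sin (y * a)))//;
    last exact: (isin y).
  by rewrite Rintegral_laplace_cos// Rintegral_laplace_sin// mulr0 addr0.
elim: n x => [|n IH] x.
  have I0 (f : 'rV[R]_0 -> R) : measurable_fun setT f ->
      \int[lebesgue_rV 0]_z f z = f 0.
    by move=> mf; rewrite /Rintegral integral_dirac ?diracT ?mul1e//; exact/measurable_EFinP.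
  split; rewrite I0.
  - by rewrite /laplaceV /dotrV !big_ord0 mul1r cos0.
  - by apply: measurable_funM; [exact: measurable_laplaceV|exact: (mtrig x).1].
  - by rewrite /laplaceV /dotrV !big_ord0 mul1r sin0.
  - by apply: measurable_funM; [exact: measurable_laplaceV|exact: (mtrig x).2].
have [IHc IHs] := IH (rV_uncons x).1.
set c0 := 2 * cauchy e (x ord0 ord0).
have cE : 2 * e / (e ^+ 2 + x ord0 ord0 ^+ 2) = c0 by rewrite /c0 mulrA.
have il := integrable_laplace e0.
have ik := integrable_laplaceV n e0.
have dom v a (r : R) : `|r| <= 1 ->
    `|laplaceV e (rV_cons (v, a)) * r| <= laplaceV e v * laplace e a.
  move=> f1; have K0 : 0 <= laplaceV e v * laplace e a.
    by rewrite mulr_ge0 ?laplaceV_ge0 ?laplace_ge0.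
  by rewrite laplaceV_rV_cons normrM ger0_norm// ler_piMr.
have iM (f : 'rV[R]_n -> R) : measurable_fun setT f -> (forall v, `|f v| <= 1) ->
    (lebesgue_rV n).-integrable setT (EFin \o (fun v => laplaceV e v * f v)).
  move=> mf f1; apply: (le_integrable _ _ _ ik) => //.
    by apply/measurable_EFinP; apply: measurable_funM => //; exact: measurable_laplaceV.
  by move=> v _ /=; rewrite lee_fin normrM ler_piMr.
split.
- rewrite (@integrable_rVS _ _ (laplaceV e) (laplace e))//; last 2 first.
  + by apply: measurable_funM; [exact: measurable_laplaceV|exact: (mtrig x).1].
  + by move=> v a; apply: dom; exact: norm_cos_le1.
  transitivity (\int[lebesgue_rV n]_v (c0 *
      (laplaceV e v * cos (dotrV (rV_uncons x).1 v)))).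
    apply: eq_Rintegral => v _.
    transitivity (\int[mu]_a (laplaceV e v * cos (dotrV (rV_uncons x).1 v) *
        (laplace e a * cos (x ord0 ord0 * a)) +
        - (laplaceV e v * sin (dotrV (rV_uncons x).1 v)) *
        (laplace e a * sin (x ord0 ord0 * a)))).
      apply: eq_Rintegral => a _.
      by rewrite laplaceV_rV_cons dotrV_rV_cons cosD; ring.
    by rewrite ilin cE mulrC.
  rewrite RintegralZl//; last first.
    by apply: iM => [|v]; [exact: (mtrig _).1|exact: norm_cos_le1].
  by rewrite IHc big_ord_recl; congr (_ * _); apply: eq_bigr => i _; rewrite mxE.
- rewrite (@integrable_rVS _ _ (laplaceV e) (laplace e))//; last 2 first.
  + by apply: measurable_funM; [exact: measurable_laplaceV|exact: (mtrig x).2].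
  + by move=> v a; apply: dom; exact: norm_sin_le1.
  transitivity (\int[lebesgue_rV n]_v (c0 *
      (laplaceV e v * sin (dotrV (rV_uncons x).1 v)))).
    apply: eq_Rintegral => v _.
    transitivity (\int[mu]_a (laplaceV e v * sin (dotrV (rV_uncons x).1 v) *
        (laplace e a * cos (x ord0 ord0 * a)) +
        laplaceV e v * cos (dotrV (rV_uncons x).1 v) *
        (laplace e a * sin (x ord0 ord0 * a)))).
      apply: eq_Rintegral => a _.
      by rewrite laplaceV_rV_cons dotrV_rV_cons sinD; ring.
    by rewrite ilin cE mulrC.
  rewrite RintegralZl//; last first.
    by apply: iM => [|v]; [exact: (mtrig _).2|exact: norm_sin_le1].
  by rewrite IHs mulr0.
Qed.

Lemma cvg_laplaceV n (u : nat -> R) (z : 'rV[R]_n) : u m @[m --> \oo] --> (0 : R) ->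
  laplaceV (u m) z @[m --> \oo] --> (1 : R).
Proof.
move=> u0.
pose s := \sum_(i < n) `|z ord0 i|.
have E e : laplaceV e z = expR (- (e * s)).
  by rewrite /laplaceV /s mulr_sumr -sumrN expR_sum.
under eq_fun do rewrite E.
rewrite -expR0; apply: continuous_cvg; first exact: continuous_expR.
rewrite -[X in _ --> X]oppr0 -(mul0r s); apply: cvgN; apply: cvgM => //.
exact: cvg_cst.
Qed.

End lebesgue_rV_integral.

(** * Fourier inversion *)

Section characteristic_function.
Context {R : realType} {disp : measure_display} {Omega : measurableType disp}
  (P : probability Omega R) (d : nat) (X : Omega -> 'rV[R]_d).
Hypothesis mX : measurable_fun setT X.
Local Notation mu := (@lebesgue_measure R).
Implicit Types (x z : 'rV[R]_d) (e : R).

Definition char_re z := \int[P]_w cos (dotrV z (X w)).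
Definition char_im z := \int[P]_w sin (dotrV z (X w)).

Let measurable_cosR : measurable_fun setT (@cos R).
Proof. by apply: continuous_measurable_fun; exact: continuous_cos. Qed.

Let measurable_sinR : measurable_fun setT (@sin R).
Proof. by apply: continuous_measurable_fun; exact: continuous_sin. Qed.

Let mdot : measurable_fun setT (fun p : 'rV[R]_d * Omega => dotrV p.1 (X p.2)).
Proof.
apply: measurable_dotrV; first exact: measurable_fst.
exact: (measurableT_comp mX measurable_snd).
Qed.

Let iP : P.-integrable setT (EFin \o (fun=> 1)).
Proof. exact: finite_measure_integrable_cst. Qed.

Let bounded_integrable (f : Omega -> R) : measurable_fun setT f ->
  (forall w, `|f w| <= 1) -> P.-integrable setT (EFin \o f).
Proof.
move=> mf f1; apply: (le_integrable _ _ _ iP) => //; first exact/measurable_EFinP.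
by move=> w _; rewrite /= lee_fin normr1.
Qed.

Let mdotX z : measurable_fun setT (fun w => dotrV z (X w)).
Proof. exact: measurable_dotrV. Qed.

Let bounded_fubini (k : 'rV[R]_d -> R) (f : 'rV[R]_d * Omega -> R) :
  (lebesgue_rV d).-integrable setT (EFin \o k) -> (forall z, 0 <= k z) ->
  measurable_fun setT f -> (forall p, `|f p| <= 1) ->
  [/\ \int[lebesgue_rV d]_z (k z * \int[P]_w f (z, w)) =
      \int[P]_w \int[lebesgue_rV d]_z (k z * f (z, w)),
      measurable_fun setT (fun z => k z * \int[P]_w f (z, w)) &
      measurable_fun setT (fun w => \int[lebesgue_rV d]_z (k z * f (z, w)))].
Proof.
move=> ik k0 mf f1.
have mk : measurable_fun setT k by apply/measurable_EFinP; exact: (measurable_int _ ik).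
pose g (p : 'rV[R]_d * Omega) := k p.1 * f p.
have mg : measurable_fun setT g.
  by apply: measurable_funM => //; exact: (measurableT_comp mk measurable_fst).
have gk p : `|g p| <= k p.1 * 1.
  by rewrite /g normrM ger0_norm// ler_wpM2l.
have Eg z : k z * \int[P]_w f (z, w) = \int[P]_w g (z, w).
  rewrite -(@RintegralZl _ _ _ _ _ (fun w => f (z, w)))//; apply: bounded_integrable => //.
  exact: (measurableT_comp mf (pair1_measurable z)).
split.
- under eq_Rintegral do rewrite Eg.
  exact: (Rintegral_fubini mg ik iP gk).
- under eq_fun do rewrite Eg.
  exact: (dominated_measurable_F mg ik iP gk).
- exact: (dominated_measurable_G mg ik iP gk).
Qed.

(** Here z ranges over a space of infinite measure, where a bounded function has no integrable
    majorant. Adding 1 makes [f] nonnegative, and Tonelli then gives the measurability. *)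
Let bounded_measurable (f : 'rV[R]_d * Omega -> R) :
  measurable_fun setT f -> (forall p, `|f p| <= 1) ->
  measurable_fun setT (fun z => \int[P]_w f (z, w)).
Proof.
move=> mf f1.
have f1ge0 p : (0 <= (1 + f p)%:E)%E.
  by rewrite lee_fin; have := f1 p; rewrite ler_norml => /andP[]; lra.
have m1f : measurable_fun setT (fun p => (1 + f p)%:E).
  by apply/measurable_EFinP/measurable_funD.
have := measurable_fun_fubini_tonelli_F (m2 := P) _ m1f f1ge0.
rewrite (_ : fubini_F _ _ = EFin \o (fun z => 1 + \int[P]_w f (z, w))).
  move=> /measurable_EFinP h.
  rewrite (_ : (fun _ => _) = (fun z => (1 + \int[P]_w f (z, w)) - 1)).
    exact: measurable_funB.
  by apply/funext => z; rewrite addrC addKr.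
apply/funext => z; rewrite /fubini_F.
have fi : P.-integrable setT (EFin \o (fun w => f (z, w))).
  by apply: bounded_integrable => //; exact: (measurableT_comp mf (pair1_measurable z)).
under eq_integral do rewrite EFinD.
rewrite integralD//= integral_cst//= probability_setT mule1 EFinD.
by rewrite /Rintegral fineK//; exact: integrable_fin_num.
Qed.

Lemma measurable_char_re : measurable_fun setT char_re.
Proof.
apply: (bounded_measurable (f := fun p => cos (dotrV p.1 (X p.2)))).
  exact: (measurableT_comp measurable_cosR mdot).
by move=> p; exact: norm_cos_le1.
Qed.

Lemma measurable_char_im : measurable_fun setT char_im.
Proof.
apply: (bounded_measurable (f := fun p => sin (dotrV p.1 (X p.2)))).
  exact: (measurableT_comp measurable_sinR mdot).
by move=> p; exact: norm_sin_le1.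
Qed.

Let icosX z : P.-integrable setT (EFin \o (fun w => cos (dotrV z (X w)))).
Proof.
apply: bounded_integrable; first exact: (measurableT_comp measurable_cosR (mdotX z)).
by move=> w; exact: norm_cos_le1.
Qed.

Let isinX z : P.-integrable setT (EFin \o (fun w => sin (dotrV z (X w)))).
Proof.
apply: bounded_integrable; first exact: (measurableT_comp measurable_sinR (mdotX z)).
by move=> w; exact: norm_sin_le1.
Qed.

Let lin_trig z r s : \int[P]_w (r * cos (dotrV z (X w)) + s * sin (dotrV z (X w))) =
  r * char_re z + s * char_im z.
Proof.
rewrite RintegralD//; last 2 first.
- by have := integrableZl measurableT r (icosX z).
- by have := integrableZl measurableT s (isinX z).
by rewrite (RintegralZl _ measurableT (icosX z)) (RintegralZl _ measurableT (isinX z)).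
Qed.

Lemma char_re_shift z x :
  \int[P]_w cos (dotrV z (X w) - dotrV z x) =
  cos (dotrV z x) * char_re z + sin (dotrV z x) * char_im z.
Proof.
by rewrite -lin_trig; apply: eq_Rintegral => w _; rewrite cosB mulrC [_ * sin _]mulrC.
Qed.

Lemma char_im_shift z x :
  \int[P]_w sin (dotrV z (X w) - dotrV z x) =
  cos (dotrV z x) * char_im z - sin (dotrV z x) * char_re z.
Proof.
rewrite [RHS]addrC -mulNr -lin_trig; apply: eq_Rintegral => w _.
by rewrite sinB mulNr addrC [sin _ * cos _]mulrC [cos _ * sin _]mulrC.
Qed.

Let norm_expectation_le1 (f : Omega -> R) : measurable_fun setT f ->
  (forall w, `|f w| <= 1) -> `|\int[P]_w f w| <= 1.
Proof.
move=> mf f1; have fi := bounded_integrable mf f1.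
apply: (le_trans (le_normr_Rintegral _ fi)) => //.
rewrite [leRHS](_ : _ = \int[P]_w cst 1 w); last first.
  by rewrite Rintegral_cst//= mul1r [P _]probability_setT.
by apply: le_Rintegral => //; exact: integrable_norm.
Qed.

Lemma norm_char_rotated_le1 z x :
  `|cos (dotrV z x) * char_re z + sin (dotrV z x) * char_im z| <= 1.
Proof.
rewrite -char_re_shift; apply: norm_expectation_le1 => [|w]; last exact: norm_cos_le1.
by apply: (measurableT_comp measurable_cosR); exact: measurable_funB.
Qed.

Let dotrVBr z x y : dotrV (x - y) z = dotrV z x - dotrV z y.
Proof.
rewrite /dotrV -sumrB; apply: eq_bigr => i _; rewrite !mxE; ring.
Qed.

(* Multiplying by a Laplace kernel before inverting the Fourier transform amounts to
   convolving with a product of Cauchy kernels. *)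
Lemma smoothed_inversion e x : 0 < e ->
  \int[lebesgue_rV d]_z (laplaceV e z *
     (cos (dotrV z x) * char_re z + sin (dotrV z x) * char_im z)) =
    \int[P]_w \prod_(i < d) (2 * cauchy e (X w ord0 i - x ord0 i)) /\
  \int[lebesgue_rV d]_z (laplaceV e z *
     (cos (dotrV z x) * char_im z - sin (dotrV z x) * char_re z)) = 0.
Proof.
move=> e0.
have mB : measurable_fun setT
    (fun p : 'rV[R]_d * Omega => dotrV p.1 (X p.2) - dotrV p.1 x).
  apply: measurable_funB => //; apply: measurable_dotrV => //; exact: measurable_fst.
split.
- under eq_Rintegral do rewrite -char_re_shift.
  have [-> _ _] := @bounded_fubini (laplaceV e)
    (fun p => cos (dotrV p.1 (X p.2) - dotrV p.1 x)) (integrable_laplaceV d e0)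
    (laplaceV_ge0 e) (measurableT_comp measurable_cosR mB) (fun p => norm_cos_le1 _).
  apply: eq_Rintegral => w _ /=.
  under eq_Rintegral do rewrite -dotrVBr.
  rewrite (Rintegral_laplaceV_trig _ e0).1.
  by apply: eq_bigr => i _; rewrite !mxE.
- under eq_Rintegral do rewrite -char_im_shift.
  have [-> _ _] := @bounded_fubini (laplaceV e)
    (fun p => sin (dotrV p.1 (X p.2) - dotrV p.1 x)) (integrable_laplaceV d e0)
    (laplaceV_ge0 e) (measurableT_comp measurable_sinR mB) (fun p => norm_sin_le1 _).
  rewrite (_ : (fun w => _) = fun=> 0); first by rewrite Rintegral_cst// mul0r.
  apply/funext => w /=.
  under eq_Rintegral do rewrite -dotrVBr.
  exact: (Rintegral_laplaceV_trig _ e0).2.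
Qed.

(** The law of [X] is compared with M times Lebesgue measure as a measure, and integrals of
    nonnegative functions are monotone in the measure. *)
Lemma ge0_integral_density_le (M : R) (f : 'rV[R]_d -> \bar R) : 0 <= M ->
  (forall B, measurable B -> (P (X @^-1` B) <= M%:E * lebesgue_rV d B)%E) ->
  measurable_fun setT f -> (forall x, 0 <= f x)%E ->
  (\int[P]_w f (X w) <= M%:E * \int[lebesgue_rV d]_x f x)%E.
Proof.
move=> M0 PM mf f0.
rewrite -(@ge0_integral_mscale _ _ _ _ setT measurableT (NngNum M0))//.
have -> : (\int[P]_w f (X w) = \int[pushforward P X]_y f y)%E.
  by rewrite ge0_integral_pushforward// preimage_setT.
exact: (@ge0_le_measure_integral _ _ _
  (measure_function_pushforward__canonical__measure_function_Measure P mX)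
  (mscale (NngNum M0) (lebesgue_rV d)) PM _ _ measurableT f0 mf).
Qed.

(** The squared modulus is the characteristic function of X - X' for an independent copy X'.
    Integrated against the Laplace kernel it becomes the expectation of a product of doubled Cauchy
    kernels at X - X'; each such product has Lebesgue integral at most (2 pi)^d, and the law of X is
    at most M times Lebesgue measure. Fatou's lemma as e -> 0 removes the kernel. *)
Lemma plancherel_le (M : R) : 0 <= M ->
  (forall B, measurable B -> (P (X @^-1` B) <= M%:E * lebesgue_rV d B)%E) ->
  (\int[lebesgue_rV d]_z (char_re z ^+ 2 + char_im z ^+ 2)%:E <=
   (M * (2 * pi) ^+ d)%:E)%E.
Proof.
move=> M0 PM.
have smooth_le e : 0 < e ->
    (\int[lebesgue_rV d]_z (laplaceV e z * (char_re z ^+ 2 + char_im z ^+ 2))%:E <=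
     (M * (2 * pi) ^+ d)%:E)%E.
  move=> e0.
  have q_le x : (\int[P]_w (\prod_(i < d) (2 * cauchy e (X w ord0 i - x ord0 i)))%:E <=
      (M * (2 * pi) ^+ d)%:E)%E.
    pose f (y : 'rV[R]_d) := \prod_(i < d) (2 * cauchy e (y ord0 i - x ord0 i)).
    have mc i : measurable_fun setT (fun a : R => 2 * cauchy e (a - x ord0 i)).
      by apply: measurable_funM => //; exact: measurable_cauchy.
    have c0 i a : 0 <= 2 * cauchy e (a - x ord0 i).
      by rewrite mulr_ge0// cauchy_ge0// ltW.
    apply: (le_trans (@ge0_integral_density_le M (EFin \o f) M0 PM _ _)) => /=.
    - by apply/measurable_EFinP; exact: (measurable_rV_prod mc).
    - by move=> y; rewrite lee_fin; apply: prodr_ge0.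
    rewrite EFinM lee_wpmul2l ?lee_fin//.
    rewrite (ge0_integral_rV_prod mc)//.
    have -> : (((2 * pi) ^+ d)%:E = \prod_(i < d) (2 * pi : R)%:E)%E.
      by rewrite prodEFin prodr_const card_ord.
    set I := fun i : 'I_d => (\int[mu]_a (2 * cauchy e (a - x ord0 i))%:E)%E.
    suff I_le i : (0 <= I i <= (2 * pi)%:E)%E.
      suff /andP[] : (0 <= \prod_(i < d) I i <= \prod_(i < d) (2 * pi : R)%:E)%E by [].
      elim/big_ind2 : _ => [|a b a' b' /andP[a0 ab] /andP[a'0 ab']|i _] //.
        by rewrite lexx lee_fin ler01.
      by rewrite mule_ge0//= lee_pmul.
    rewrite /I integral_ge0 /=; last by move=> a _; rewrite lee_fin.
    under eq_integral do rewrite EFinM.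
    rewrite ge0_integralZl_EFin//; last 2 first.
    - by move=> a _; rewrite lee_fin cauchy_ge0// ltW.
    - by apply/measurable_EFinP; exact: measurable_cauchy.
    by rewrite EFinM lee_wpmul2l ?lee_fin//; exact: integral_cauchy_le.
  set M' := M * (2 * pi) ^+ d.
  (* The real part of exp(- i <z, X w>) phi(z), with phi the characteristic function: its mean over
     [w] is |phi(z)|^2, while for fixed [w] it is the integrand of [smoothed_inversion] at the point
     [X w]. *)
  pose f (p : 'rV[R]_d * Omega) := cos (dotrV p.1 (X p.2)) * char_re p.1 +
    sin (dotrV p.1 (X p.2)) * char_im p.1.
  have mf : measurable_fun setT f.
    apply: measurable_funD; apply: measurable_funM.
    - exact: (measurableT_comp measurable_cosR mdot).
    - exact: (measurableT_comp measurable_char_re measurable_fst).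
    - exact: (measurableT_comp measurable_sinR mdot).
    - exact: (measurableT_comp measurable_char_im measurable_fst).
  have f1 p : `|f p| <= 1 by exact: norm_char_rotated_le1.
  have Ef z : \int[P]_w f (z, w) = char_re z ^+ 2 + char_im z ^+ 2.
    rewrite !expr2 -lin_trig; apply: eq_Rintegral => w _.
    by rewrite /f /= mulrC [_ * char_im z]mulrC.
  have Ef1 z : `|char_re z ^+ 2 + char_im z ^+ 2| <= 1.
    rewrite -Ef; apply: norm_expectation_le1 => // .
    exact: (measurableT_comp mf (pair1_measurable z)).
  have ik := integrable_laplaceV d e0.
  have [fub _ mG] := bounded_fubini ik (laplaceV_ge0 e) mf f1.
  have iK : (lebesgue_rV d).-integrable setT
      (EFin \o (fun z => laplaceV e z * (char_re z ^+ 2 + char_im z ^+ 2))).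
    apply: (le_integrable _ _ _ ik) => //.
      apply/measurable_EFinP; apply: measurable_funM; first exact: measurable_laplaceV.
      by apply: measurable_funD; apply: measurable_funX;
        [exact: measurable_char_re|exact: measurable_char_im].
    by move=> z _; rewrite /= lee_fin normrM ler_piMr.
  rewrite -[leLHS]fineK; last exact: (integrable_fin_num _ iK).
  rewrite lee_fin -[leLHS]/(\int[_]_z _).
  under eq_Rintegral do rewrite -Ef.
  rewrite fub.
  have G_le w : 0 <= \int[lebesgue_rV d]_z (laplaceV e z * f (z, w)) <= M'.
    have [-> _] := smoothed_inversion (X w) e0.
    have := q_le (X w); rewrite /Rintegral.
    have : (0 <= \int[P]_w0 (\prod_(i < d)
        (2 * cauchy e (X w0 ord0 i - X w ord0 i)))%:E)%E.
      apply: integral_ge0 => v _; rewrite lee_fin; apply: prodr_ge0 => i _.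
      by rewrite mulr_ge0// cauchy_ge0// ltW.
    by case: (integral _ _ _) => [r|//|//]; rewrite !lee_fin /= => -> ->.
  have iM : P.-integrable setT (EFin \o (fun=> M')).
    exact: finite_measure_integrable_cst.
  rewrite (_ : M' = \int[P]_w cst M' w); last first.
    by rewrite Rintegral_cst//= [P _]probability_setT mulr1.
  apply: le_Rintegral => //; last by move=> w _; have /andP[] := G_le w.
  apply: (le_integrable _ _ _ iM) => //; first exact/measurable_EFinP.
  move=> w _; rewrite /= lee_fin; have /andP[g0 gM] := G_le w.
  by rewrite ger0_norm// (le_trans gM)// ler_norm.
have u0 : (@harmonic R) n @[n --> \oo] --> (0 : R) by exact: cvg_harmonic.
pose g n z := (laplaceV (@harmonic R n) z * (char_re z ^+ 2 + char_im z ^+ 2))%:E.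
have gz z : g n z @[n --> \oo] --> (char_re z ^+ 2 + char_im z ^+ 2)%:E.
  apply: cvg_EFin; first exact: nearW.
  rewrite /= -[X in _ --> X]mul1r; apply: cvgM; last exact: cvg_cst.
  exact: cvg_laplaceV.
have mg n : measurable_fun setT (g n).
  apply/measurable_EFinP; apply: measurable_funM; first exact: measurable_laplaceV.
  by apply: measurable_funD; apply: measurable_funX;
    [exact: measurable_char_re|exact: measurable_char_im].
have g0 n z : (0 <= g n z)%E.
  by rewrite lee_fin mulr_ge0 ?laplaceV_ge0// addr_ge0 ?sqr_ge0.
have := fatou (lebesgue_rV d) measurableT mg (fun n x _ => g0 n x).
under eq_integral do rewrite (cvg_limn_einf_sup (gz _)).1.
move=> /le_trans; apply; rewrite limn_einf_lim.
apply: lime_le; first exact: is_cvg_einfs.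
apply: nearW => n; apply: (le_trans _ (smooth_le (harmonic n) (harmonic_gt0 n))).
by apply: ereal_inf_lbound; exists n => /=.
Qed.

End characteristic_function.

(** * Arctangent approximations of the indicator of an open interval *)

Section cauchy_window.
Context {R : realType}.
Local Notation mu := (@lebesgue_measure R).
Let c (n : nat) : R := n.+3%:R^-1.

Let c_gt0 n : 0 < c n. Proof. by rewrite invr_gt0. Qed.

(** With c_n = 1/(n+3), the window keeps a gap (b - a) c_n from the endpoints while the kernel has
    width c_n^2. At y = a or y = b both arctangents then have the same limit, so the endpoints get
    weight 0. The shift by 3 gives c_n <= 1/3, hence a nonempty window. *)
Definition window_lo (a b : R) n : R := a + (b - a) * c n.
Definition window_hi (a b : R) n : R := b - (b - a) * c n.
Definition window_eps n : R := c n ^+ 2.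

Lemma window_eps_gt0 n : 0 < window_eps n. Proof. by rewrite exprn_gt0. Qed.

Let cvg_c : c n @[n --> \oo] --> (0 : R).
Proof.
have -> : c = fun n => (@harmonic R) (n + 2)%N by apply/funext => n; rewrite /c /= addn2.
by have := @cvg_harmonic R; rewrite -(cvg_shiftn 2).
Qed.

Lemma cvg_window_eps : window_eps n @[n --> \oo] --> (0 : R).
Proof. by rewrite -[X in _ --> X](mulr0 (0 : R)); apply: cvgM; exact: cvg_c. Qed.

Let c_lt n : c n <= 3^-1.
Proof. by rewrite lef_pV2 ?posrE// ler_nat. Qed.

Lemma window_lt a b n : a < b -> window_lo a b n < window_hi a b n.
Proof.
move=> ab; rewrite /window_lo /window_hi; have := c_lt n; have := c_gt0 n.
move=> h1 h2; have : (b - a) * c n <= (b - a) * 3^-1 by rewrite ler_wpM2l// subr_ge0 ltW.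
lra.
Qed.

Lemma window_sub a b n y : a < b -> window_lo a b n <= y <= window_hi a b n -> a < y < b.
Proof.
move=> ab; rewrite /window_lo /window_hi.
have : 0 < (b - a) * c n by rewrite mulr_gt0// subr_gt0.
by move=> h /andP[h1 h2]; apply/andP; split; lra.
Qed.

(** The argument equals (n+3)(s(n+3) - delta). For s > 0 the quadratic term wins; for s <= 0 the
    term in delta already drives it to minus infinity, including at the endpoint s = 0. *)
Let cvg_atan_step (s delta : R) : 0 < delta ->
  atan ((s - delta * c n) / window_eps n) @[n --> \oo] -->
    (if 0 < s then pi / 2 else - (pi / 2) : R).
Proof.
move=> d0.
have E n : (s - delta * c n) / window_eps n = n.+3%:R * (s * n.+3%:R - delta).
  have n0 : n.+3%:R != 0 :> R by rewrite pnatr_eq0.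
  by rewrite /window_eps /c; field.
under eq_fun do rewrite E.
case: ifPn => [s0|].
  apply: (cvg_comp (fun n : nat => n.+3%:R * (s * n.+3%:R - delta) : R) (@atan R));
    last exact: cvgy_atan.
  apply/cvgryPge => M; near=> n.
  have h1 : 1 <= s * n.+3%:R - delta.
    have : (1 + delta) / s <= n.+3%:R.
      apply: (@le_trans _ _ n%:R); last by rewrite ler_nat -addn3 leq_addr.
      by near: n; exact: nbhs_infty_ger.
    by rewrite ler_pdivrMr// [_ * s]mulrC; lra.
  apply: (@le_trans _ _ (n.+3%:R * 1)).
    rewrite mulr1; apply: (@le_trans _ _ n%:R); last by rewrite ler_nat -addn3 leq_addr.
    by near: n; exact: nbhs_infty_ger.
  by rewrite ler_wpM2l.
rewrite -leNgt => s0.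
under eq_fun do rewrite -[X in atan X]opprK atanN.
apply: cvgN.
apply: (cvg_comp (fun n : nat => - (n.+3%:R * (s * n.+3%:R - delta)) : R) (@atan R));
    last exact: cvgy_atan.
apply/cvgryPge => M; near=> n.
apply: (@le_trans _ _ (n.+3%:R * delta)).
  rewrite -ler_pdivrMr//; apply: (@le_trans _ _ n%:R); last by rewrite ler_nat -addn3 leq_addr.
  by near: n; exact: nbhs_infty_ger.
rewrite -mulrN ler_wpM2l// opprB lerBrDr gerDl.
by rewrite mulr_le0_ge0.
Unshelve. all: by end_near. Qed.

Lemma cvg_window a b y : a < b ->
  atan ((window_hi a b n - y) / window_eps n) - atan ((window_lo a b n - y) / window_eps n)
    @[n --> \oo] --> pi * \1_`]a, b[ y.
Proof.
move=> ab; have ab0 : 0 < b - a by rewrite subr_gt0.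
have E n : atan ((window_hi a b n - y) / window_eps n) -
    atan ((window_lo a b n - y) / window_eps n) =
    atan ((b - y - (b - a) * c n) / window_eps n) + atan ((y - a - (b - a) * c n) / window_eps n).
  rewrite -[in RHS](opprB a y) -opprD mulNr atanN /window_hi /window_lo.
  by congr (atan (_ / _) - atan (_ / _)); ring.
under eq_fun do rewrite E.
rewrite (_ : pi * _ = (if 0 < b - y then pi / 2 else - (pi / 2)) +
    (if 0 < y - a then pi / 2 else - (pi / 2)) :> R); last first.
  rewrite !subr_gt0 indicE mem_setE in_itv/=.
  case: (ltP y b) => yb; case: (ltP a y) => ya /=.
  - by rewrite mulr1 -splitr.
  - by rewrite mulr0 subrr.
  - by rewrite mulr0 addrC subrr.
  - by move: (lt_le_trans ab yb) ya => /lt_le_trans h /h; rewrite ltxx.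
by apply: cvgD; exact: cvg_atan_step.
Qed.

Lemma cvg_indic_window a b y : a < b ->
  (\1_`[window_lo a b n, window_hi a b n] y : R) @[n --> \oo] --> (\1_`]a, b[ y : R).
Proof.
move=> ab; rewrite [in X in _ --> X]indicE mem_setE in_itv/=.
have cd : (b - a) * c n @[n --> \oo] --> (0 : R).
  by rewrite -[X in _ --> X](mulr0 (b - a)); apply: cvgM; [exact: cvg_cst|exact: cvg_c].
case: (boolP (a < y < b)) => [/andP[ya yb]|yab] /=.
- apply: cvg_near_cst; near=> n.
  rewrite indicE mem_set//= in_itv/=.
  have : (b - a) * c n < Num.min (y - a) (b - y).
    by near: n; apply: (cvgr_lt 0 cd); rewrite lt_min !subr_gt0 ya.
  by rewrite lt_min /window_lo /window_hi => /andP[h1 h2]; apply/andP; split; lra.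
- apply: cvg_near_cst; near=> n.
  rewrite indicE memNset//= in_itv/= => /(window_sub ab).
  exact/negP.
Unshelve. all: by end_near. Qed.

End cauchy_window.

Lemma laplaceV_le1 (R : realType) n e (z : 'rV[R]_n) : 0 <= e -> laplaceV e z <= 1.
Proof.
by move=> e0; apply: prodr_ile1 => i _; rewrite laplace_ge0 /= laplace_le1.
Qed.

Section density_measure.
Context {disp : measure_display} {T : measurableType disp} {R : realType}
  (mu : {measure set T -> \bar R}) (f : T -> \bar R).
Hypotheses (mf : measurable_fun setT f) (f0 : forall x, (0 <= f x)%E).

Let density_fun (A : set T) : \bar R := (\int[mu]_(x in A) f x)%E.

Let density_fun0 : density_fun set0 = 0%E.
Proof. exact: integral_set0. Qed.

Let density_fun_ge0 A : (0 <= density_fun A)%E.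
Proof. exact: integral_ge0. Qed.

Let density_fun_sigma_additive : semi_sigma_additive density_fun.
Proof.
move=> F mF tF mUF; rewrite /density_fun ge0_integral_bigcup//.
  by apply: is_cvg_ereal_nneg_natsum_cond => n _ _; exact: integral_ge0.
exact: measurable_funTS.
Qed.

HB.instance Definition _ := isMeasure.Build _ _ _ density_fun
  density_fun0 density_fun_ge0 density_fun_sigma_additive.

(** Packaged as a measure so that uniqueness on a pi-system can compare it with the law of [X]. *)
Definition density_measure : {measure set T -> \bar R} := density_fun.

End density_measure.

Definition open_box (R : realType) d (a b : 'rV[R]_d) : set 'rV[R]_d :=
  [set x | forall i, a ord0 i < x ord0 i < b ord0 i].

Lemma measurable_open_box (R : realType) d (a b : 'rV[R]_d) : measurable (open_box a b).
Proof.
apply: (@measurable_rV_box _ _ (fun i => `]a ord0 i, b ord0 i[%classic)) => i.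
exact: measurable_itv.
Qed.

(** Open boxes, because the smoothed indicators converge to indicators of open intervals. They form
    a pi-system generating the Borel sets. *)
Definition open_boxes (R : realType) d : set (set 'rV[R]_d) :=
  [set B | exists a b, B = open_box a b].

Lemma measurable_rV_open_boxes (R : realType) d :
  @measurable _ 'rV[R]_d = <<s @open_boxes R d >>.
Proof.
apply/seteqP; split; last first.
  apply: smallest_sub; first exact: sigma_algebra_measurable.
  by move=> _ [a [b ->]]; exact: measurable_open_box.
apply: smallest_sub; first exact: smallest_sigma_algebra.
move=> B; rewrite -bigcup_seq => -[i _ [C mC <-]].
have : measurable_fun (setT : set (g_sigma_algebraType (@open_boxes R d)))
    (fun x : 'rV[R]_d => x ord0 i).
  apply: (measurability _ (RGenOpens.measurableE R)).
  move=> _ [_ [a [b ->]] <-]; rewrite setTI.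
  (* The slab a < x_i < b is the union over n of the boxes whose other coordinates lie in ]-n,
     n[. *)
  pose lo n : 'rV[R]_d := \row_j if j == i then a else - n%:R.
  pose hi n : 'rV[R]_d := \row_j if j == i then b else n%:R.
  have -> : (fun x : 'rV[R]_d => x ord0 i) @^-1` `]a, b[%classic =
      \bigcup_n open_box (lo n) (hi n).
    apply/seteqP; split => [x|x [n _ /(_ i)]]; last first.
      by rewrite !mxE eqxx /= in_itv.
    rewrite /= in_itv/= => xab.
    exists (Num.truncn (\sum_j `|x ord0 j|)).+1 => // j; rewrite !mxE.
    have [->//|ji] := eqVneq j i.
    rewrite -ltr_norml; apply: le_lt_trans (truncnS_gt _).
    by rewrite (bigD1 j)//= lerDl sumr_ge0.
  by apply: bigcupT_measurable => n; apply: sub_sigma_algebra; exists (lo n), (hi n).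
by move/(_ measurableT C mC).
Qed.

Lemma setI_closed_open_boxes (R : realType) d : setI_closed (@open_boxes R d).
Proof.
move=> _ _ [a [b ->]] [a' [b' ->]].
exists (\row_i Num.max (a ord0 i) (a' ord0 i)), (\row_i Num.min (b ord0 i) (b' ord0 i)).
apply/seteqP; split => [x [h h'] i|x h].
  by rewrite !mxE gt_max lt_min; have /andP[-> ->] := h i; have /andP[-> ->] := h' i.
split => i; have := h i; rewrite !mxE gt_max lt_min => /andP[/andP[h1 h2] /andP[h3 h4]].
  by rewrite h1 h3.
by rewrite h2 h4.
Qed.

(** * Recovering the law from an integrable characteristic function *)

Section fourier_inversion.
Context {R : realType} {disp : measure_display} {Omega : measurableType disp}
  (P : probability Omega R) (d : nat) (X : Omega -> 'rV[R]_d).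
Hypothesis mX : measurable_fun setT X.
Local Notation mu := (@lebesgue_measure R).
Local Notation lambda := (@lebesgue_rV R d).
Local Notation C := (char_re P X).
Local Notation S := (char_im P X).
Hypothesis iC : lambda.-integrable setT (EFin \o C).
Hypothesis iS : lambda.-integrable setT (EFin \o S).
Implicit Types (x z a b : 'rV[R]_d) (e : R).

Let rot x z : R := cos (dotrV z x) * C z + sin (dotrV z x) * S z.
Let env z : R := `|C z| + `|S z|.

Definition inversion_density x : R := (2 * pi) ^- d * \int[lambda]_z rot x z.

Let ienv : lambda.-integrable setT (EFin \o env).
Proof.
have := integrableD measurableT (integrable_norm iC) (integrable_norm iS).
by apply: eq_integrable.
Qed.

Let measurable_cosR : measurable_fun setT (@cos R).
Proof. by apply: continuous_measurable_fun; exact: continuous_cos. Qed.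

Let measurable_sinR : measurable_fun setT (@sin R).
Proof. by apply: continuous_measurable_fun; exact: continuous_sin. Qed.

Let rot_env x z : `|rot x z| <= env z.
Proof.
apply: (le_trans (ler_normD _ _)); rewrite !normrM.
by apply: lerD; apply: ler_piMl => //; [exact: norm_cos_le1|exact: norm_sin_le1].
Qed.

Let irot_env x z : `|cos (dotrV z x) * S z - sin (dotrV z x) * C z| <= env z.
Proof.
apply: (le_trans (ler_normB _ _)); rewrite !normrM addrC /env.
by apply: lerD; apply: ler_piMl => //; [exact: norm_sin_le1|exact: norm_cos_le1].
Qed.

Let mrot2 : measurable_fun setT (fun p : 'rV[R]_d * 'rV[R]_d => rot p.1 p.2).
Proof.
have md : measurable_fun setT (fun p : 'rV[R]_d * 'rV[R]_d => dotrV p.2 p.1).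
  by apply: measurable_dotrV; [exact: measurable_snd|exact: measurable_fst].
apply: measurable_funD; apply: measurable_funM.
- exact: (measurableT_comp measurable_cosR md).
- exact: (measurableT_comp (measurable_char_re P mX) measurable_snd).
- exact: (measurableT_comp measurable_sinR md).
- exact: (measurableT_comp (measurable_char_im P mX) measurable_snd).
Qed.

Let mrot x : measurable_fun setT (rot x).
Proof. exact: (measurableT_comp mrot2 (pair1_measurable x)). Qed.

Let irot x : lambda.-integrable setT (EFin \o rot x).
Proof.
apply: (le_integrable _ _ _ ienv) => //; first exact/measurable_EFinP.
by move=> z _ /=; rewrite lee_fin (le_trans (rot_env x z))// ler_norm.
Qed.

Let mirot x : measurable_fun setT (fun z => cos (dotrV z x) * S z - sin (dotrV z x) * C z).
Proof.
have md : measurable_fun setT (fun z : 'rV[R]_d => dotrV z x).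
  exact: measurable_dotrV.
apply: measurable_funB; apply: measurable_funM.
- exact: (measurableT_comp measurable_cosR md).
- exact: measurable_char_im.
- exact: (measurableT_comp measurable_sinR md).
- exact: measurable_char_re.
Qed.

(** A product majorant in (x, z) is obtained by multiplying the integrand by [laplaceV 1 x]; the
    factor is removed afterwards by its inverse [laplaceV (-1) x]. *)
Lemma measurable_inversion_density : measurable_fun setT inversion_density.
Proof.
apply: measurable_funM => //.
pose f (p : 'rV[R]_d * 'rV[R]_d) := laplaceV 1 p.1 * rot p.1 p.2.
have mf : measurable_fun setT f.
  rewrite /f; apply: measurable_funM; last exact: mrot2.
  exact: (measurableT_comp (@measurable_laplaceV R d 1) measurable_fst).
have fk p : `|f p| <= laplaceV 1 p.1 * env p.2.
  by rewrite /f normrM ger0_norm ?laplaceV_ge0// ler_wpM2l ?laplaceV_ge0.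
have := dominated_measurable_F mf (integrable_laplaceV d ltr01) ienv fk.
move=> /(measurable_funM (@measurable_laplaceV R d (-1))).
apply: eq_measurable_fun => x _ /=.
rewrite -[X in _ * X]/(\int[lambda]_z (laplaceV 1 x * rot x z)).
rewrite (@RintegralZl _ _ _ _ _ (rot x))//.
rewrite mulrA /laplaceV -big_split/= big1 ?mul1r// => i _.
by rewrite /laplace -expRD mulN1r opprK mul1r addrN expR0.
Qed.

Let cvg_smooth (f : 'rV[R]_d -> R) (u : nat -> R) : u n @[n --> \oo] --> (0 : R) ->
  (forall n, 0 < u n) -> measurable_fun setT f -> (forall z, `|f z| <= env z) ->
  \int[lambda]_z (laplaceV (u n) z * f z) @[n --> \oo] --> \int[lambda]_z f z.
Proof.
move=> u0 u_gt0 mf fe.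
have [||||_] := @Rintegral_dominated_cvg _ _ _ lambda
  (fun n z => laplaceV (u n) z * f z) f env; last exact.
- by move=> n; apply: measurable_funM => //; exact: measurable_laplaceV.
- move=> z; rewrite -[X in _ --> X]mul1r; apply: cvgM; last exact: cvg_cst.
  exact: cvg_laplaceV.
- exact: ienv.
- move=> n z; rewrite normrM ger0_norm ?laplaceV_ge0//.
  apply: (le_trans _ (fe z)); apply: ler_piMl => //.
  exact/laplaceV_le1/ltW.
Qed.

(** The inversion integral is real: its smoothed imaginary part is 0 for every e > 0. This
    reconciles the complex formula in [is_density] with the real [inversion_density]. *)
Lemma inversion_imaginary x :
  \int[lambda]_z (cos (dotrV z x) * S z - sin (dotrV z x) * C z) = 0.
Proof.
have := cvg_smooth (@cvg_harmonic R) (@harmonic_gt0 R) (mirot x) (irot_env x).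
under eq_fun => n do rewrite (smoothed_inversion P mX x (harmonic_gt0 n)).2.
by move=> /cvg_lim <-//; rewrite lim_cst.
Qed.

Let q e x := \int[P]_w \prod_(i < d) (2 * cauchy e (X w ord0 i - x ord0 i)).

Let q_rot e x : 0 < e -> q e x = \int[lambda]_z (laplaceV e z * rot x z).
Proof. by move=> e0; rewrite /q -(smoothed_inversion P mX x e0).1. Qed.

Let q_cvg (u : nat -> R) x : u n @[n --> \oo] --> (0 : R) -> (forall n, 0 < u n) ->
  q (u n) x @[n --> \oo] --> \int[lambda]_z rot x z.
Proof.
move=> u0 u_gt0; under eq_fun do rewrite q_rot//.
exact: cvg_smooth.
Qed.

(** Up to a positive factor it is a limit of expectations of products of Cauchy kernels, which are
    nonnegative. *)
Lemma inversion_density_ge0 x : 0 <= inversion_density x.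
Proof.
rewrite mulr_ge0 ?invr_ge0 ?exprn_ge0 ?mulr_ge0 ?pi_ge0//.
have := @q_cvg _ x (@cvg_harmonic R) (@harmonic_gt0 R).
move/cvg_lim => <- //; apply: limr_ge.
  by apply/cvg_ex; eexists; exact: (q_cvg (@cvg_harmonic R) (@harmonic_gt0 R)).
apply: nearW => n; apply: Rintegral_ge0 => w _; apply: prodr_ge0 => i _.
by rewrite mulr_ge0// cauchy_ge0// ltW// harmonic_gt0.
Qed.

(** The bound depends neither on e nor on x, which is what dominated convergence over a box
    requires. *)
Let q_le e x : 0 < e -> `|q e x| <= \int[lambda]_z env z.
Proof.
move=> e0; rewrite q_rot//.
have lrot z : `|laplaceV e z * rot x z| <= env z.
  rewrite normrM ger0_norm ?laplaceV_ge0//; apply: (le_trans _ (rot_env x z)).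
  by apply: ler_piMl => //; exact/laplaceV_le1/ltW.
have ilrot : lambda.-integrable setT (EFin \o (fun z => laplaceV e z * rot x z)).
  apply: (le_integrable _ _ _ ienv) => //.
    by apply/measurable_EFinP; apply: measurable_funM => //; exact: measurable_laplaceV.
  by move=> z _; rewrite /= lee_fin; exact/(le_trans (lrot z))/ler_norm.
apply: (le_trans (le_normr_Rintegral _ ilrot)) => //.
apply: le_Rintegral => //; first exact: integrable_norm.
Qed.

Local Notation box := (@open_box R d).

Let prod_indic (J : 'I_d -> set R) (x : 'rV[R]_d) :
  \prod_(i < d) \1_(J i) (x ord0 i) = \1_[set x : 'rV[R]_d | forall i, J i (x ord0 i)] x :> R.
Proof.
have [h|h] := pselect (forall i, J i (x ord0 i)).
  rewrite [RHS]indicE mem_set// big1// => i _; by rewrite indicE mem_set.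
rewrite [RHS]indicE memNset//; move/existsNP : h => [i Ji].
by rewrite (bigD1 i)//= indicE memNset// mul0r.
Qed.

Let cauchy_le e y : 0 < e -> cauchy e y <= e^-1.
Proof.
move=> e0; rewrite /cauchy ler_pdivrMr; last by rewrite ltr_pwDl ?exprn_gt0 ?sqr_ge0.
by rewrite mulrDr expr2 mulrA mulVf ?gt_eqF// mul1r lerDl mulr_ge0 ?sqr_ge0 ?invr_ge0 ?ltW.
Qed.

Let mprodc e x : 0 < e -> measurable_fun setT
  (fun w => \prod_(i < d) (2 * cauchy e (X w ord0 i - x ord0 i))).
Proof.
move=> e0; apply: (measurable_prod (h := fun i w => 2 * cauchy e (X w ord0 i - x ord0 i))) => i _.
apply: measurable_funM => //.
exact: (measurableT_comp (measurable_cauchy (x ord0 i) e0)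
  (measurableT_comp (measurable_rV_coord i) mX)).
Qed.

Let prodc_bound e (y : 'rV[R]_d) x : 0 < e ->
  0 <= \prod_(i < d) (2 * cauchy e (y ord0 i - x ord0 i)) <= (2 / e) ^+ d.
Proof.
move=> e0; apply/andP; split.
  by apply: prodr_ge0 => i _; rewrite mulr_ge0// cauchy_ge0// ltW.
rewrite -[in leRHS](card_ord d) -prodr_const; apply: ler_prod => i _.
by rewrite mulr_ge0 ?cauchy_ge0 ?(ltW e0)//= ler_wpM2l// cauchy_le.
Qed.

(* The window converges from inside the box, faster than the width [window_eps n] of the
   kernel shrinks: this is why no boundary term shows up in the limit. *)
Lemma integral_smooth_box a b n : (forall i, a ord0 i < b ord0 i) ->
  \int[lambda]_x (\prod_(i < d) \1_`[window_lo (a ord0 i) (b ord0 i) n,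
       window_hi (a ord0 i) (b ord0 i) n] (x ord0 i) * q (window_eps n) x) =
  \int[P]_w \prod_(i < d) (2 *
     (atan ((window_hi (a ord0 i) (b ord0 i) n - X w ord0 i) / window_eps n) -
      atan ((window_lo (a ord0 i) (b ord0 i) n - X w ord0 i) / window_eps n))).
Proof.
move=> ab; set e : R := window_eps n; have e0 : 0 < e by exact: window_eps_gt0.
pose J i : set R := `[window_lo (a ord0 i) (b ord0 i) n, window_hi (a ord0 i) (b ord0 i) n]%classic.
have mJ i : measurable_fun setT (\1_(J i) : R -> R).
  by apply: measurable_indic; exact: measurable_itv.
pose k (x : 'rV[R]_d) : R := (\prod_(i < d) \1_(J i) (x ord0 i)) * (2 / e) ^+ d.
have k0 x : 0 <= k x.
  by rewrite mulr_ge0 ?exprn_ge0 ?divr_ge0 ?(ltW e0)//; apply: prodr_ge0 => i _; rewrite indicE.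
have mprodJ : measurable_fun setT (fun x : 'rV[R]_d => \prod_(i < d) (\1_(J i) (x ord0 i) : R)).
  exact: (measurable_rV_prod mJ).
have iprodJ : lambda.-integrable setT (EFin \o
     (fun x : 'rV[R]_d => \prod_(i < d) (\1_(J i) (x ord0 i) : R))).
  apply/integrableP; split; first exact/measurable_EFinP.
  under eq_integral => x _.
    rewrite /= ger0_norm; last by apply: prodr_ge0 => i _; rewrite indicE.
    over.
  rewrite (ge0_integral_rV_prod mJ)//.
  have hJ i : (\int[mu]_y (\1_(J i) y)%:E = (window_hi (a ord0 i) (b ord0 i) n -
      window_lo (a ord0 i) (b ord0 i) n)%:E)%E.
    rewrite integral_indic//; last exact: measurable_itv.
    by rewrite setIT /= lebesgue_measure_itv/= lte_fin window_lt// -EFinB.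
  under eq_bigr do rewrite hJ.
  by rewrite prodEFin ltry.
have ik : lambda.-integrable setT (EFin \o k).
  have := integrableZr measurableT ((2 / e) ^+ d) iprodJ.
  by apply: eq_integrable.
pose f (p : 'rV[R]_d * Omega) := \prod_(i < d) (\1_(J i) (p.1 ord0 i) *
  (2 * cauchy e (X p.2 ord0 i - p.1 ord0 i))).
have mf : measurable_fun setT f.
  apply: (measurable_prod (h := fun i (p : 'rV[R]_d * Omega) => \1_(J i) (p.1 ord0 i) *
    (2 * cauchy e (X p.2 ord0 i - p.1 ord0 i)))) => i _.
  have m1 : measurable_fun setT (fun p : 'rV[R]_d * Omega => p.1 ord0 i).
    exact: (measurableT_comp (measurable_rV_coord i) measurable_fst).
  have m2 : measurable_fun setT (fun p : 'rV[R]_d * Omega => X p.2 ord0 i).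
    apply: (measurableT_comp (measurable_rV_coord i)).
    exact: (measurableT_comp mX measurable_snd).
  apply: measurable_funM; first exact: (measurableT_comp (mJ i) m1).
  apply: measurable_funM => //.
  have := measurableT_comp (measurable_cauchy 0 e0) (measurable_funB m2 m1).
  by apply: eq_measurable_fun => p _ /=; rewrite subr0.
have fE p : f p = \prod_(i < d) \1_(J i) (p.1 ord0 i) *
    \prod_(i < d) (2 * cauchy e (X p.2 ord0 i - p.1 ord0 i)) by rewrite /f big_split.
have fk p : `|f p| <= k p.1 * 1.
  have /andP[h1 h2] := prodc_bound (X p.2) p.1 e0.
  have h0 : 0 <= \prod_(i < d) (\1_(J i) (p.1 ord0 i) : R).
    by apply: prodr_ge0 => i _; rewrite indicE.
  by rewrite fE normrM !ger0_norm// mulr1 /k ler_wpM2l.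
have iP : P.-integrable setT (EFin \o (fun=> 1 : R)).
  exact: finite_measure_integrable_cst.
transitivity (\int[lambda]_x (\int[P]_w f (x, w))).
  apply: eq_Rintegral => x _.
  rewrite /q -(@RintegralZl _ _ _ _ _ (fun w => \prod_(i < d) (2 * cauchy e (X w ord0 i - x ord0 i))))//.
    by apply: eq_Rintegral => w _; rewrite fE.
  have iB : P.-integrable setT (EFin \o (fun=> (2 / e) ^+ d)).
    exact: finite_measure_integrable_cst.
  apply: (le_integrable _ _ _ iB) => //; first by apply/measurable_EFinP; exact: mprodc.
  move=> w _; rewrite /= lee_fin; have /andP[h1 h2] := prodc_bound (X w) x e0.
  by rewrite ger0_norm// (le_trans h2)// ler_norm.
rewrite (Rintegral_fubini mf ik iP fk).
apply: eq_Rintegral => w _.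
rewrite /Rintegral.
have mg i : measurable_fun setT (fun y : R => \1_(J i) y * (2 * cauchy e (y - X w ord0 i))).
  by apply: measurable_funM => //; apply: measurable_funM => //; exact: measurable_cauchy.
have g0 i y : 0 <= \1_(J i) y * (2 * cauchy e (y - X w ord0 i)).
  by rewrite mulr_ge0 ?indicE// mulr_ge0// cauchy_ge0// ltW.
under eq_integral => x _.
  rewrite /f; under eq_bigr => i _.
    rewrite (_ : cauchy e (X w ord0 i - x ord0 i) = cauchy e (x ord0 i - X w ord0 i)); last first.
      by rewrite /cauchy -opprB sqrrN.
    over.
  over.
rewrite /= (ge0_integral_rV_prod mg g0).
have hI i : (\int[mu]_y (\1_(J i) y * (2 * cauchy e (y - X w ord0 i)))%:E =
    (2 * (atan ((window_hi (a ord0 i) (b ord0 i) n - X w ord0 i) / e) -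
      atan ((window_lo (a ord0 i) (b ord0 i) n - X w ord0 i) / e)))%:E)%E.
  transitivity (\int[mu]_(y in J i) (2 * cauchy e (y - X w ord0 i))%:E)%E.
    rewrite [RHS]integral_mkcond; apply: eq_integral => y _.
    by rewrite patchE indicE; case: ifP => _; rewrite ?mul1r ?mul0r.
  under eq_integral do rewrite EFinM.
  rewrite ge0_integralZl_EFin//; last 3 first.
  - exact: measurable_itv.
  - by move=> y _; rewrite lee_fin cauchy_ge0// ltW.
  - by apply/measurable_EFinP/measurable_funTS; exact: measurable_cauchy.
  by rewrite integral_cauchy_itv// window_lt.
by rewrite (eq_bigr _ (fun i _ => hI i)) prodEFin.
Qed.

Let measurable_q e : 0 < e -> measurable_fun setT (q e).
Proof.
move=> e0.
pose F (p : 'rV[R]_d * Omega) := (\prod_(i < d) (2 * cauchy e (X p.2 ord0 i - p.1 ord0 i)))%:E.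
have F0 p : (0 <= F p)%E.
  by rewrite lee_fin; have /andP[] := prodc_bound (X p.2) p.1 e0.
have mF : measurable_fun setT F.
  apply/measurable_EFinP.
  apply: (measurable_prod (h := fun i (p : 'rV[R]_d * Omega) =>
    2 * cauchy e (X p.2 ord0 i - p.1 ord0 i))) => i _.
  have m1 : measurable_fun setT (fun p : 'rV[R]_d * Omega => p.1 ord0 i).
    exact: (measurableT_comp (measurable_rV_coord i) measurable_fst).
  have m2 : measurable_fun setT (fun p : 'rV[R]_d * Omega => X p.2 ord0 i).
    apply: (measurableT_comp (measurable_rV_coord i)).
    exact: (measurableT_comp mX measurable_snd).
  apply: measurable_funM => //.
  have := measurableT_comp (measurable_cauchy 0 e0) (measurable_funB m2 m1).
  by apply: eq_measurable_fun => p _ /=; rewrite subr0.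
have := measurable_fun_fubini_tonelli_F (m2 := P) F mF F0.
exact: measurableT_comp.
Qed.

Let cvg_prod (f : nat -> 'I_d -> R) (l : 'I_d -> R) :
  (forall i, f n i @[n --> \oo] --> l i) ->
  \prod_(i < d) f n i @[n --> \oo] --> \prod_(i < d) l i.
Proof.
move=> fl; apply: cvg_big => [|i _]; last exact: fl.
by move=> p; exact: mul_continuous.
Qed.

Let mbox a b : measurable (box a b).
Proof.
apply: (@measurable_rV_box _ _ (fun i => `]a ord0 i, b ord0 i[%classic)) => i.
exact: measurable_itv.
Qed.

Let boxE a b x : \prod_(i < d) \1_`]a ord0 i, b ord0 i[ (x ord0 i) = \1_(box a b) x :> R.
Proof. by rewrite prod_indic; congr (\1_ _ x). Qed.

Let finite_box a b : (lambda (box a b) < +oo)%E.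
Proof.
rewrite (@lebesgue_rV_box _ _ (fun i => `]a ord0 i, b ord0 i[%classic)); last first.
  by move=> i; exact: measurable_itv.
have E i : lebesgue_measure `]a ord0 i, b ord0 i[%classic =
    (if a ord0 i < b ord0 i then b ord0 i - a ord0 i else 0)%:E.
  by rewrite lebesgue_measure_itv/= lte_fin; case: ifP; rewrite // -EFinB.
by under eq_bigr do rewrite E; rewrite prodEFin ltry.
Qed.

(** Both sides of [integral_smooth_box] pass to the limit by dominated convergence. On the left [q]
    tends to the unnormalised density under the uniform bound [q_le]; on the right each arctangent
    difference tends to pi times an indicator and is at most pi in absolute value. *)
Lemma integral_inversion_density_box a b : (forall i, a ord0 i < b ord0 i) ->
  P (X @^-1` box a b) = (\int[lambda]_(x in box a b) (inversion_density x)%:E)%E.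
Proof.
move=> ab.
set Kw := \int[lambda]_z env z.
pose Q x := \int[lambda]_z rot x z.
have [||||iQ cvgl] := @Rintegral_dominated_cvg _ _ _ lambda (fun n x =>
  \prod_(i < d) \1_`[window_lo (a ord0 i) (b ord0 i) n,
       window_hi (a ord0 i) (b ord0 i) n] (x ord0 i) * q (window_eps n) x)
  (fun x => \1_(box a b) x * Q x) (fun x => \1_(box a b) x * Kw).
- move=> n; apply: measurable_funM; last by apply: measurable_q; exact: window_eps_gt0.
  apply: (measurable_rV_prod (f := fun i => \1_`[window_lo (a ord0 i) (b ord0 i) n,
       window_hi (a ord0 i) (b ord0 i) n])) => i.
  by apply: measurable_indic; exact: measurable_itv.
- move=> x; apply: cvgM; last first.
    by apply: q_cvg; [exact: cvg_window_eps|exact: window_eps_gt0].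
  by rewrite -boxE; apply: cvg_prod => i; exact: cvg_indic_window.
- have ib : lambda.-integrable setT (EFin \o (\1_(box a b) : 'rV[R]_d -> R)).
    apply/integrableP; split; first exact/measurable_EFinP/measurable_indic.
    under eq_integral do rewrite /= ger0_norm//.
    by rewrite integral_indic// setIT; exact: finite_box.
  by have := integrableZr measurableT Kw ib; apply: eq_integrable.
- move=> n x; rewrite normrM; apply: ler_pM => //; last by apply: q_le; exact: window_eps_gt0.
  rewrite -boxE ger0_norm; last by apply: prodr_ge0 => i _; rewrite indicE.
  apply: ler_prod => i _; rewrite {1}indicE/= !indicE; apply/andP; split => //.
  rewrite ler_nat !mem_setE !in_itv/=.
  by case: (boolP (_ <= _ <= _)) => // h; rewrite (window_sub (ab i) h).
have [||||_ cvgr] := @Rintegral_dominated_cvg _ _ _ P (fun n w =>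
  \prod_(i < d) (2 *
     (atan ((window_hi (a ord0 i) (b ord0 i) n - X w ord0 i) / window_eps n) -
      atan ((window_lo (a ord0 i) (b ord0 i) n - X w ord0 i) / window_eps n))))
  (fun w => (2 * pi) ^+ d * \1_(X @^-1` box a b) w) (fun=> (2 * pi) ^+ d).
- move=> n; apply: (measurable_prod (h := fun i w => 2 *
     (atan ((window_hi (a ord0 i) (b ord0 i) n - X w ord0 i) / window_eps n) -
      atan ((window_lo (a ord0 i) (b ord0 i) n - X w ord0 i) / window_eps n)))) => i _.
  have matan (r s : R) : measurable_fun setT (fun y : R => atan ((r - y) / s)).
    apply: continuous_measurable_fun => y.
    by apply/differentiable_continuous/derivable1_diffP/ex_derive.
  have mXi : measurable_fun setT (fun w => X w ord0 i).
    exact: (measurableT_comp (measurable_rV_coord i) mX).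
  apply: measurable_funM => //; apply: measurable_funB.
  - exact: (measurableT_comp (matan _ _) mXi).
  - exact: (measurableT_comp (matan _ _) mXi).
- move=> w; have -> : (2 * pi) ^+ d * \1_(X @^-1` box a b) w =
      \prod_(i < d) (2 * (pi * \1_`]a ord0 i, b ord0 i[ (X w ord0 i))) :> R.
    under eq_bigr do rewrite mulrA.
    by rewrite big_split/= prodr_const card_ord boxE.
  by apply: cvg_prod => i; apply: cvgM; [exact: cvg_cst|exact: cvg_window].
- exact: finite_measure_integrable_cst.
- move=> n w; rewrite normr_prod -[in leRHS](card_ord d) -prodr_const.
  apply: ler_prod => i _; rewrite normr_ge0 /= normrM ger0_norm// ler_wpM2l//.
  rewrite ler_norml; set u := atan _; set v := atan _.
  have := atan_ltpi2 ((window_hi (a ord0 i) (b ord0 i) n - X w ord0 i) / window_eps n).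
  have := atan_gtNpi2 ((window_hi (a ord0 i) (b ord0 i) n - X w ord0 i) / window_eps n).
  have := atan_ltpi2 ((window_lo (a ord0 i) (b ord0 i) n - X w ord0 i) / window_eps n).
  have := atan_gtNpi2 ((window_lo (a ord0 i) (b ord0 i) n - X w ord0 i) / window_eps n).
  by rewrite -/u -/v => h1 h2 h3 h4; apply/andP; split; lra.
have E : \int[lambda]_x (\1_(box a b) x * Q x) =
    \int[P]_w ((2 * pi) ^+ d * \1_(X @^-1` box a b) w).
  move: cvgl; under eq_fun do rewrite (integral_smooth_box _ ab).
  move=> cvgl; rewrite -[LHS](cvg_lim (@Rhausdorff R) cvgl).
  by rewrite -[RHS](cvg_lim (@Rhausdorff R) cvgr).
have pi0 : (2 * pi) ^+ d != 0 :> R by rewrite expf_neq0// mulf_neq0// gt_eqF ?pi_gt0.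
have mXb : measurable (X @^-1` box a b).
  by rewrite -[X in measurable X]setTI; exact: mX.
have idens : lambda.-integrable setT (EFin \o (fun x => \1_(box a b) x * inversion_density x)).
  have := integrableZl measurableT ((2 * pi) ^- d) iQ.
  by apply: eq_integrable => // x _; rewrite /= mulrCA.
transitivity (\int[lambda]_x (\1_(box a b) x * inversion_density x))%:E; last first.
  rewrite fineK; last exact: integrable_fin_num.
  rewrite [RHS]integral_mkcond; apply: eq_integral => x _.
  by rewrite patchE indicE; case: ifP => _; rewrite ?mul1r ?mul0r.
have -> : \int[lambda]_x (\1_(box a b) x * inversion_density x) =
    (2 * pi) ^- d * \int[lambda]_x (\1_(box a b) x * Q x).
  by rewrite -(@RintegralZl _ _ _ _ _ (fun x => \1_(box a b) x * Q x))//;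
    apply: eq_Rintegral => x _; rewrite mulrCA.
rewrite E (@RintegralZl _ _ _ _ _ (\1_(X @^-1` box a b) : Omega -> R))//.
  by rewrite mulKf// /Rintegral integral_indic// setIT fineK// fin_num_measure.
exact: integrable_indic.
Qed.

(** Two measures agreeing on a generating pi-system coincide, the cubes ]-n, n[^d being an
    exhaustion of finite mass. Degenerate boxes are empty. *)
Theorem inversion_densityP B : measurable B ->
  P (X @^-1` B) = (\int[lambda]_(x in B) (inversion_density x)%:E)%E.
Proof.
have d0 x : (0 <= (inversion_density x)%:E)%E by rewrite lee_fin inversion_density_ge0.
have md : measurable_fun setT (EFin \o inversion_density).
  by apply/measurable_EFinP; exact: measurable_inversion_density.
pose g (n : nat) : set 'rV[R]_d := open_box (const_mx (- n%:R)) (const_mx n%:R).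
move=> mB; apply: (@measure_unique _ _ _ (@open_boxes R d) g _ _ _ _
  (measure_function_pushforward__canonical__measure_function_Measure P mX)
  (density_measure lambda md d0) _ _ B mB).
- exact: measurable_rV_open_boxes.
- exact: setI_closed_open_boxes.
- by move=> n; exists (const_mx (- n%:R)), (const_mx n%:R).
- rewrite -subTset => x _; exists (Num.truncn (\sum_j `|x ord0 j|)).+1 => // j.
  rewrite !mxE -ltr_norml; apply: le_lt_trans (truncnS_gt _).
  by rewrite (bigD1 j)//= lerDl sumr_ge0.
- move=> _ [a [b ->]].
  have [ab|/existsNP[i /negP]] := pselect (forall i, a ord0 i < b ord0 i).
    exact: integral_inversion_density_box.
  rewrite -leNgt => ba.
  have -> : open_box a b = set0.
    rewrite -subset0 => x /(_ i)/andP[h1 h2].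
    by move: (lt_trans h1 h2); rewrite ltNge ba.
  by rewrite !measure0.
- move=> n; apply: (le_lt_trans (probability_le1 P _)); rewrite ?ltry//.
  by rewrite -[X in measurable X]setTI; apply: mX => //; exact: measurable_open_box.
Qed.

End fourier_inversion.

(** * The characteristic exponent *)

Section cosine_bounds.
Context {R : realType}.
Implicit Types (u v t : R).

Let sin_mvt u : 0 <= u -> exists2 c, 0 <= c <= u & sin u = cos c * u.
Proof.
move=> u0; have [] := @MVT_segment R (@sin R) (@cos R) 0 u u0.
  by apply: continuous_subspaceT => x; exact: continuous_sin.
by move=> c; rewrite in_itv/= => cu; rewrite sin0 !subr0 => ->; exists c.
Qed.

Lemma norm_sin_le u : `|sin u| <= `|u|.
Proof.
wlog u0 : u / 0 <= u => [h|].
  have [|u0] := leP 0 u; first exact: h.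
  by have := h (- u); rewrite sinN !normrN oppr_ge0; apply; exact: ltW.
by have [c _ ->] := sin_mvt u0; rewrite normrM ler_piMl// norm_cos_le1.
Qed.

Lemma subr1_cos u : 1 - cos u = 2 * sin (u / 2) ^+ 2.
Proof.
have -> : cos u = cos (u / 2 + u / 2) by rewrite -splitr.
by rewrite cosD -!expr2; have := cos2Dsin2 (u / 2); lra.
Qed.

Lemma subr1_cos_ge0 u : 0 <= 1 - cos u.
Proof. by rewrite subr_ge0 cos_le1. Qed.

Lemma subr1_cos_le u : 1 - cos u <= 2 * Num.min 1 (u ^+ 2).
Proof.
rewrite minr_pMr// le_min; apply/andP; split.
  by have := cos_geN1 u; lra.
rewrite subr1_cos ler_pM2l// -[leLHS]real_normK ?num_real// -[leRHS]real_normK ?num_real//.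
rewrite ler_sqr ?nnegrE//; apply: (le_trans (norm_sin_le _)).
by rewrite normrM ler_piMr// ger0_norm ?invr_ge0// invf_le1// ler1n.
Qed.

Let sin_ge_half u : 0 <= u <= 1 -> u / 2 <= sin u.
Proof.
move=> /andP[u0 u1]; have [c /andP[c0 cu] ->] := sin_mvt u0.
rewrite mulrC ler_wpM2r//.
have := subr1_cos c; have : sin (c / 2) ^+ 2 <= 4^-1 ; last by lra.
have -> : 4^-1 = 2^-1 ^+ 2 :> R by field.
rewrite -[leLHS]real_normK ?num_real// ler_sqr ?nnegrE//.
apply: (le_trans (norm_sin_le _)); rewrite ger0_norm ?divr_ge0//; lra.
Qed.

Lemma subr1_cos_ge u : `|u| <= 2 -> u ^+ 2 / 8 <= 1 - cos u.
Proof.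
wlog u0 : u / 0 <= u => [h|].
  have [|u0] := leP 0 u; first exact: h.
  by have := h (- u); rewrite cosN normrN sqrrN oppr_ge0; apply; exact: ltW.
rewrite ger0_norm// => u2; rewrite subr1_cos.
have h : u / 2 / 2 <= sin (u / 2) by apply: sin_ge_half; apply/andP; split; lra.
have : (u / 2 / 2) ^+ 2 <= sin (u / 2) ^+ 2.
  by rewrite ler_sqr ?nnegrE//; [lra|apply: le_trans h; lra].
rewrite !expr2; lra.
Qed.

(** As 1 - cos u = 2 sin(u/2)^2, this is the square of |sin(a + b)| <= |sin a| + |sin b|. *)
Lemma subr1_cosD u v : 1 - cos (u + v) <= 2 * (1 - cos u) + 2 * (1 - cos v).
Proof.
rewrite !subr1_cos; set a := u / 2; set b := v / 2.
have -> : (u + v) / 2 = a + b by rewrite mulrDl.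
have h : `|sin (a + b)| <= `|sin a| + `|sin b|.
  rewrite sinD; apply: (le_trans (ler_normD _ _)); rewrite !normrM.
  by apply: lerD; [rewrite ler_piMr//|rewrite ler_piMl//]; exact: norm_cos_le1.
have : `|sin (a + b)| ^+ 2 <= (`|sin a| + `|sin b|) ^+ 2 by rewrite ler_sqr ?nnegrE ?addr_ge0.
rewrite real_normK ?num_real//.
rewrite -(real_normK (num_real (sin a))) -(real_normK (num_real (sin b))).
by have := sqr_ge0 (`|sin a| - `|sin b|); rewrite sqrrB sqrrD; lra.
Qed.

Local Notation mu := (@lebesgue_measure R).

Let continuous_subr1_cosM u : continuous (fun t : R => 1 - cos (t * u)).
Proof. by move=> t; apply/differentiable_continuous/derivable1_diffP/ex_derive. Qed.

(** For |u| <= 2 the bound 1 - cos(tu) >= t^2 u^2 / 8 integrates to u^2 / 24, whence the constant.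
    For |u| > 2 the integral is 1 - sin(u)/u >= 1/2. *)
Lemma integral_subr1_cosM_ge u :
  ((Num.min 1 (u ^+ 2) / 24)%:E <= \int[mu]_(t in `[0%R, 1%R]) (1 - cos (t * u))%:E)%E.
Proof.
have mf : measurable_fun (`[0, 1]%classic : set (measurableTypeR R))
    (fun t : R => (1 - cos (t * u))%:E).
  apply/measurable_EFinP/measurable_funTS.
  by apply: continuous_measurable_fun; exact: continuous_subr1_cosM.
have [u2|u2] := leP `|u| 2.
  apply: (@le_trans _ _ (\int[mu]_(t in `[0%R, 1%R]) (t ^+ 2 * (u ^+ 2 / 8))%:E)%E).
    have dF (x : R) : is_derive x 1 (fun t : R => t ^+ 3 * (u ^+ 2 / 24)) (x ^+ 2 * (u ^+ 2 / 8)).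
      by apply: is_derive_eq; rewrite /GRing.scale/=; field.
    have cF : continuous (fun t : R => t ^+ 3 * (u ^+ 2 / 24)).
      by move=> x; apply/differentiable_continuous/derivable1_diffP/ex_derive.
    rewrite (@continuous_FTC2 _ _ (fun t : R => t ^+ 3 * (u ^+ 2 / 24)))//.
    - rewrite -EFinB lee_fin expr1n expr0n /= mul0r subr0 mul1r.
      by rewrite ler_wpM2r ?invr_ge0// ge_min lexx orbT.
    - apply: continuous_subspaceT => x.
      by apply/differentiable_continuous/derivable1_diffP/ex_derive.
    - split=> [x _||]; first exact: ex_derive.
        exact/cvg_at_right_filter/cF.
      exact/cvg_at_left_filter/cF.
    - by move=> x _; rewrite derive1E; exact: derive_val.
  apply: ge0_le_integral => //.
  - by move=> t _; rewrite lee_fin mulr_ge0 ?sqr_ge0// divr_ge0 ?sqr_ge0.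
  - apply/measurable_EFinP/measurable_funTS; apply: continuous_measurable_fun => x.
    by apply/differentiable_continuous/derivable1_diffP/ex_derive.
  - move=> t; rewrite /= in_itv/= => /andP[t0 t1].
    rewrite lee_fin mulrA -exprMn; apply: subr1_cos_ge.
    by rewrite normrM ger0_norm// (le_trans _ u2)// ler_piMl.
have u0 : u != 0 by rewrite -normr_gt0 (lt_trans _ u2).
have dF (x : R) : is_derive x 1 (fun t : R => t - sin (t * u) / u) (1 - cos (x * u)).
  by apply: is_derive_eq; rewrite /GRing.scale/=; field.
have cF : continuous (fun t : R => t - sin (t * u) / u).
  by move=> x; apply/differentiable_continuous/derivable1_diffP/ex_derive.
rewrite (@continuous_FTC2 _ _ (fun t : R => t - sin (t * u) / u))//.
- rewrite -EFinB lee_fin mul0r sin0 mul0r subrr subr0 mul1r.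
  apply: (@le_trans _ _ (1 / 24)).
    by rewrite ler_wpM2r ?invr_ge0// ge_min lexx.
  have : `|sin u / u| <= 1 / 2.
    rewrite normrM normfV ler_pdivrMr ?normr_gt0//.
    by apply: (le_trans (norm_sin_le1 _)); lra.
  by move=> /(le_trans (ler_norm _)); lra.
- by apply: continuous_subspaceT; exact: continuous_subr1_cosM.
- split=> [x _||]; first exact: ex_derive.
    exact/cvg_at_right_filter/cF.
  exact/cvg_at_left_filter/cF.
- by move=> x _; rewrite derive1E; exact: derive_val.
Qed.

End cosine_bounds.

(** * Euclidean norm and nonnegative quadratic forms *)

Section euclidean_norm.
Context {R : realType} {d : nat}.
Implicit Types (x y z : 'rV[R]_d) (A : 'M[R]_d).

Lemma dotrVC x y : dotrV x y = dotrV y x.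
Proof. by apply: eq_bigr => i _; rewrite mulrC. Qed.

Lemma dotrVDl x y z : dotrV (x + y) z = dotrV x z + dotrV y z.
Proof. by rewrite /dotrV -big_split; apply: eq_bigr => i _; rewrite mxE mulrDl. Qed.

Lemma dotrVDr x y z : dotrV z (x + y) = dotrV z x + dotrV z y.
Proof. by rewrite dotrVC dotrVDl ![dotrV z _]dotrVC. Qed.

Lemma dotrVZl (k : R) x y : dotrV (k *: x) y = k * dotrV x y.
Proof. by rewrite /dotrV mulr_sumr; apply: eq_bigr => i _; rewrite mxE mulrA. Qed.

Lemma dotrVZr (k : R) x y : dotrV x (k *: y) = k * dotrV x y.
Proof. by rewrite dotrVC dotrVZl dotrVC. Qed.

Lemma dotrV0l x : dotrV 0 x = 0.
Proof. by rewrite /dotrV big1// => i _; rewrite mxE mul0r. Qed.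

Lemma dotrVv_ge0 x : 0 <= dotrV x x.
Proof. by apply: sumr_ge0 => i _; rewrite -expr2 sqr_ge0. Qed.

Lemma enorm_ge0 x : 0 <= enorm x. Proof. exact: sqrtr_ge0. Qed.

Lemma enorm_sqr x : enorm x ^+ 2 = dotrV x x.
Proof. by rewrite sqr_sqrtr// dotrVv_ge0. Qed.

Lemma enormZ (k : R) x : enorm (k *: x) = `|k| * enorm x.
Proof. by rewrite /enorm dotrVZl dotrVZr mulrA -expr2 sqrtrM ?sqr_ge0// sqrtr_sqr. Qed.

Lemma enorm_le_sqr x (r : R) : 0 <= r -> (enorm x <= r) = (dotrV x x <= r ^+ 2).
Proof. by move=> r0; rewrite -enorm_sqr ler_sqr// nnegrE ?enorm_ge0. Qed.

Lemma enorm_eq0 x : enorm x = 0 -> x = 0.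
Proof.
move=> /(congr1 (fun r => r ^+ 2)); rewrite enorm_sqr expr0n /= => /eqP.
rewrite psumr_eq0 => [/allP h|i _]; last by rewrite -expr2 sqr_ge0.
apply/rowP => i; have := h i; rewrite mem_index_enum => /(_ isT).
by rewrite /= mulf_eq0 orbb mxE => /eqP.
Qed.

Lemma coord_le_enorm x i : `|x ord0 i| <= enorm x.
Proof.
rewrite -ler_sqr ?nnegrE ?enorm_ge0// enorm_sqr real_normK ?num_real//.
rewrite /dotrV (bigD1 i)//= expr2 lerDl; apply: sumr_ge0 => j _.
by rewrite -expr2 sqr_ge0.
Qed.

Lemma enorm_le_coord x (r : R) : 0 <= r -> (forall i, `|x ord0 i| <= r) ->
  enorm x <= d%:R * r.
Proof.
move=> r0 xr; rewrite enorm_le_sqr ?mulr_ge0// exprMn.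
apply: (@le_trans _ _ (\sum_(i < d) r ^+ 2)).
  by apply: ler_sum => i _; rewrite -expr2 -real_normK ?num_real// ler_sqr ?nnegrE.
rewrite sumr_const card_ord -[leLHS]mulr_natl ler_wpM2r ?sqr_ge0//.
by rewrite -natrX ler_nat; case: d => // n; rewrite expnS leq_pmulr// expn1.
Qed.

Lemma dotrV_sqr_le x y : dotrV x y ^+ 2 <= dotrV x x * dotrV y y.
Proof.
have [->|y0] := eqVneq y 0.
  by rewrite dotrVC !dotrV0l mulr0 expr0n.
have yy : 0 < dotrV y y.
  rewrite lt0r dotrVv_ge0 andbT; apply: contraNneq y0 => h.
  by apply/eqP/enorm_eq0; rewrite /enorm h sqrtr0.
have := dotrVv_ge0 (dotrV y y *: x - dotrV x y *: y).
rewrite -scaleNr !(dotrVDl, dotrVDr, dotrVZl, dotrVZr) [dotrV y x]dotrVC => h.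
suff : 0 <= dotrV y y * (dotrV x x * dotrV y y - dotrV x y ^+ 2).
  by rewrite pmulr_rge0// subr_ge0.
rewrite expr2; lra.
Qed.

Lemma dotrV_le x y : dotrV x y <= enorm x * enorm y.
Proof.
apply: (le_trans (ler_norm _)).
rewrite -ler_sqr ?nnegrE ?mulr_ge0 ?enorm_ge0// real_normK ?num_real//.
by rewrite exprMn !enorm_sqr dotrV_sqr_le.
Qed.

Definition qform A x := dotrV x (mxact A x).

Lemma qformZ A (k : R) x : qform A (k *: x) = k ^+ 2 * qform A x.
Proof. by rewrite /qform /mxact -scalemxAl dotrVZl dotrVZr mulrA expr2. Qed.

Lemma mxactE A x i : mxact A x ord0 i = \sum_j x ord0 j * A i j.
Proof. by rewrite mxE; apply: eq_bigr => j _; rewrite mxE. Qed.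

Definition base i : 'rV[R]_d := delta_mx ord0 i.

Lemma dotr_base i x : dotrV (base i) x = x ord0 i.
Proof.
rewrite /dotrV (bigD1 i)//= mxE !eqxx mul1r big1 ?addr0// => j ji.
by rewrite mxE (negbTE ji) andbF mul0r.
Qed.

Lemma mxact_base A i j : mxact A (base i) ord0 j = A j i.
Proof.
rewrite mxactE (bigD1 i)//= mxE !eqxx mul1r big1 ?addr0// => k ki.
by rewrite mxE (negbTE ki) andbF mul0r.
Qed.

Lemma enorm_base i : enorm (base i) = 1.
Proof. by rewrite /enorm dotr_base mxE !eqxx sqrtr1. Qed.

Section nonneg_definite.
Variable A : 'M[R]_d.
Hypotheses (symA : A^T = A) (psdA : nonneg_definite A).

Lemma qform_ge0 x : 0 <= qform A x. Proof. exact: psdA. Qed.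

Let diag_ge0 i : 0 <= A i i.
Proof. by have := psdA (base i); rewrite dotr_base mxact_base. Qed.

(** Nonnegativity of the form at e_i + e_j and e_i - e_j gives 2 |A_ij| <= A_ii + A_jj. *)
Let entry_le i j : `|A i j| <= \tr A.
Proof.
have AC : A j i = A i j by rewrite -[in LHS]symA mxE.
have [<-|ij] := eqVneq i j.
  by rewrite ger0_norm// /mxtrace (bigD1 i)//= lerDl sumr_ge0.
have trle : A i i + A j j <= \tr A.
  rewrite /mxtrace (bigD1 i)//= (bigD1 j) 1?eq_sym//= addrA lerDl.
  exact: sumr_ge0.
have := psdA (base i + base j); have := psdA (base i - base j).
rewrite -scaleN1r /mxact !mulmxDl -scalemxAl -!/(mxact A _).
rewrite !(dotrVDl, dotrVDr, dotrVZl, dotrVZr) !dotr_base !mxact_base AC => h1 h2.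
have := diag_ge0 i; have := diag_ge0 j.
by rewrite ler_norml => h3 h4; apply/andP; split; lra.
Qed.

Let trace_ge0 : 0 <= \tr A. Proof. exact: sumr_ge0. Qed.

Let enorm_mxact_le x : enorm x <= 1 -> enorm (mxact A x) <= d%:R ^+ 2 * \tr A.
Proof.
move=> x1; rewrite expr2 -mulrA; apply: enorm_le_coord; first by rewrite mulr_ge0.
move=> i; rewrite mxactE; apply: (le_trans (ler_norm_sum _ _ _)).
apply: (@le_trans _ _ (\sum_(j < d) \tr A)).
  apply: ler_sum => j _; rewrite normrM -[leRHS]mul1r; apply: ler_pM => //.
  exact: (le_trans (coord_le_enorm x j)).
by rewrite sumr_const card_ord -[leLHS]mulr_natl.
Qed.

Let opnorm_has_sup :
  has_sup [set enorm (mxact A x) | x in [set x | enorm x <= 1]].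
Proof.
split; first by exists (enorm (mxact A 0)), 0 => //=; rewrite /enorm dotrV0l sqrtr0.
by exists (d%:R ^+ 2 * \tr A) => _ [x x1 <-]; exact: enorm_mxact_le.
Qed.

Lemma opnorm_ge0 : 0 <= opnorm A.
Proof.
apply: (le_trans (enorm_ge0 (mxact A 0))); apply: ub_le_sup.
  exact: opnorm_has_sup.2.
by exists 0 => //=; rewrite /enorm dotrV0l sqrtr0.
Qed.

(** The sum is the trace, which bounds every entry. The norm of A is thus controlled by the form on
    the coordinate axes alone, where it can be compared with [psi]. *)
Lemma opnorm_le : opnorm A <= d%:R ^+ 2 * \sum_(i < d) qform A (base i).
Proof.
have -> : \sum_(i < d) qform A (base i) = \tr A.
  by apply: eq_bigr => i _; rewrite /qform dotr_base mxact_base.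
apply: ge_sup; first exact: opnorm_has_sup.1.
by move=> _ [x x1 <-]; exact: enorm_mxact_le.
Qed.

Lemma qform_le x : qform A x <= enorm x ^+ 2 * opnorm A.
Proof.
have [x0|x0] := eqVneq (enorm x) 0.
  have -> : qform A x = 0 by rewrite (enorm_eq0 x0) /qform dotrV0l.
  by rewrite x0 expr0n /= mul0r.
have xp : 0 < enorm x by rewrite lt0r x0 enorm_ge0.
set y := (enorm x)^-1 *: x.
have y1 : enorm y = 1 by rewrite enormZ gtr0_norm ?invr_gt0// mulVf.
have xE : x = enorm x *: y by rewrite scalerA mulfV// scale1r.
rewrite [in leLHS]xE qformZ ler_wpM2l ?sqr_ge0//.
apply: (le_trans (dotrV_le _ _)); rewrite y1 mul1r.
apply: ub_le_sup; first exact: opnorm_has_sup.2.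
by exists y => //=; rewrite y1.
Qed.

End nonneg_definite.
End euclidean_norm.

(** * The real part of the exponent and its directional majorants *)

Section levy_exponent.
Context {R : realType} {d : nat} (A : 'M[R]_d)
  (N : {measure set 'rV[R]_d -> \bar R}) (b : 'rV[R]_d).
Hypotheses (symA : A^T = A) (psdA : nonneg_definite A) (LN : levy_measure N).
Implicit Types (x y z : 'rV[R]_d) (r : R).

Let g z : R := Num.min 1 (dotrV z z).

Let g_ge0 z : 0 <= g z. Proof. by rewrite le_min ler01 dotrVv_ge0. Qed.

Let mdotrV x : measurable_fun setT (dotrV x).
Proof. exact: measurable_dotrV. Qed.

Let mg : measurable_fun setT g.
Proof. by apply: measurable_minr => //; exact: measurable_dotrV. Qed.

Let ig : N.-integrable setT (EFin \o g).
Proof.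
apply/integrableP; split; first exact/measurable_EFinP.
under eq_integral => z _ do rewrite /= ger0_norm// /g -enorm_sqr.
exact: LN.2.
Qed.

Lemma levy_integrable (f : 'rV[R]_d -> R) (K : R) : measurable_fun setT f ->
  (forall z, `|f z| <= K * Num.min 1 (dotrV z z)) -> N.-integrable setT (EFin \o f).
Proof.
move=> mf fK; apply: (le_integrable _ _ _ (integrableZl measurableT K ig)) => //.
  exact/measurable_EFinP.
by move=> z _; rewrite /= lee_fin; exact: (le_trans (fK z) (ler_norm _)).
Qed.

(** The origin is a null set, and by Markov's inequality each set where min(1, |z|^2) >= 1/(n+1) has
    finite mass. This makes Tonelli available for [N]. *)
Lemma levy_sigma_finite : sigma_finite setT N.
Proof.
exists (fun n => g @^-1` [set 0] `|` g @^-1` `[n.+1%:R^-1, +oo[%classic).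
  apply/esym; rewrite -subTset => z _.
  have [g0|g0] := eqVneq (g z) 0; first by exists 0%N => //; left.
  have gp : 0 < g z by rewrite lt0r g0 g_ge0.
  exists (Num.truncn (g z)^-1) => //; right; rewrite /= in_itv/= andbT.
  rewrite -[leRHS]invrK lef_pV2 ?posrE ?invr_gt0//.
  by rewrite ltW// truncnS_gt.
move=> n; have m1 : measurable (g @^-1` [set 0]).
  by rewrite -[X in measurable X]setTI; exact: mg.
have m2 : measurable (g @^-1` `[n.+1%:R^-1, +oo[%classic).
  by rewrite -[X in measurable X]setTI; apply: mg => //; exact: measurable_itv.
split; first exact: measurableU.
apply: (le_lt_trans (measureU2 _ m1 m2)) => //.
have -> : g @^-1` [set 0] = [set 0].
  apply/seteqP; split => z /=; last by move=> ->; rewrite /g dotrV0l; exact/min_idPr.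
  move=> gz; apply: enorm_eq0; apply/eqP; rewrite -sqrf_eq0 enorm_sqr.
  move: gz; rewrite /g; case: leP => // _; last by move=> ->.
  by move/eqP; rewrite oner_eq0.
rewrite [X in (X + _)%E](_ : _ = 0%E) ?add0e; last exact: LN.1.
have n0 : 0 < n.+1%:R^-1 :> R by rewrite invr_gt0.
have h := @le_integral_abse _ _ _ N setT measurableT (EFin \o g) _
  (proj2 (measurable_EFinP _ _) mg) n0.
have E : setT `&` [set z | (n.+1%:R^-1%:E <= `|(EFin \o g) z|)%E] =
    g @^-1` `[n.+1%:R^-1, +oo[%classic.
  rewrite setTI; apply/seteqP; split => z /=; rewrite in_itv/= andbT lee_fin ger0_norm//.
rewrite E in h.
have /integrableP[_ foo] := ig.
suff fin (q : \bar R) : (n.+1%:R^-1%:E * q < +oo -> q < +oo)%E.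
  exact: fin (le_lt_trans h foo).
case: q => [r _|//|//]; first exact: ltry.
by rewrite mulry gtr0_sg// mul1e.
Qed.

Let levy_fun : set 'rV[R]_d -> \bar R := N.

HB.instance Definition _ := Measure.copy levy_fun N.

HB.instance Definition _ := Measure_isSigmaFinite.Build _ _ _ levy_fun levy_sigma_finite.

Definition levy_sfin : {sigma_finite_measure set 'rV[R]_d -> \bar R} := levy_fun.

Lemma levy_sfinE (f : 'rV[R]_d -> \bar R) :
  (\int[levy_sfin]_z f z = \int[N]_z f z)%E.
Proof. by []. Qed.

Local Notation psi := (re_char_exponent A N b).
Local Notation conc := (concentration A N).

(** The one-dimensional concentration function, at radius 1, of the image of the triplet under <x,
    .>. It bounds [psi] up to a factor 2 and is monotone along rays. *)
Definition dir_conc x : R := qform A x + \int[N]_z Num.min 1 (dotrV x z ^+ 2).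

(** Half the right derivative at l = 1 of l -> dir_conc (l x). Hence comparing it with [dir_conc]
    amounts to power growth along the ray. *)
Definition dir_trunc x : R := qform A x +
  \int[N]_(z in [set z | `|dotrV x z| < 1]) (`|dotrV x z| ^+ 2).

Let min_scale (c q : R) : 0 <= c -> 0 <= q -> Num.min 1 (c * q) <= (1 + c) * Num.min 1 q.
Proof.
move=> c0 q0; have [q1|q1] := leP 1 q; first by rewrite mulr1 ge_min lerDl c0.
by rewrite ge_min ler_wpM2r ?orbT// lerDr.
Qed.

Let min_dir_le x z : Num.min 1 (dotrV x z ^+ 2) <=
  (1 + dotrV x x) * Num.min 1 (dotrV z z).
Proof.
apply: le_trans (min_scale (dotrVv_ge0 x) (dotrVv_ge0 z)).
by rewrite le_min ge_min lexx/= ge_min dotrV_sqr_le orbT.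
Qed.

Let min_sqr_ge0 (u : R) : 0 <= Num.min 1 (u ^+ 2).
Proof. by rewrite le_min ler01 sqr_ge0. Qed.

Let mmin x : measurable_fun setT (fun z => Num.min 1 (dotrV x z ^+ 2)).
Proof. by apply: measurable_minr => //; exact: measurable_funX. Qed.

Lemma integrable_min_dir x :
  N.-integrable setT (EFin \o (fun z => Num.min 1 (dotrV x z ^+ 2))).
Proof.
apply: (@levy_integrable _ (1 + dotrV x x)) => // z.
by rewrite ger0_norm// min_dir_le.
Qed.

Let mcos x : measurable_fun setT (fun z => 1 - cos (dotrV x z)).
Proof.
apply: measurable_funB => //; apply: (measurableT_comp (f := @cos R)) => //.
by apply: continuous_measurable_fun; exact: continuous_cos.
Qed.

Lemma integrable_subr1_cos x :
  N.-integrable setT (EFin \o (fun z => 1 - cos (dotrV x z))).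
Proof.
apply: (@levy_integrable _ (2 * (1 + dotrV x x))) => // z.
rewrite ger0_norm ?subr1_cos_ge0//; apply: (le_trans (subr1_cos_le _)).
by rewrite -mulrA ler_pM2l// min_dir_le.
Qed.

Let mset x : measurable [set z | `|dotrV x z| < 1].
Proof.
have -> : [set z | `|dotrV x z| < 1] = dotrV x @^-1` `]-1, 1[%classic.
  by apply/seteqP; split => z /=; rewrite in_itv/= ltr_norml.
by rewrite -[X in measurable X]setTI; apply: mdotrV => //; exact: measurable_itv.
Qed.

Lemma integrable_sqr_dir x :
  N.-integrable [set z | `|dotrV x z| < 1] (EFin \o (fun z => `|dotrV x z| ^+ 2)).
Proof.
have := integrableS measurableT (mset x) (@subsetT _ _) (integrable_min_dir x).
apply: le_integrable => //.
  apply/measurable_EFinP/measurable_funTS/measurable_funX.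
  exact: (measurableT_comp (@normr_measurable R setT) (mdotrV x)).
move=> z /= z1; rewrite lee_fin; move: z1; move: (dotrV x z) => u u1.
have u2 : `|u| ^+ 2 <= 1 by rewrite expr_le1// ltW.
rewrite real_normK ?num_real// in u2 *.
by rewrite ger0_norm ?sqr_ge0// ger0_norm// le_min lexx u2.
Qed.

Lemma re_char_exponentE x : psi x = qform A x + \int[N]_z (1 - cos (dotrV x z)).
Proof.
rewrite /re_char_exponent /char_exponent /cintegral /=.
rewrite (_ : 0 * dotrV x b - 1 * 0 = 0) ?subr0; last by ring.
rewrite -/(qform A x) -[in RHS](opprK (\int[N]_z _)); congr (_ - _).
rewrite -[RHS]mulN1r -(RintegralZl _ measurableT (integrable_subr1_cos x)).
apply: eq_Rintegral => z _.
rewrite !mul0r !mulr0 !subrr !add0r expR0 !mul1r; ring.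
Qed.

Lemma re_char_exponent_ge0 x : 0 <= psi x.
Proof.
rewrite re_char_exponentE addr_ge0 ?qform_ge0//.
by apply: Rintegral_ge0 => z _; exact: subr1_cos_ge0.
Qed.

Lemma measurable_re_char_exponent : measurable_fun setT psi.
Proof.
have mdot2 : measurable_fun setT (fun p : 'rV[R]_d * 'rV[R]_d => dotrV p.1 p.2).
  by apply: measurable_dotrV; [exact: measurable_fst|exact: measurable_snd].
have mF : measurable_fun setT (fun p : 'rV[R]_d * 'rV[R]_d => (1 - cos (dotrV p.1 p.2))%:E).
  apply/measurable_EFinP/measurable_funB => //; apply: (measurableT_comp (f := @cos R)) => //.
  by apply: continuous_measurable_fun; exact: continuous_cos.
have F0 (p : 'rV[R]_d * 'rV[R]_d) : (0 <= (1 - cos (dotrV p.1 p.2))%:E)%E.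
  by rewrite lee_fin subr1_cos_ge0.
have h : measurable_fun setT (fun x => \int[N]_z (1 - cos (dotrV x z))).
  have := measurable_fun_fubini_tonelli_F (m2 := levy_sfin) _ mF F0.
  exact: measurableT_comp.
rewrite (_ : psi = fun x => qform A x + \int[N]_z (1 - cos (dotrV x z))); last first.
  by apply/funext => x; exact: re_char_exponentE.
apply: measurable_funD.
  apply: measurable_dotrV => //; apply/measurable_fun_rVP => i.
  rewrite (_ : (fun x : 'rV[R]_d => _) = fun x => dotrV x (\row_j A i j)).
    exact: measurable_dotrV.
  by apply/funext => x; rewrite mxactE; apply: eq_bigr => j _; rewrite !mxE.
exact: h.
Qed.

Lemma re_char_exponent_le_dir x : psi x <= 2 * dir_conc x.
Proof.
rewrite re_char_exponentE mulrDr; apply: lerD.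
  by have := qform_ge0 psdA x; lra.
rewrite -(RintegralZl _ measurableT (integrable_min_dir x)).
apply: le_Rintegral => //; [exact: integrable_subr1_cos| |].
  by have := integrableZl measurableT 2 (integrable_min_dir x).
by move=> z _; exact: subr1_cos_le.
Qed.

Lemma dir_trunc_le_re_char_exponent x : dir_trunc x <= 8 * psi x.
Proof.
rewrite re_char_exponentE mulrDr; apply: lerD.
  by have := qform_ge0 psdA x; lra.
rewrite -(RintegralZl _ measurableT (integrable_subr1_cos x)) Rintegral_mkcond.
apply: le_Rintegral => //.
- have /(integrable_mkcond _ (mset x)) := integrable_sqr_dir x.
  by rewrite restrict_EFin.
- by have := integrableZl measurableT 8 (integrable_subr1_cos x).
move=> z _; rewrite patchE; case: ifPn => [|_]; last by rewrite mulr_ge0 ?subr1_cos_ge0.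
rewrite inE /= => z1; rewrite real_normK ?num_real//.
have : `|dotrV x z| <= 2 by lra.
by move=> /subr1_cos_ge; lra.
Qed.

Lemma dir_conc_ge0 x : 0 <= dir_conc x.
Proof. by rewrite addr_ge0 ?qform_ge0//; apply: Rintegral_ge0. Qed.

Lemma dir_conc0 : dir_conc 0 = 0.
Proof.
rewrite /dir_conc /qform dotrV0l add0r.
under eq_Rintegral do rewrite dotrV0l expr0n/= (min_idPr ler01).
by rewrite Rintegral_cst// mul0r.
Qed.

Let integrable_trunc x : N.-integrable setT
  (EFin \o ((fun z => `|dotrV x z| ^+ 2) \_ [set z | `|dotrV x z| < 1])).
Proof. by rewrite -restrict_EFin -integrable_mkcond//; exact: integrable_sqr_dir. Qed.

Let sqr_norm_le1 (u : R) : `|u| < 1 -> u ^+ 2 <= 1.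
Proof. by move=> u1; rewrite -(real_normK (num_real u)) expr_le1// ltW. Qed.

(** Pointwise in z: where |<x,z>| < 1 the two integrands on the left add up to <x,z>^2, an equality;
    elsewhere the truncated term is 0 and the minimum only decreases. *)
Lemma dir_concZ_add_trunc_le (l : R) x : 0 <= l <= 1 ->
  dir_conc (l *: x) + (1 - l ^+ 2) * dir_trunc x <= dir_conc x.
Proof.
move=> /andP[l0 l1]; have l2 : 0 <= 1 - l ^+ 2 by rewrite subr_ge0 expr_le1.
rewrite /dir_conc /dir_trunc qformZ mulrDr.
suff : \int[N]_z Num.min 1 (dotrV (l *: x) z ^+ 2) +
    (1 - l ^+ 2) * \int[N]_(z in [set z | `|dotrV x z| < 1]) `|dotrV x z| ^+ 2
    <= \int[N]_z Num.min 1 (dotrV x z ^+ 2).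
  by move=> h; lra.
rewrite [X in (1 - _) * X]Rintegral_mkcond.
have i1 := integrable_min_dir (l *: x).
have i2 := integrableZl measurableT (1 - l ^+ 2) (integrable_trunc x).
rewrite -(RintegralZl _ measurableT (integrable_trunc x)) -RintegralD//.
apply: le_Rintegral => //; first exact: (integrableD measurableT i1 i2).
  exact: integrable_min_dir.
move=> z _; rewrite patchE dotrVZl exprMn; case: ifPn => [/set_mem/= u1|_].
  have u2 := sqr_norm_le1 u1; rewrite real_normK ?num_real// (min_idPr u2).
  have lu : l ^+ 2 * dotrV x z ^+ 2 <= dotrV x z ^+ 2.
    by rewrite ler_piMl ?sqr_ge0//; lra.
  by rewrite (min_idPr (le_trans lu u2)); lra.
rewrite mulr0 addr0 le_min ge_min lexx/= ge_min; apply/orP; right.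
by rewrite ler_piMl ?sqr_ge0//; lra.
Qed.

(** Pointwise in z: where |<lx,z>| < 1 the square <x,z>^2 is l^-2 times the truncated one; elsewhere
    the minimum at lx already equals 1. *)
Lemma dir_conc_le_trunc (l : R) x : 0 < l ->
  dir_conc x <= l ^- 2 * dir_trunc (l *: x) + dir_conc (l *: x).
Proof.
move=> l0; have l2 : 0 < l ^- 2 by rewrite invr_gt0 exprn_gt0.
have lE q : l ^- 2 * (l ^+ 2 * q) = q by rewrite mulKf// gt_eqF// exprn_gt0.
rewrite /dir_conc /dir_trunc qformZ mulrDr lE.
have q0 : 0 <= l ^+ 2 * qform A x by rewrite mulr_ge0 ?sqr_ge0 ?qform_ge0.
suff : \int[N]_z Num.min 1 (dotrV x z ^+ 2) <=
    l ^- 2 * (\int[N]_(z in [set z | `|dotrV (l *: x) z| < 1]) `|dotrV (l *: x) z| ^+ 2)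
    + \int[N]_z Num.min 1 (dotrV (l *: x) z ^+ 2).
  by move=> h; lra.
rewrite [X in _ * X]Rintegral_mkcond.
have i1 := integrable_min_dir (l *: x).
have i2 := integrableZl measurableT (l ^- 2) (integrable_trunc (l *: x)).
rewrite -(RintegralZl _ measurableT (integrable_trunc (l *: x))) -RintegralD//.
apply: le_Rintegral => //; first exact: integrable_min_dir.
  exact: (integrableD measurableT i2 i1).
move=> z _; rewrite patchE; case: ifPn => [/set_mem/= u1|/negP u1].
  rewrite real_normK ?num_real// dotrVZl exprMn lE ge_min; apply/orP; right.
  by rewrite lerDl le_min ler01 mulr_ge0 ?sqr_ge0.
have v1 : 1 <= dotrV (l *: x) z ^+ 2.
  rewrite -(real_normK (num_real _)) exprn_ege1// leNgt; apply/negP => h.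
  exact/u1/mem_set.
by rewrite mulr0 add0r (min_idPl v1) ge_min lexx.
Qed.

Lemma re_char_exponentD x y : psi (x + y) <= 2 * psi x + 2 * psi y.
Proof.
rewrite !re_char_exponentE !mulrDr addrACA; apply: lerD.
  have := qform_ge0 psdA (x - y).
  rewrite /qform /mxact -scaleN1r !mulmxDl -scalemxAl -!/(mxact A _).
  by rewrite !(dotrVDl, dotrVDr, dotrVZl, dotrVZr); lra.
rewrite -!(RintegralZl _ measurableT (integrable_subr1_cos _)).
have iz z : N.-integrable setT (EFin \o (fun w => 2 * (1 - cos (dotrV z w)))).
  by have := integrableZl measurableT 2 (integrable_subr1_cos z).
rewrite -RintegralD//; apply: le_Rintegral => //; first exact: integrable_subr1_cos.
  by have := integrableD measurableT (iz x) (iz y).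
by move=> z _; rewrite dotrVDl subr1_cosD.
Qed.

Lemma re_char_exponent0 : psi 0 = 0.
Proof.
rewrite re_char_exponentE /qform dotrV0l add0r /Rintegral integral0_eq// => z _.
by rewrite dotrV0l cos0 subrr.
Qed.

(** Iteration of [re_char_exponentD] on kx + x. The exponential factor is crude but harmless, since
    k stays below a number fixed in advance. *)
Lemma re_char_exponentMn x k : psi (k%:R *: x) <= 4 ^+ k * psi x.
Proof.
elim: k => [|k IH].
  by rewrite scale0r expr0 mul1r re_char_exponent0 re_char_exponent_ge0.
rewrite -natr1 scalerDl scale1r; apply: (le_trans (re_char_exponentD _ _)).
have := re_char_exponent_ge0 x; have : 1 <= 4 ^+ k :> R by rewrite exprn_ege1// ler1n.
rewrite exprS => h1 h2; have := ler_wpM2r h2 h1; lra.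
Qed.

Lemma integrable_min_enorm r : 0 < r -> N.-integrable setT
  (EFin \o (fun z => Num.min 1 (enorm z ^+ 2 / r ^+ 2))).
Proof.
move=> r0; apply: (@levy_integrable _ (1 + r ^- 2)) => [|z].
  under eq_fun do rewrite enorm_sqr.
  by apply: measurable_minr => //; apply: measurable_funM => //; exact: measurable_dotrV.
rewrite ger0_norm; last by rewrite le_min ler01 divr_ge0 ?sqr_ge0.
by rewrite mulrC enorm_sqr; apply: min_scale; rewrite ?invr_ge0 ?sqr_ge0// dotrVv_ge0.
Qed.

Lemma dir_conc_le x r : 0 < r -> enorm x <= r -> dir_conc x <= conc r^-1.
Proof.
move=> r0 xr; have xr2 : enorm x ^+ 2 <= r ^+ 2.
  by rewrite enorm_sqr -enorm_le_sqr// ltW.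
rewrite /dir_conc /concentration exprVn invrK; apply: lerD.
  by apply: (le_trans (qform_le symA psdA x)); rewrite ler_wpM2r// opnorm_ge0.
apply: le_Rintegral => //; first exact: integrable_min_dir.
  have := @integrable_min_enorm r^-1; rewrite invr_gt0 => /(_ r0).
  by apply: eq_integrable => // z _ /=; rewrite exprVn invrK.
move=> z _; rewrite le_min ge_min lexx/= ge_min; apply/orP; right.
apply: (le_trans (dotrV_sqr_le _ _)); rewrite -!enorm_sqr mulrC.
by rewrite ler_wpM2l// sqr_ge0.
Qed.

Lemma concentration_ge0 r : 0 <= conc r.
Proof.
rewrite addr_ge0//; first by rewrite mulr_ge0 ?invr_ge0 ?sqr_ge0// opnorm_ge0.
by apply: Rintegral_ge0 => z _; rewrite le_min ler01 divr_ge0 ?sqr_ge0.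
Qed.

Lemma re_char_exponent_le x r : 0 < r -> enorm x <= r -> psi x <= 2 * conc r^-1.
Proof.
move=> r0 xr; apply: (le_trans (re_char_exponent_le_dir x)).
by rewrite ler_pM2l//; exact: dir_conc_le.
Qed.

Local Notation psimax := (char_exponent_max A N b).

Let psimax_ub r : has_ubound [set psi z | z in [set z | enorm z <= r]].
Proof.
exists (2 * conc (1 + `|r|)^-1) => _ [z /= zr <-]; apply: re_char_exponent_le.
  by rewrite ltr_pwDl.
by apply: (le_trans zr); rewrite (le_trans (ler_norm _))// lerDr.
Qed.

Lemma le_char_exponent_max x r : enorm x <= r -> psi x <= psimax r.
Proof. by move=> xr; apply: ub_le_sup => //; exists x. Qed.

Lemma char_exponent_max_le r (M : R) : 0 <= r -> (forall x, enorm x <= r -> psi x <= M) ->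
  psimax r <= M.
Proof.
move=> r0 rM; apply: ge_sup; last by move=> _ [x xr <-]; exact: rM.
by exists (psi 0), 0 => //=; rewrite /enorm dotrV0l sqrtr0.
Qed.

Lemma char_exponent_max_le_conc r : 0 < r -> psimax r <= 2 * conc r^-1.
Proof.
by move=> r0; apply: char_exponent_max_le => [|x]; [exact: ltW|exact: re_char_exponent_le].
Qed.

(** Settles x = 0 in (D3) and (D4), where the inverse of the norm takes the default value 0 and
    comparison with h(1/|x|) is meaningless. *)
Lemma char_exponent_max0 : psimax 0 <= 0.
Proof.
apply: char_exponent_max_le => // x x0.
by rewrite (_ : x = 0) ?re_char_exponent0//; apply/enorm_eq0/le_anti; rewrite x0 enorm_ge0.
Qed.

(* Averaging over the segments [0, r] along the coordinate axes removes the oscillation of the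
   cosine, which pointwise could vanish at any finite set of dilations. *)
Lemma conc_le_char_exponent_max r : 0 < r ->
  conc r^-1 <= (d%:R ^+ 3 + 24 * d%:R) * psimax r.
Proof.
move=> r0.
have psi_le t i : 0 <= t <= 1 -> psi (t *: (r *: base i)) <= psimax r.
  move=> /andP[t0 t1]; apply: le_char_exponent_max.
  by rewrite !enormZ enorm_base mulr1 ger0_norm// ger0_norm ?(ltW r0)// ler_piMl// ltW.
have pm0 : 0 <= psimax r.
  apply: (le_trans (re_char_exponent_ge0 0)); apply: le_char_exponent_max.
  by rewrite /enorm dotrV0l sqrtr0 ltW.
(* The form at r e_i is at most psi(r e_i); d such terms and the factor d^2 of [opnorm_le] give
   d^3. *)
have part_A : r ^+ 2 * opnorm A <= d%:R ^+ 3 * psimax r.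
  apply: (@le_trans _ _ (r ^+ 2 * (d%:R ^+ 2 * \sum_(i < d) qform A (base i)))).
    by rewrite ler_pM2l ?exprn_gt0//; exact: opnorm_le.
  have d3 : d%:R ^+ 3 = d%:R ^+ 2 * d%:R :> R by rewrite exprSr.
  rewrite mulrCA d3 -[leRHS]mulrA ler_wpM2l ?sqr_ge0// mulr_sumr.
  rewrite mulr_natl -[X in _ *+ X](card_ord d) -sumr_const; apply: ler_sum => i _.
  apply: (le_trans _ (psi_le 1 i _)); last by rewrite ler01 lexx.
  rewrite scale1r re_char_exponentE qformZ lerDl.
  by apply: Rintegral_ge0 => z _; exact: subr1_cos_ge0.
have mbase i : measurable_fun setT (fun z : 'rV[R]_d => z ord0 i).
  exact: measurable_rV_coord.
have imin i : N.-integrable setT (EFin \o (fun z => Num.min 1 ((r * z ord0 i) ^+ 2))).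
  have := integrable_min_dir (r *: base i); apply: eq_integrable => // z _ /=.
  by rewrite dotrVZl dotr_base.
(* Tonelli exchanges the average over t in [0,1] with the integral over [N]: for fixed t the inner
   integral is at most psi(t r e_i), for fixed z it is at least 1/24 of the minimum. *)
have part_N i : \int[N]_z Num.min 1 ((r * z ord0 i) ^+ 2) <= 24 * psimax r.
  pose I01 : set R := `[0, 1]%classic.
  pose f (p : R * 'rV[R]_d) := \1_I01 p.1 * (1 - cos (p.1 * (r * p.2 ord0 i))).
  have mI : measurable_fun setT (\1_I01 : R -> R).
    by apply: measurable_indic; exact: measurable_itv.
  have mf : measurable_fun setT (fun p => (f p)%:E).
    apply/measurable_EFinP; apply: measurable_funM.
      exact: (measurableT_comp mI measurable_fst).
    apply: measurable_funB => //; apply: (measurableT_comp (f := @cos R)).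
      by apply: continuous_measurable_fun; exact: continuous_cos.
    apply: measurable_funM; first exact: measurable_fst.
    by apply: measurable_funM => //; exact: (measurableT_comp (mbase i) measurable_snd).
  have f0 p : (0 <= (f p)%:E)%E by rewrite lee_fin mulr_ge0 ?subr1_cos_ge0 ?indicE.
  have := fubini_tonelli (m1 := @lebesgue_measure R) (m2 := levy_sfin) _ mf f0.
  have int_le : (\int[@lebesgue_measure R]_t \int[levy_sfin]_z (f (t, z))%:E <= (psimax r)%:E)%E.
    apply: (@le_trans _ _ (\int[@lebesgue_measure R]_t ((psimax r)%:E * (\1_I01 t)%:E))%E).
      apply: ge0_le_integral => //.
      - by move=> t _; exact: integral_ge0.
      - exact: (measurable_fun_fubini_tonelli_F (m2 := levy_sfin) _ mf f0).
      - by apply: measurable_funeM; exact/measurable_EFinP.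
      move=> t _; rewrite levy_sfinE /f /= indicE.
      have [t01|t01] := boolP (t \in I01); last first.
        by rewrite integral0_eq ?mule0// => z _; rewrite mul0r.
      rewrite mule1; under eq_integral do rewrite mul1r -dotr_base -!dotrVZl.
      have ic := integrable_subr1_cos (t *: (r *: base i)).
      rewrite -[leLHS]fineK; last exact: (integrable_fin_num _ ic).
      rewrite lee_fin; apply: (le_trans _ (psi_le t i _)).
        by rewrite re_char_exponentE lerDr qform_ge0.
      by move: t01; rewrite inE /I01 /= in_itv.
    rewrite ge0_integralZl_EFin//; last exact/measurable_EFinP.
    rewrite integral_indic//; last exact: measurable_itv.
    by rewrite setIT /= lebesgue_measure_itv/= lte_fin ltr01 sube0 mule1.
  have int_ge : ((\int[N]_z Num.min 1 ((r * z ord0 i) ^+ 2) / 24)%:E <=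
      \int[levy_sfin]_z \int[@lebesgue_measure R]_t (f (t, z))%:E)%E.
    rewrite mulrC -(RintegralZl _ measurableT (imin i)) /Rintegral fineK; last first.
      by apply: integrable_fin_num => //; have := integrableZl measurableT 24^-1 (imin i).
    rewrite levy_sfinE; apply: ge0_le_integral => //.
    - by move=> z _; rewrite lee_fin mulr_ge0 ?invr_ge0.
    - apply/measurable_EFinP; apply: measurable_funM => //.
      by have /(measurable_int _)/measurable_EFinP := imin i.
    - exact: (measurable_fun_fubini_tonelli_G (m1 := @lebesgue_measure R) _ mf f0).
    move=> z _; rewrite mulrC; apply: (le_trans (integral_subr1_cosM_ge _)).
    rewrite integral_mkcond; apply: ge0_le_integral => //.
    - by move=> t _; rewrite patchE; case: ifP => // _; rewrite lee_fin subr1_cos_ge0.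
    - apply/(measurable_restrictT _ _).1; first exact: measurable_itv.
      apply/measurable_EFinP/measurable_funTS; apply: continuous_measurable_fun => t.
      by apply/differentiable_continuous/derivable1_diffP/ex_derive.
    - exact: (measurableT_comp mf (pair2_measurable z)).
    move=> t _; rewrite patchE /f /= indicE /I01; case: ifP => _; by rewrite ?mul1r ?mul0r.
  move=> E; have := le_trans int_ge; rewrite -E => /(_ _ int_le).
  by rewrite lee_fin; lra.
rewrite /concentration mulrDl; apply: lerD; first by rewrite exprVn invrK.
(* If some |r z_i| >= 1, that term alone is 1; otherwise every minimum is (r z_i)^2 and they sum to
   r^2 |z|^2. *)
have min_sum (z : 'rV[R]_d) : Num.min 1 (enorm z ^+ 2 / r^-1 ^+ 2) <=
    \sum_(i < d) Num.min 1 ((r * z ord0 i) ^+ 2).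
  have [/existsP[i zi]|/existsPn zi] := boolP [exists i : 'I_d, 1 <= (r * z ord0 i) ^+ 2].
    rewrite (bigD1 i)//= (min_idPl zi) ge_min lerDl; apply/orP; left.
    by apply: sumr_ge0.
  rewrite ge_min; apply/orP; right.
  rewrite enorm_sqr exprVn invrK /dotrV mulr_suml; apply: ler_sum => i _.
  have := zi i; rewrite -ltNge => /ltW/min_idPr ->.
  by rewrite exprMn mulrC expr2.
have isum : N.-integrable setT
    (fun z : 'rV[R]_d => \sum_(i < d) (Num.min 1 ((r * z ord0 i) ^+ 2))%:E)%E.
  apply: (@integrable_sum _ _ _ _ setT measurableT _ _ _
    (fun i (z : 'rV[R]_d) => (Num.min 1 ((r * z ord0 i) ^+ 2))%:E)) => i _.
  exact: imin.
have iS : N.-integrable setT (EFin \o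
    (fun z : 'rV[R]_d => \sum_(i < d) Num.min 1 ((r * z ord0 i) ^+ 2))).
  by move: isum; apply: eq_integrable => // z _; rewrite /= sumEFin.
apply: (@le_trans _ _ (\int[N]_z \sum_(i < d) Num.min 1 ((r * z ord0 i) ^+ 2))).
  apply: le_Rintegral => //.
  by apply: integrable_min_enorm; rewrite invr_gt0.
rewrite -lee_fin /Rintegral fineK; last exact: integrable_fin_num.
under eq_integral do rewrite -sumEFin.
rewrite integral_sum//.
apply: (@le_trans _ _ (\sum_(i < d) (24 * psimax r)%:E)%E).
  apply: lee_sum => i _; rewrite -[leLHS]fineK; last exact: (integrable_fin_num _ (imin i)).
  by rewrite lee_fin; exact: part_N.
by rewrite sumEFin sumr_const card_ord lee_fin -[leLHS]mulr_natl mulrA [_ * 24]mulrC.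
Qed.

End levy_exponent.

(** * The concentration function and its scaling *)

Section concentration.
Context {R : realType} {d : nat} (A : 'M[R]_d)
  (N : {measure set 'rV[R]_d -> \bar R}).
Hypotheses (symA : A^T = A) (psdA : nonneg_definite A) (LN : levy_measure N).
Implicit Types (x y z : 'rV[R]_d) (r s : R).

Local Notation conc := (concentration A N).

Lemma concentration_le r s : 0 < r -> r <= s -> conc s <= conc r.
Proof.
move=> r0 rs; have s0 : 0 < s := lt_le_trans r0 rs.
have rs2 : s ^- 2 <= r ^- 2.
  by rewrite lef_pV2 ?posrE ?exprn_gt0// lerXn2r// nnegrE ltW.
rewrite /concentration; apply: lerD; first by rewrite ler_wpM2r ?opnorm_ge0.
apply: le_Rintegral => //; [exact: integrable_min_enorm|exact: integrable_min_enorm|].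
move=> z _; rewrite le_min ge_min lexx/= ge_min; apply/orP; right.
by rewrite ler_wpM2l// sqr_ge0.
Qed.

(** Says that r^2 h(r) is nondecreasing, which serves as a quantitative continuity of h. *)
Lemma concentration_scale r s : 0 < r -> r <= s -> conc r <= (s / r) ^+ 2 * conc s.
Proof.
move=> r0 rs; have s0 : 0 < s := lt_le_trans r0 rs.
have sr1 : 1 <= (s / r) ^+ 2 by rewrite exprn_ege1// ler_pdivlMr// mul1r.
have E : (s / r) ^+ 2 * s ^- 2 = r ^- 2.
  by rewrite expr_div_n mulrAC divff ?mul1r// expf_neq0// gt_eqF.
rewrite /concentration mulrDr mulrA E lerD2l.
rewrite -(RintegralZl _ measurableT (integrable_min_enorm LN s0)).
apply: le_Rintegral => //; first exact: integrable_min_enorm.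
  exact: (integrableZl measurableT _ (integrable_min_enorm LN s0)).
move=> z _ /=; rewrite minr_pMr; last exact: le_trans sr1.
rewrite le_min !ge_min mulr1 sr1/= mulrCA E.
by rewrite lexx orbT.
Qed.

Lemma concentration_vanish (e : R) : 0 < e -> exists2 r, 0 < r & conc r < e.
Proof.
move=> e0.
have inv_cvg : (n.+1%:R^-1 : R) @[n --> \oo] --> (0 : R) by exact: cvg_harmonic.
have inv2_cvg : (n.+1%:R^-1 * n.+1%:R^-1 : R) @[n --> \oo] --> (0 : R).
  by rewrite -[X in _ --> X](mulr0 0); exact: cvgM.
have inv2E n : (n.+1%:R ^- 2 : R) = n.+1%:R^-1 * n.+1%:R^-1 by rewrite expr2 invfM.
have nR n : 0 < n.+1%:R :> R by [].
have [||||_] := @Rintegral_dominated_cvg _ _ R N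
  (fun n z => Num.min 1 (enorm z ^+ 2 / n.+1%:R ^+ 2)) (fun=> 0)
  (fun z => Num.min 1 (enorm z ^+ 2 / 1 ^+ 2)).
- move=> n; apply/measurable_EFinP.
  by have /integrableP[] := integrable_min_enorm LN (nR n).
- move=> z; have : (enorm z ^+ 2 / n.+1%:R ^+ 2) @[n --> \oo] --> (0 : R).
    rewrite -(mulr0 (enorm z ^+ 2)); apply: cvgM; first exact: cvg_cst.
    by under eq_fun do rewrite inv2E.
  apply: squeeze_cvgr; last exact: cvg_cst.
  apply: nearW => n; rewrite le_min ler01/= ge_min lexx orbT andbT.
  by rewrite divr_ge0// sqr_ge0.
- exact: integrable_min_enorm.
- move=> n z; rewrite ger0_norm ?le_min ?ler01 ?divr_ge0 ?sqr_ge0//.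
  rewrite ge_min lexx/= ge_min; apply/orP; right.
  rewrite ler_wpM2l ?sqr_ge0// lef_pV2 ?posrE ?exprn_gt0//.
  by rewrite lerXn2r ?nnegrE// ler1n.
rewrite Rintegral_cst// mul0r => cvgI.
have /cvgrPdist_lt/(_ _ e0) : conc n.+1%:R @[n --> \oo] --> (0 : R).
  rewrite -(addr0 0); apply: cvgD => //.
  rewrite -(mul0r (opnorm A)); apply: cvgM; last exact: cvg_cst.
  by under eq_fun do rewrite inv2E.
case=> n _ /(_ n (leqnn n)) /=; rewrite sub0r normrN => ne.
by exists n.+1%:R => //; apply: le_lt_trans ne; exact: ler_norm.
Qed.

Hypothesis hinfty : conc r @[r --> 0^'+] --> +oo.

Let unbounded s (M : R) : 0 < s -> exists2 r, 0 < r < s & M <= conc r.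
Proof.
move=> s0; have /cvgryPge/(_ M) := hinfty.
move=> [e /= e0 He]; exists (Num.min (e / 2) (s / 2)).
  by rewrite lt_min gt_min !divr_gt0//= orbC ltr_pdivrMr// ltr_pMr// ltr1n.
apply: He => /=; last by rewrite lt_min !divr_gt0.
rewrite sub0r normrN ger0_norm ?le_min ?divr_ge0 ?ltW//.
by rewrite gt_min ltr_pdivrMr// ltr_pMr// ltr1n.
Qed.

(* [concentration] is concave as a function of [r ^- 2], so it is bounded
   once it is constant somewhere. *)
Lemma concentration_lt r s : 0 < r -> r < s -> conc s < conc r.
Proof.
move=> r0 rs; rewrite ltNge; apply/negP => crs.
have s0 : 0 < s := lt_trans r0 rs.
(* Since r^-2 lies between s^-2 and q^-2, concavity together with h(r) <= h(s) would force h(q) <=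
   h(s), against the choice of [q]. *)
have [q /andP[q0 qr] cq] := unbounded (conc s + 1) r0.
suff : conc q <= conc s by lra.
set v := s ^- 2; set w := r ^- 2; set u := q ^- 2.
have vw : v < w by rewrite ltf_pV2 ?posrE ?exprn_gt0// ltrXn2r// ?nnegrE ltW.
have wu : w < u by rewrite ltf_pV2 ?posrE ?exprn_gt0// ltrXn2r// ?nnegrE ltW.
have uv0 : u - v != 0 by rewrite gt_eqF//; lra.
pose a := (u - w) / (u - v); pose c := (w - v) / (u - v).
have a0 : 0 <= a by apply: divr_ge0; lra.
have c0 : 0 < c by apply: divr_gt0; lra.
have ac : a + c = 1 by rewrite /a /c; field.
have wE : w = a * v + c * u by rewrite /a /c; field.
suff : a * conc s + c * conc q <= conc r.
  move=> h; rewrite -(ler_pM2l c0); have aE : a = 1 - c by lra.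
  by move: h; rewrite aE mulrBl mul1r; lra.
have im t : 0 < t -> N.-integrable setT
  (EFin \o (fun z => Num.min 1 (enorm z ^+ 2 / t ^+ 2))) by exact: integrable_min_enorm.
rewrite /concentration -/u -/v -/w wE.
rewrite 2!mulrDr -(RintegralZl _ measurableT (im _ s0)) -(RintegralZl _ measurableT (im _ q0)).
rewrite mulrDl !mulrA /= -/u -/v.
suff : \int[N]_z (a * Num.min 1 (enorm z ^+ 2 * v)) + \int[N]_z (c * Num.min 1 (enorm z ^+ 2 * u))
    <= \int[N]_z Num.min 1 (enorm z ^+ 2 * (a * v + c * u)).
  by lra.
have ia := integrableZl measurableT a (im _ s0).
have ic := integrableZl measurableT c (im _ q0).
rewrite -RintegralD//.
apply: le_Rintegral => //.
- exact: (integrableD measurableT ia ic).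
- by rewrite -wE; exact: im.
move=> z _; have z0 := sqr_ge0 (enorm z).
have ml p : Num.min 1 (enorm z ^+ 2 * p) <= 1 by rewrite ge_min lexx.
have mr p : Num.min 1 (enorm z ^+ 2 * p) <= enorm z ^+ 2 * p by rewrite ge_min lexx orbT.
have [av cu] := (ler_wpM2l a0 (ml v), ler_wpM2l (ltW c0) (ml u)).
have [av' cu'] := (ler_wpM2l a0 (mr v), ler_wpM2l (ltW c0) (mr u)).
have E : enorm z ^+ 2 * (a * v + c * u) = a * (enorm z ^+ 2 * v) + c * (enorm z ^+ 2 * u).
  by rewrite mulrDr; congr (_ + _); rewrite mulrCA.
rewrite le_min E (lerD av' cu') andbT.
by apply: (le_trans (lerD av cu)); rewrite !mulr1 ac.
Qed.

(** The preimage is the supremum of the radii where h >= y. [concentration_scale] replaces the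
    intermediate value theorem. *)
Lemma concentration_surj (y : R) : 0 < y -> exists2 r, 0 < r & conc r = y.
Proof.
move=> y0; pose S := [set r | 0 < r /\ y <= conc r].
have [r1 /andP[r10 _] r1y] := unbounded y ltr01.
have [r2 r20 r2y] := concentration_vanish y0.
have supS : has_sup S.
  split; first by exists r1.
  exists r2 => r [r0 yr]; rewrite leNgt; apply/negP => r2r.
  by have := concentration_le r20 (ltW r2r); lra.
have r0_ge r : S r -> r <= sup S by move=> Sr; apply: ub_le_sup => //; case: supS.
have r0_gt0 : 0 < sup S by apply: (lt_le_trans r10); exact: r0_ge.
exists (sup S) => //.
have conc0 : 0 < conc (sup S).
  have := concentration_scale r10 (r0_ge _ (conj r10 r1y)).
  move/(le_trans r1y)/(lt_le_trans y0); rewrite pmulr_rgt0//.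
  by rewrite exprn_gt0// divr_gt0.
(* A dilation by k changes h by at most the factor h(sup S)/y. If h(sup S) > y, then h is still at
   least y at k sup S > sup S; if h(sup S) < y, a point of S above k sup S has h < y. *)
pose k := Num.sqrt (conc (sup S) / y).
have k2 : k ^+ 2 = conc (sup S) / y by rewrite sqr_sqrtr// ltW// divr_gt0.
have k0 : 0 < k by rewrite sqrtr_gt0 divr_gt0.
apply/le_anti/andP; split; rewrite leNgt; apply/negP => lt.
  have k1 : 1 < k by rewrite -(@ltr_pXn2r _ 2)// ?nnegrE ?ltW// expr1n k2 ltr_pdivlMr// mul1r.
  have rs : sup S < k * sup S by rewrite ltr_pMl.
  have ks0 : 0 < k * sup S by rewrite mulr_gt0.
  have small : conc (k * sup S) < y.
    rewrite ltNge; apply/negP => ge.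
    by have := r0_ge _ (conj ks0 ge); rewrite leNgt rs.
  have := concentration_scale r0_gt0 (ltW rs).
  rewrite mulfK ?gt_eqF// k2 leNgt => /negP; apply.
  rewrite mulrAC ltr_pdivrMr// ltr_pM2l//.
have k1 : k < 1.
  by rewrite -(@ltr_pXn2r _ 2)// ?nnegrE ?ltW// expr1n k2 ltr_pdivrMr// mul1r.
have [||r Sr] := @sup_adherent _ S (sup S - k * sup S) => //.
  by rewrite subr_gt0 gtr_pMl.
rewrite opprB addrC subrK => kr; case: (Sr) => r0 yr.
have := concentration_scale r0 (r0_ge _ Sr).
move/(le_trans yr); rewrite leNgt => /negP; apply.
have -> : y = k ^- 2 * conc (sup S).
  by rewrite k2 invf_div mulfVK// gt_eqF.
rewrite ltr_pM2r// -exprVn ltrXn2r ?nnegrE ?invr_ge0 ?divr_ge0 ?ltW//.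
by rewrite ltr_pdivrMr// mulrC ltr_pdivlMr// mulrC.
Qed.

Local Notation cinv := (concentration_inv A N).

Lemma concentration_inv_gt0 (y : R) : 0 < y -> 0 < cinv y.
Proof.
move=> y0; have [r r0 rE] := concentration_surj y0.
have yi : (conc @` [set r | 0 < r]) y by exists r.
by have := @funS _ _ _ _ (cinv) y yi.
Qed.

Lemma concentration_invK (y : R) : 0 < y -> conc (cinv y) = y.
Proof.
move=> y0; have [r r0 rE] := concentration_surj y0.
by apply: pinvK; apply/mem_set; exists r.
Qed.

Lemma concentrationK r : 0 < r -> cinv (conc r) = r.
Proof.
move=> r0; apply: pinvKV; last exact/mem_set.
move=> s t /set_mem/= s0 /set_mem/= t0 st.
by have [/(concentration_lt s0)|/(concentration_lt t0)|//] := ltgtP s t; rewrite st ltxx.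
Qed.

Lemma concentration_gt0 r : 0 < r -> 0 < conc r.
Proof.
move=> r0; have r1 : r < r + 1 by lra.
by apply: le_lt_trans (concentration_lt r0 r1); exact: concentration_ge0.
Qed.

End concentration.

(** * From halving at one scale to power scaling *)

Section power_scaling.
Context {R : realType}.
Implicit Types (l r s : R).

Let exists_geometric l0 l : 0 < l0 < 1 -> 0 < l <= 1 ->
  exists n, l0 ^+ n.+1 <= l <= l0 ^+ n.
Proof.
move=> /andP[l00 l01] /andP[l_gt0 l_le1].
have ex : exists n, l0 ^+ n.+1 <= l.
  have /cvgrPdist_lt/(_ _ l_gt0)[n _ /(_ n (leqnn n))/=] : l0 ^+ n @[n --> \oo] --> (0 : R).
    by apply: cvg_expr; rewrite ger0_norm// ltW.
  rewrite sub0r normrN ger0_norm ?exprn_ge0 ?ltW// => ln; exists n.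
  by apply: ltW; apply: le_lt_trans ln; rewrite exprS ler_piMl ?exprn_ge0 ?ltW.
case: (ex_minnP ex) => n ln min_n; exists n; rewrite ln/=.
case: n ln min_n => [|n] ln min_n; first by rewrite expr0.
by rewrite leNgt; apply/negP => /ltW/min_n; rewrite ltnn.
Qed.

(** The halving is iterated along powers of l0, and l is rounded up to such a power; the rounding
    costs the factor 2. *)
Lemma power_scaling (F : R -> R) (r0 l0 : R) :
  (forall r s, 0 < r -> r <= s -> s < r0 -> F r <= F s) ->
  (forall r, 0 < r < r0 -> 0 <= F r) ->
  0 < l0 < 1 -> (forall r, 0 < r < r0 -> F (l0 * r) <= 2^-1 * F r) ->
  exists2 alpha, 0 < alpha <= 2 &
    forall l r, 0 < l <= 1 -> 0 < r < r0 -> F (l * r) <= 2 * l `^ alpha * F r.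
Proof.
move=> F_le F_ge0 l001 F_half; have /andP[l00 l01] := l001.
have ln_l0 : 0 < - ln l0 by rewrite oppr_gt0 ln_lt0// l00.
have ln2 : 0 < ln 2 :> R by rewrite ln_gt0// ltr1n.
(* The second entry solves l0^alpha = 1/2. The cap 2 is the range required in (D3); lowering alpha
   only weakens the bound as l <= 1. *)
exists (Num.min 2 (ln 2 / - ln l0)).
  by rewrite lt_min ge_min lexx/= divr_gt0// ltr0n.
set alpha := Num.min _ _.
have alpha0 : 0 < alpha by rewrite lt_min divr_gt0// ltr0n.
have l0alpha : 2^-1 <= l0 `^ alpha.
  rewrite /powR gt_eqF// -[leLHS](@lnK R) ?posrE ?invr_gt0// ler_expR lnV ?posrE//.
  rewrite lerNl -mulrN -ler_pdivlMr// /alpha ge_min; apply/orP; right.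
  exact: lexx.
have F_iter n r : 0 < r < r0 -> F (l0 ^+ n * r) <= 2^-1 ^+ n * F r.
  move=> /andP[rp rr0]; elim: n => [|n IH]; first by rewrite !mul1r.
  rewrite !exprS -!mulrA; apply: le_trans (F_half _ _) _.
    rewrite mulr_gt0 ?exprn_gt0//=; apply: le_lt_trans rr0.
    by rewrite ler_piMl ?exprn_ile1 ?ltW.
  by rewrite ler_pM2l ?invr_gt0.
move=> l r l_01 /andP[rp rr0]; have /andP[lp l1] := l_01.
have [n /andP[ln nl]] := exists_geometric l001 l_01.
have ln_r0 : l0 ^+ n * r < r0.
  by apply: le_lt_trans rr0; rewrite ler_piMl ?exprn_ile1 ?ltW.
apply: (@le_trans _ _ (F (l0 ^+ n * r))).
  by apply: F_le => //; [rewrite mulr_gt0|rewrite ler_pM2r].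
apply: (le_trans (F_iter n r _)); first by rewrite rp.
apply: ler_wpM2r; first by apply: F_ge0; rewrite rp.
have -> : 2^-1 ^+ n = 2 * 2^-1 ^+ n.+1 :> R by rewrite exprS mulrA divff// mul1r.
rewrite ler_pM2l//; apply: (@le_trans _ _ ((l0 ^+ n.+1) `^ alpha)).
  rewrite -powR_mulrn; last exact: ltW.
  rewrite -powRrM mulrC powRrM powR_mulrn; last exact: powR_ge0.
  by apply: lerXn2r; rewrite ?nnegrE ?powR_ge0 ?invr_ge0.
apply: ge0_ler_powR => //; rewrite ?nnegrE; first exact: ltW.
  by rewrite exprn_ge0// ltW.
exact: ltW.
Qed.

End power_scaling.

(** * Bounds on the integral of exp (- t Re Psi) *)

Section packing.
Context {R : realType} {d : nat} (A : 'M[R]_d)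
  (N : {measure set 'rV[R]_d -> \bar R}) (b : 'rV[R]_d).
Hypotheses (symA : A^T = A) (psdA : nonneg_definite A) (LN : levy_measure N).
Implicit Types (x y z w c : 'rV[R]_d) (t M r : R).

Local Notation psi := (re_char_exponent A N b).
Local Notation mu := (lebesgue_rV (R:=R) d).

Lemma enormD x y : enorm (x + y) <= enorm x + enorm y.
Proof.
rewrite enorm_le_sqr ?addr_ge0 ?enorm_ge0// dotrVDl !dotrVDr (dotrVC y x) sqrrD.
by rewrite !enorm_sqr; have := dotrV_le x y; lra.
Qed.

Let cube c r : set 'rV[R]_d :=
  [set y | forall i, `]c ord0 i - r, c ord0 i + r[%classic (y ord0 i)].

Let measurable_cube c r : measurable (cube c r).
Proof.
apply: (measurable_rV_box (B := fun i => `]c ord0 i - r, c ord0 i + r[%classic)) => i.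
exact: measurable_itv.
Qed.

Let enorm_cube c r y : 0 <= r -> cube c r y -> enorm (y - c) <= d%:R * r.
Proof.
move=> r0 cy; apply: enorm_le_coord => // i.
by have := cy i; rewrite /= in_itv/= !mxE ler_norml => /andP[? ?]; lra.
Qed.

Let lebesgue_cube c r : 0 < r -> mu (cube c r) = ((2 * r) ^+ d)%:E.
Proof.
move=> r0; rewrite /cube.
rewrite (lebesgue_rV_box (B := fun i => `]c ord0 i - r, c ord0 i + r[%classic)); last first.
  by move=> i; exact: measurable_itv.
rewrite (eq_bigr (fun=> (2 * r)%:E)); last first.
  move=> i _; rewrite lebesgue_measure_itv/= lte_fin ifT; last by lra.
  by rewrite -EFinD; congr (_%:E); ring.
by rewrite prodEFin prodr_const card_ord.
Qed.

Lemma measurable_expR_psi t :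
  measurable_fun setT (fun z => (expR (- (t * psi z)))%:E).
Proof.
apply/measurable_EFinP; apply: measurableT_comp => //; apply: measurableT_comp => //.
by apply: measurable_funM => //; exact: measurable_re_char_exponent.
Qed.

Let integral_cube c t r M : 0 < r -> (forall y, cube c r y -> t * psi y <= M) ->
  ((expR (- M) * (2 * r) ^+ d)%:E <= \int[mu]_(z in cube c r) (expR (- (t * psi z)))%:E)%E.
Proof.
move=> r0 psiM; rewrite EFinM -(lebesgue_cube c r0) -integral_cst//.
apply: ge0_le_integral => //.
- by move=> z _; rewrite lee_fin expR_ge0.
- exact: measurable_funS (measurable_expR_psi t).
- by move=> z cz; rewrite lee_fin ler_expR lerN2; exact: psiM.
Qed.

(** The cube of half-side r/d lies in the ball of radius r, because the Euclidean norm is at most d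
    times the largest coordinate. *)
Lemma le_integral_expR_ball t r M : (0 < d)%N -> 0 < r ->
  (forall w, enorm w <= r -> t * psi w <= M) ->
  ((expR (- M) * (2 * r / d%:R) ^+ d)%:E <= \int[mu]_z (expR (- (t * psi z)))%:E)%E.
Proof.
move=> d0 r0 psiM; have dR : 0 < d%:R :> R by rewrite ltr0n.
have rd0 : 0 < r / d%:R by rewrite divr_gt0.
rewrite -mulrA; apply: (le_trans (integral_cube (c := 0) (t := t) rd0 _)).
  move=> y /(enorm_cube (ltW rd0)); rewrite subr0 mulrC divfK ?gt_eqF//.
  exact: psiM.
by apply: ge0_subset_integral => //; exact: measurable_expR_psi.
Qed.

(* The cubes around [k *: x], [k < K], are disjoint, and on each of them
   [t * psi] is bounded because [psi (k *: x) <= 4 ^ k * psi x]. *)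
Lemma le_integral_expR_packing x t r M (K : nat) : (0 < d)%N -> 0 < r ->
  2 * r < enorm x -> 0 < t -> (forall w, enorm w <= r -> t * psi w <= M) ->
  4 ^+ K * (t * psi x) <= 1 ->
  ((K%:R * (expR (- (2 + 2 * M)) * (2 * r / d%:R) ^+ d))%:E <=
   \int[mu]_z (expR (- (t * psi z)))%:E)%E.
Proof.
move=> d0 r0 xr t0 psiM Kpsi; have dR : 0 < d%:R :> R by rewrite ltr0n.
have rd0 : 0 < r / d%:R by rewrite divr_gt0.
pose Q k := cube (k%:R *: x) (r / d%:R).
have enormQ k y : Q k y -> enorm (y - k%:R *: x) <= r.
  by move/(enorm_cube (ltW rd0)); rewrite mulrC divfK ?gt_eqF.
have psi_ge0 := re_char_exponent_ge0 b psdA LN.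
(* The centre contributes 2 t psi(kx) <= 2 by the smallness of psi(x), the offset contributes at
   most 2M. *)
have psiQ k y : (k < K)%N -> Q k y -> t * psi y <= 2 + 2 * M.
  move=> kK /enormQ/psiM; set w := y - _ => wM.
  have -> : y = k%:R *: x + w by rewrite /w addrC subrK.
  apply: (@le_trans _ _ (t * (2 * psi (k%:R *: x) + 2 * psi w))).
    by rewrite ler_pM2l//; exact: re_char_exponentD.
  rewrite mulrDr; apply: lerD; last by rewrite mulrCA ler_pM2l.
  rewrite mulrCA -[leRHS]mulr1 ler_pM2l//; apply: le_trans Kpsi.
  apply: (@le_trans _ _ (t * (4 ^+ k * psi x))).
    by rewrite ler_pM2l//; exact: re_char_exponentMn.
  rewrite mulrCA ler_wpM2r ?mulr_ge0 ?(ltW t0)//.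
  by apply: ler_weXn2l; [rewrite ler1n|exact: ltnW].
have triQ : trivIset [set` iota 0 K] Q.
  move=> j k _ _ [y [/enormQ yj /enormQ yk]]; apply/eqP/negPn/negP => jk.
  have : enorm x <= 2 * r; last by rewrite leNgt xr.
  have jk1 : 1 <= `|j%:R - k%:R : R|.
    by case: (ltngtP j k) jk => // jk _; [rewrite distrC|];
      rewrite -natrB ?(ltnW jk)// normr_nat ler1n subn_gt0.
  apply: (@le_trans _ _ (enorm ((j%:R - k%:R) *: x))).
    by rewrite enormZ -[leLHS]mul1r ler_wpM2r// enorm_ge0.
  have -> : (j%:R - k%:R) *: x = (y - k%:R *: x) + (- 1) *: (y - j%:R *: x).
    by rewrite scaleN1r scalerBl opprB [RHS]addrC addrA subrK.
  apply: (le_trans (enormD _ _)).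
  by rewrite enormZ normrN normr1 mul1r; lra.
have mQ k : measurable (Q k) by exact: measurable_cube.
apply: (@le_trans _ _ (\int[mu]_(z in \big[setU/set0]_(k <- iota 0 K) Q k)
    (expR (- (t * psi z)))%:E)%E).
  rewrite ge0_integral_bigsetU//; last 2 first.
  - exact: iota_uniq.
  - exact: measurable_funS (measurable_expR_psi t).
  apply: (@le_trans _ _ (\sum_(k <- iota 0 K) (expR (- (2 + 2 * M)) * (2 * r / d%:R) ^+ d)%:E)%E).
    by rewrite sumEFin big_const_seq count_predT size_iota iter_addr_0 mulr_natl.
  rewrite big_seq [leRHS]big_seq; apply: lee_sum => k; rewrite mem_iota add0n => /= kK.
  by rewrite -[2 * r / _]mulrA; apply: integral_cube => // y; exact: psiQ.
apply: ge0_subset_integral => //.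
- exact: bigsetU_measurable.
- exact: measurable_expR_psi.
Qed.

End packing.

(** * From integral bounds to scaling and to truncated moments *)

Section scaling_conditions.
Context {R : realType} {d : nat} (A : 'M[R]_d)
  (N : {measure set 'rV[R]_d -> \bar R}) (b : 'rV[R]_d).
Hypotheses (d0 : (0 < d)%N) (symA : A^T = A) (psdA : nonneg_definite A)
  (LN : levy_measure N).
Hypothesis hinfty : concentration A N r @[r --> 0^'+] --> +oo.
Implicit Types (x y z w : 'rV[R]_d) (t s r : R).

Local Notation psi := (re_char_exponent A N b).
Local Notation psimax := (char_exponent_max A N b).
Local Notation conc := (concentration A N).
Local Notation g t := (concentration_inv A N t^-1).
Local Notation mu := (lebesgue_rV (R:=R) d).
Local Notation U := (dir_trunc A N).

Let cd : R := d%:R ^+ 3 + 24 * d%:R.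

Let dR1 : 1 <= d%:R :> R. Proof. by rewrite ler1n. Qed.

Let dR0 : 0 < d%:R :> R. Proof. by rewrite ltr0n. Qed.

Let cd1 : 1 <= cd.
Proof. by rewrite /cd; have : 0 <= d%:R ^+ 3 :> R by []; have := dR1; lra. Qed.

Let cd0 : 0 < cd. Proof. exact: lt_le_trans cd1. Qed.

Let psi_ge0 x : 0 <= psi x.
Proof. exact: re_char_exponent_ge0. Qed.

Let U_ge0 x : 0 <= U x.
Proof.
apply: addr_ge0; first exact: qform_ge0.
by apply: Rintegral_ge0 => z _; exact: exprn_ge0.
Qed.

Let conc_gt0 r : 0 < r -> 0 < conc r.
Proof. exact: concentration_gt0. Qed.

Let conc_cd r : 0 < r -> conc r^-1 <= cd * psimax r.
Proof. exact: conc_le_char_exponent_max. Qed.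

Let gt0 t : 0 < t -> 0 < g t.
Proof. by move=> t0; apply: concentration_inv_gt0; rewrite ?invr_gt0. Qed.

Let concg t : 0 < t -> conc (g t) = t^-1.
Proof. by move=> t0; apply: concentration_invK; rewrite ?invr_gt0. Qed.

Let ltK s t : 0 < s -> 0 < t -> (g t < s) = (conc s < t^-1).
Proof.
move=> s0 t0; rewrite -[X in _ = (_ < X)](concg t0); apply/idP/idP => [|h].
  by apply: concentration_lt => //; exact: gt0.
by rewrite ltNge; apply/negP => /(concentration_le symA psdA LN s0); rewrite leNgt h.
Qed.

(** On the ball of radius 1/g(t/2) one has psi <= 2 h(g(t/2)) = 4/t, so the integral is at least a
    constant times g(t/2)^-d, to be compared with c g(t)^-d. The parameter [a] covers both the
    Plancherel bound (a = 2) and (D2) itself (a = 1). *)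
Lemma concentration_inv_doubling (a c T : R) : 0 < a -> 0 < T ->
  (forall t, T < t ->
    (\int[mu]_z (expR (- (a * t * psi z)))%:E <= (c * g t ^- d)%:E)%E) ->
  exists2 C, 1 < C & forall t, T < t -> g t <= C * g (t / 2).
Proof.
move=> a0 T0 H; pose K := c * expR (4 * a) * (d%:R / 2) ^+ d.
(* The ratio u = g(t)/g(t/2) satisfies u^d <= K; for u > 1 this gives u <= K without a d-th root. *)
exists (2 + `|K|); first by have := normr_ge0 K; lra.
move=> t Tt; have t0 : 0 < t := lt_trans T0 Tt.
have t20 : 0 < t / 2 by rewrite divr_gt0.
set s := g (t / 2); have s0 : 0 < s by exact: gt0.
have sV0 : 0 < s^-1 by rewrite invr_gt0.
have ball w : enorm w <= s^-1 -> a * t * psi w <= 4 * a.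
  move=> ws; apply: (@le_trans _ _ (a * t * (2 * conc s))).
    rewrite ler_pM2l ?mulr_gt0// -[s]invrK; apply: re_char_exponent_le => //.
  rewrite concg// invf_div le_eqVlt; apply/orP; left; apply/eqP.
  by field; rewrite gt_eqF.
have := le_trans (le_integral_expR_ball LN d0 sV0 ball) (H t Tt).
rewrite lee_fin; set u := g t / s => h.
have u0 : 0 < u by rewrite divr_gt0// gt0.
have gE : g t = u * s by rewrite divfK// gt_eqF.
suff : u <= 2 + `|K| by rewrite gE ler_pM2r.
have [u1|u1] := leP u 1; first by have := normr_ge0 K; lra.
have uud : u <= u ^+ d by rewrite -[leLHS]expr1; apply: ler_weXn2l => //; exact: ltW.
suff : u ^+ d <= K by have := ler_norm K; lra.
move: h; rewrite gE ler_pdivlMr; last by rewrite exprn_gt0// mulr_gt0.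
rewrite [(u * s) ^+ d]exprMn.
have -> : expR (- (4 * a)) * (2 * s^-1 / d%:R) ^+ d * (u ^+ d * s ^+ d) =
    u ^+ d * (expR (- (4 * a)) * (2 / d%:R) ^+ d).
  rewrite !exprMn !exprVn; field.
  by rewrite !expf_neq0// gt_eqF.
rewrite -ler_pdivlMr; last by rewrite mulr_gt0 ?expR_gt0// exprn_gt0// divr_gt0.
by rewrite invfM -expRN opprK -exprVn invf_div mulrA.
Qed.

(** At t = 2/h(1/r) one has g(t/2) = 1/r, so doubling reads g(t) <= C/r, that is h(C/r) <= h(1/r)/2:
    a halving at scale l0 = 1/C. *)
Lemma concentration_scaling (C T : R) : 1 < C -> 0 < T ->
  (forall t, T < t -> g t <= C * g (t / 2)) ->
  exists2 r0, 0 < r0 & exists2 alpha, 0 < alpha <= 2 &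
    forall l r, 0 < l <= 1 -> 0 < r < r0 -> conc (l * r)^-1 <= 2 * l `^ alpha * conc r^-1.
Proof.
move=> C1 T0 gC; have C0 : 0 < C := lt_trans ltr01 C1.
have T20 : 0 < T / 2 by rewrite divr_gt0.
have g0 := gt0 T20.
exists (g (T / 2))^-1; first by rewrite invr_gt0.
apply: (@power_scaling R (fun r => conc r^-1) _ C^-1).
- move=> r s r0 rs _; apply: concentration_le => //; rewrite ?invr_gt0 ?(lt_le_trans r0 rs)//.
  by rewrite lef_pV2 ?posrE// (lt_le_trans r0 rs).
- by move=> r /andP[r0 _]; rewrite ltW// conc_gt0// invr_gt0.
- by rewrite invr_gt0 C0 invf_lt1.
move=> r /andP[r0 rg]; have rV0 : 0 < r^-1 by rewrite invr_gt0.
have cr0 := conc_gt0 rV0.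
pose t := 2 / conc r^-1; have t0 : 0 < t by rewrite divr_gt0.
have t2 : t / 2 = (conc r^-1)^-1 by rewrite /t mulrAC divff// mul1r.
have Tt : T < t.
  have : g (T / 2) < r^-1 by rewrite -[X in X < _]invrK ltf_pV2 ?posrE ?invr_gt0.
  rewrite ltK// invf_div => h; rewrite /t ltr_pdivlMr// mulrC.
  by move: h; rewrite ltr_pdivlMr// mulrC.
have := gC t Tt; rewrite t2 invrK concentrationK// => gt_le.
apply: (@le_trans _ _ (conc (g t))).
  by apply: (concentration_le symA psdA LN (gt0 t0)); rewrite [leRHS]invfM invrK.
by rewrite concg// /t invf_div mulrC.
Qed.

Lemma char_exponent_max_scaling (K r0 alpha : R) :
  (forall l r, 0 < l <= 1 -> 0 < r < r0 -> conc (l * r)^-1 <= K * l `^ alpha * conc r^-1) ->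
  0 <= K -> forall l r, 0 < l <= 1 -> 0 < r < r0 ->
  psimax (l * r) <= 2 * K * cd * l `^ alpha * psimax r.
Proof.
move=> H K0 l r l01 r01; have /andP[l0 _] := l01; have /andP[rp _] := r01.
apply: (le_trans (char_exponent_max_le_conc b symA psdA LN (mulr_gt0 l0 rp))).
rewrite -!mulrA ler_pM2l//; apply: (le_trans (H l r l01 r01)).
rewrite -!mulrA ler_wpM2l// mulrCA ler_wpM2l ?powR_ge0//.
exact: conc_cd.
Qed.

(** With t = 1/h(1/|x|), so that g(t) = 1/|x|, cubes of size proportional to |x| each contribute v
    |x|^d to the integral. K of them with K v > c contradict the bound c |x|^d, hence 4^K t psi(x) >
    1. *)
Lemma char_exponent_max_le_re (c T : R) : 0 < T ->
  (forall t, T < t ->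
    (\int[mu]_z (expR (- (t * psi z)))%:E <= (c * g t ^- d)%:E)%E) ->
  exists2 r0, 0 < r0 & exists2 k, 0 < k &
    forall x, enorm x < r0 -> k * psimax (enorm x) <= psi x.
Proof.
move=> T0 H; exists (g T)^-1; first by rewrite invr_gt0 gt0.
pose v : R := expR (- (2 + 2 * 2)) * (2 / 3 / d%:R) ^+ d.
have v0 : 0 < v by rewrite mulr_gt0 ?expR_gt0// exprn_gt0// !divr_gt0.
pose K := (Num.truncn (c / v)).+1.
have cK : c < K%:R * v by rewrite -ltr_pdivrMr//; exact: truncnS_gt.
have K0 : 0 < 4 ^+ K :> R by rewrite exprn_gt0.
(* 4^-K comes from the packing, 1/2 from the bound of [psimax] by 2h. *)
exists (2^-1 / 4 ^+ K); first by rewrite divr_gt0.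
move=> x xg; have [x0|x0] := eqVneq (enorm x) 0.
  rewrite x0; apply: (le_trans _ (psi_ge0 x)).
  by rewrite pmulr_rle0 ?char_exponent_max0// divr_gt0.
have {}x0 : 0 < enorm x by rewrite lt0r x0 enorm_ge0.
have xV0 : 0 < (enorm x)^-1 by rewrite invr_gt0.
have cx0 := conc_gt0 xV0.
pose t := (conc (enorm x)^-1)^-1; have t0 : 0 < t by rewrite invr_gt0.
have gt : g t = (enorm x)^-1 by rewrite /t invrK concentrationK.
have Tt : T < t.
  have : g T < (enorm x)^-1 by rewrite -[X in X < _]invrK ltf_pV2 ?posrE ?invr_gt0// gt0.
  by rewrite ltK// /t => h; rewrite -[X in X < _]invrK ltf_pV2 ?posrE ?invr_gt0.
have r0 : 0 < enorm x / 3 by rewrite divr_gt0.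
have tpsi : 1 < 4 ^+ K * (t * psi x).
  rewrite ltNge; apply/negP => small.
  have xr : 2 * (enorm x / 3) < enorm x.
    by rewrite mulrA ltr_pdivrMr// mulrC ltr_pM2l// ltr_nat.
  have ball w : enorm w <= enorm x / 3 -> t * psi w <= 2.
    move=> wx; rewrite /t mulrC ler_pdivrMr//; apply: re_char_exponent_le => //.
    by apply: (le_trans wx); rewrite ler_pdivrMr// ler_peMr ?ler1n// ltW.
  have := le_trans (le_integral_expR_packing psdA LN d0 r0 xr t0 ball small) (H t Tt).
  rewrite lee_fin gt -exprVn invrK.
  have -> : 2 * (enorm x / 3) / d%:R = enorm x * (2 / 3 / d%:R) by ring.
  rewrite exprMn -/v leNgt => /negP; apply.
  have -> : K%:R * (expR (- (2 + 2 * 2)) * (enorm x ^+ d * (2 / 3 / d%:R) ^+ d)) =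
    K%:R * v * enorm x ^+ d by rewrite /v; ring.
  by rewrite ltr_pM2r// exprn_gt0.
have xle := char_exponent_max_le_conc b symA psdA LN x0.
apply: (@le_trans _ _ (conc (enorm x)^-1 / 4 ^+ K)).
  by rewrite mulrAC ler_pM2r ?invr_gt0//; lra.
rewrite ler_pdivrMr//; move: tpsi; rewrite /t mulrCA.
by rewrite [X in _ < X]mulrC ltr_pdivlMr// mul1r mulrC => /ltW.
Qed.

(** With x = l y, the hypotheses chain to dir_conc(x) <= K l^alpha3 dir_conc(y), at most half of
    dir_conc(y) for small l. The other half must come from the truncated part at x by
    [dir_conc_le_trunc]. *)
Lemma char_exponent_max_le_dir_trunc (T3 c3 alpha3 : R) :
  0 < T3 -> 0 < c3 -> 0 < alpha3 ->
  (forall x, enorm x < T3^-1 -> c3 * psimax (enorm x) <= psi x) ->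
  (forall l r, 0 < l <= 1 -> 0 < r < T3^-1 ->
     psimax (l * r) <= c3^-1 * l `^ alpha3 * psimax r) ->
  exists T4 c4, [/\ 0 < T4, 1 <= c4 &
    forall x, enorm x < T4^-1 -> psimax (enorm x) <= c4 * U x].
Proof.
move=> T30 c30 a30 Hpsi Hscale.
pose K := 2 * cd / c3 ^+ 2; have K0 : 0 < K by rewrite divr_gt0// ?exprn_gt0// mulr_gt0.
(* Chosen so that K l^alpha3 <= 1/2; the 1 added to K ensures l <= 1. *)
pose l := (2 * (1 + K)) `^ (- alpha3^-1).
have l0 : 0 < l by rewrite powR_gt0// mulr_gt0// addr_gt0.
have lalpha : l `^ alpha3 = (2 * (1 + K))^-1.
  by rewrite /l -powRrM mulNr mulVf ?gt_eqF// powR_inv1// ltW// mulr_gt0// addr_gt0.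
have l1 : l <= 1.
  rewrite /l powRN invf_le1 ?powR_gt0 ?mulr_gt0 ?addr_gt0//.
  rewrite -[leLHS](powRr0 (2 * (1 + K))); apply: ler_powR; first by lra.
  by rewrite invr_ge0 ltW.
pose c4 := 4 / c3 * l ^- 2.
have c40 : 0 < c4 by rewrite mulr_gt0 ?divr_gt0// invr_gt0 exprn_gt0.
(* T3/l guarantees |y| < 1/T3 for y = x/l; adding 1 gives the required lower bound 1. *)
exists (T3 / l), (1 + c4); split; [by rewrite divr_gt0|by rewrite lerDl ltW|].
move=> x; have [x0 _|x0] := eqVneq (enorm x) 0.
  rewrite x0; apply: le_trans (char_exponent_max0 A b LN) _ => //.
  by apply: mulr_ge0 => //; lra.
have {}x0 : 0 < enorm x by rewrite lt0r x0 enorm_ge0.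
pose y := l^-1 *: x; have xE : x = l *: y by rewrite scalerA divff ?scale1r// gt_eqF.
have xyE : enorm x = l * enorm y by rewrite {1}xE enormZ gtr0_norm.
have y0 : 0 < enorm y by move: x0; rewrite xyE pmulr_rgt0.
rewrite invf_div => xT.
have yT : enorm y < T3^-1 by rewrite -(ltr_pM2l l0) -xyE.
have lE : conc (l * enorm y)^-1 <= K * l `^ alpha3 * dir_conc A N y.
  apply: (le_trans (conc_cd (mulr_gt0 l0 y0))).
  have -> : K * l `^ alpha3 * dir_conc A N y =
      cd * (c3^-1 * l `^ alpha3 * (c3^-1 * (2 * dir_conc A N y))).
    by rewrite /K; field; rewrite gt_eqF.
  rewrite ler_pM2l//; apply: (le_trans (Hscale l _ _ _)); rewrite ?l0 ?y0//.
  rewrite ler_wpM2l ?mulr_ge0 ?invr_ge0 ?powR_ge0 ?(ltW c30)//.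
  rewrite ler_pdivlMl//; apply: (le_trans (Hpsi _ yT)).
  exact: re_char_exponent_le_dir.
have dx : dir_conc A N x <= 2^-1 * dir_conc A N y.
  apply: (@le_trans _ _ (conc (l * enorm y)^-1)).
    by apply: dir_conc_le => //; rewrite -xyE.
  apply: (le_trans lE); rewrite lalpha ler_wpM2r ?dir_conc_ge0//.
  by rewrite ler_pdivrMr ?mulr_gt0 ?addr_gt0// mulrA mulVf// mul1r lerDr.
have dy : dir_conc A N y <= 2 * l ^- 2 * U x.
  by have := dir_conc_le_trunc psdA LN y l0; rewrite -xE; lra.
have ymax : psimax (enorm x) <= psimax (enorm y).
  apply: char_exponent_max_le => [|w wx]; first exact: ltW.
  apply: le_char_exponent_max => //; apply: (le_trans wx).
  by rewrite xyE ler_piMl// ltW.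
apply: (le_trans ymax); apply: (@le_trans _ _ (c4 * U x)); last first.
  by rewrite ler_wpM2r// lerDr.
rewrite /c4 -mulrA [4 / c3]mulrC -!mulrA ler_pdivlMl//.
apply: (le_trans (Hpsi _ yT)); apply: (le_trans (re_char_exponent_le_dir _ psdA LN _)).
by move: dy; rewrite -!mulrA; lra.
Qed.

End scaling_conditions.

Section exponential_decay.
Context {R : realType}.

Lemma expRN_le (y : R) (m : nat) : 0 < y -> expR (- y) <= m.+1`!%:R / y ^+ m.+1.
Proof.
move=> y0; have ym : 0 < y ^+ m.+1 by rewrite exprn_gt0.
have fac : 0 < m.+1`!%:R :> R by rewrite ltr0n fact_gt0.
rewrite expRN -invf_div lef_pV2 ?posrE ?expR_gt0 ?divr_gt0//.
by have := expR_ge1Dxn m (ltW y0); lra.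
Qed.

Lemma expr_le_powR_expr (u alpha : R) (k m : nat) : 1 <= u -> k%:R <= m%:R * alpha ->
  u ^+ k <= (u `^ alpha) ^+ m.
Proof.
move=> u1 km; have u0 : 0 <= u by exact: le_trans u1.
rewrite -powR_mulrn// -powR_mulrn ?powR_ge0// -powRrM.
by apply: ler_powR => //; rewrite mulrC.
Qed.

End exponential_decay.

(** * Cauchy products as integrable majorants *)

Section cauchy_product.
Context {R : realType} {d : nat}.
Implicit Types (x : 'rV[R]_d) (e w : R).

Local Notation kernel e x := (\prod_(i < d) (e * cauchy e (x ord0 i))).

Let mcauchy e : 0 < e -> measurable_fun setT (fun u : R => e * cauchy e u).
Proof.
move=> e0; apply: measurable_funM => //.
by have := measurable_cauchy 0 e0; under eq_fun do rewrite subr0.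
Qed.

Let factor_ge0 e (u : R) : 0 < e -> 0 <= e * cauchy e u.
Proof. by move=> e0; rewrite mulr_ge0 ?cauchy_ge0 ?ltW. Qed.

Lemma cauchy_prod_ge0 e x : 0 < e -> 0 <= kernel e x.
Proof. by move=> e0; apply: prodr_ge0 => i _; exact: factor_ge0. Qed.

Lemma measurable_cauchy_prod e : 0 < e -> measurable_fun setT (fun x => kernel e x).
Proof.
move=> e0; apply: measurable_prod => i _.
exact: (measurableT_comp (mcauchy e0) (measurable_rV_coord i)).
Qed.

(** Decay of order (|x|/e)^(-2d) is thus dominated by the product kernel, whose integral is at most
    (pi e)^d. *)
Lemma cauchy_prod_ge e w x : 0 < e -> 1 <= w -> enorm x <= w * e ->
  (2 * w ^+ 2) ^- d <= kernel e x.
Proof.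
move=> e0 w1 xw; have w0 : 0 < w := lt_le_trans ltr01 w1.
have -> : (2 * w ^+ 2) ^- d = \prod_(i < d) (2 * w ^+ 2)^-1.
  by rewrite prodr_const card_ord exprVn.
apply: ler_prod => i _; rewrite invr_ge0 mulr_ge0 ?sqr_ge0//=.
have e20 : 0 < e ^+ 2 by rewrite exprn_gt0.
have := coord_le_enorm x i; set v := x ord0 i => vx.
have v2 : v ^+ 2 <= (w * e) ^+ 2.
  rewrite -real_normK ?num_real// lerXn2r ?nnegrE//; last exact: le_trans xw.
  by rewrite mulr_ge0// ltW.
have w21 : 1 <= w ^+ 2 by rewrite exprn_ege1.
have e2w : e ^+ 2 <= w ^+ 2 * e ^+ 2 by rewrite ler_peMl// ltW.
have den : 0 < e ^+ 2 + v ^+ 2 by rewrite ltr_wpDr// sqr_ge0.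
rewrite /cauchy mulrA ler_pdivlMr// ler_pdivrMl; last by rewrite mulr_gt0// exprn_gt0.
by move: v2; rewrite exprMn -expr2; lra.
Qed.

Lemma integral_cauchy_prod_le e : 0 < e ->
  (\int[lebesgue_rV d]_x (kernel e x)%:E <= ((pi * e) ^+ d)%:E)%E.
Proof.
move=> e0; rewrite (ge0_integral_rV_prod (f := fun _ u => e * cauchy e u)); last 2 first.
- by move=> i; exact: mcauchy.
- by move=> i u; exact: factor_ge0.
have int_ge0 : (0 <= \int[lebesgue_measure]_u (e * cauchy e u)%:E)%E.
  by apply: integral_ge0 => u _; rewrite lee_fin; exact: factor_ge0.
have int_le : (\int[lebesgue_measure]_u (e * cauchy e u)%:E <= (pi * e)%:E)%E.
  under eq_integral do rewrite EFinM.
  rewrite ge0_integralZl_EFin//; last 3 first.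
  - by move=> u _; rewrite lee_fin cauchy_ge0// ltW.
  - by apply/measurable_EFinP; have := measurable_cauchy 0 e0; under eq_fun do rewrite subr0.
  - exact: ltW.
  rewrite mulrC EFinM lee_wpmul2l ?lee_fin ?(ltW e0)//.
  apply: le_trans (integral_cauchy_le 0 e0).
  by under [leRHS]eq_integral do rewrite subr0.
have fin_int : (\int[lebesgue_measure]_u (e * cauchy e u)%:E)%E \is a fin_num.
  by rewrite ge0_fin_numE//; apply: le_lt_trans int_le _; rewrite ltry.
move: int_ge0 int_le; rewrite -(fineK fin_int) !lee_fin => int_ge0 int_le.
rewrite prodEFin prodr_const card_ord lee_fin lerXn2r ?nnegrE//.
exact: le_trans int_le.
Qed.

End cauchy_product.

(** * The integral bound from the truncated moment condition *)

Section integral_bound.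
Context {R : realType} {d : nat} (A : 'M[R]_d)
  (N : {measure set 'rV[R]_d -> \bar R}) (b : 'rV[R]_d).
Hypotheses (d0 : (0 < d)%N) (symA : A^T = A) (psdA : nonneg_definite A)
  (LN : levy_measure N).
Hypothesis hinfty : concentration A N r @[r --> 0^'+] --> +oo.
Implicit Types (x y z w : 'rV[R]_d) (t s r l : R).

Local Notation psi := (re_char_exponent A N b).
Local Notation psimax := (char_exponent_max A N b).
Local Notation conc := (concentration A N).
Local Notation g t := (concentration_inv A N t^-1).
Local Notation mu := (lebesgue_rV (R:=R) d).
Local Notation U := (dir_trunc A N).

Let cd : R := d%:R ^+ 3 + 24 * d%:R.

Let cd1 : 1 <= cd.
Proof.
have d1 : 1 <= d%:R :> R by rewrite ler1n.
by rewrite /cd; have : 0 <= d%:R ^+ 3 :> R by []; lra.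
Qed.

Let cd0 : 0 < cd. Proof. exact: lt_le_trans cd1. Qed.

Let psi_ge0 x : 0 <= psi x.
Proof. exact: re_char_exponent_ge0. Qed.

Let conc_gt0 r : 0 < r -> 0 < conc r.
Proof. exact: concentration_gt0. Qed.

(** Contraction is iterated on [dir_conc], where one step loses no constant. Only then is it
    transferred to h, so the comparison constant 2 cd is paid once and absorbed by q^(n+1). *)
Lemma dir_trunc_scaling (k r0 : R) : 0 < r0 -> 0 < k ->
  (forall x, 0 < enorm x < r0 -> k * conc (enorm x)^-1 <= U x) ->
  exists2 alpha, 0 < alpha <= 2 &
    forall l r, 0 < l <= 1 -> 0 < r < r0 -> conc (l * r)^-1 <= 2 * l `^ alpha * conc r^-1.
Proof.
(* Halving y removes (1 - 1/4) [dir_trunc], whence 3/4; the maximum with 0 keeps the powers of q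
   monotone. *)
move=> r00 k0 HU; pose q := Num.max 0 (1 - 3 / 4 * k).
have q0 : 0 <= q by rewrite le_max lexx.
have kq : 1 - 3 / 4 * k <= q by rewrite le_max lexx orbT.
have q1 : q < 1 by rewrite gt_max ltr01/=; lra.
have dc0 y : 0 <= dir_conc A N y by exact: dir_conc_ge0.
have Hdir y : enorm y < r0 -> dir_conc A N (2^-1 *: y) <= q * dir_conc A N y.
  move=> yr; have [y0|y0] := eqVneq (enorm y) 0.
    by rewrite (enorm_eq0 y0) scaler0 dir_conc0 mulr0.
  have {}y0 : 0 < enorm y by rewrite lt0r y0 enorm_ge0.
  have Uy : k * dir_conc A N y <= U y.
    apply: le_trans (HU y _); last by rewrite y0.
    by rewrite ler_pM2l//; exact: dir_conc_le.
  have half01 : 0 <= (2^-1 : R) <= 1 by apply/andP; split; lra.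
  have := dir_concZ_add_trunc_le A LN y half01.
  by have := ler_wpM2r (dc0 y) kq; lra.
have dirk y n : enorm y < r0 -> dir_conc A N (2^-1 ^+ n *: y) <= q ^+ n * dir_conc A N y.
  move=> yr; elim: n => [|n IH]; first by rewrite !expr0 scale1r mul1r.
  rewrite exprS -scalerA; have yn : enorm (2^-1 ^+ n *: y) < r0.
    apply: le_lt_trans yr; rewrite enormZ ger0_norm ?exprn_ge0//.
    by rewrite ler_piMl ?enorm_ge0// exprn_ile1//; lra.
  by apply: (le_trans (Hdir _ yn)); rewrite exprS -mulrA ler_wpM2l.
have [n qn] : exists n, 2 * cd * q ^+ n.+1 <= 2^-1.
  have e0 : 0 < 2^-1 / (2 * cd) by rewrite divr_gt0// mulr_gt0.
  have /cvgrPdist_lt/(_ _ e0)[n _ /(_ n (leqnn n))/=] : q ^+ n @[n --> \oo] --> (0 : R).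
    by apply: cvg_expr; rewrite ger0_norm.
  rewrite sub0r normrN ger0_norm ?exprn_ge0// ltr_pdivlMr ?mulr_gt0// => qn; exists n.
  apply: le_trans (ltW qn); rewrite mulrC ler_pM2r ?mulr_gt0// exprS.
  by rewrite ler_piMl ?exprn_ge0// ltW.
apply: (@power_scaling R (fun r => conc r^-1) r0 (2^-1 ^+ n.+1)).
- move=> r s rp rs _; apply: concentration_le => //; rewrite ?invr_gt0 ?(lt_le_trans rp rs)//.
  by rewrite lef_pV2 ?posrE// (lt_le_trans rp rs).
- by move=> r /andP[rp _]; rewrite ltW// conc_gt0// invr_gt0.
- by rewrite exprn_gt0//= exprn_ilt1//; lra.
move=> r /andP[rp rr0]; set l := 2^-1 ^+ n.+1; have l0 : 0 < l by rewrite exprn_gt0.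
apply: (le_trans (conc_le_char_exponent_max b symA psdA LN (mulr_gt0 l0 rp))).
apply: (@le_trans _ _ (cd * (2 * (q ^+ n.+1 * conc r^-1)))); last first.
  by rewrite !mulrA [cd * 2]mulrC ler_wpM2r// ltW// conc_gt0// invr_gt0.
rewrite ler_pM2l//; apply: char_exponent_max_le => [|y yl]; first by rewrite ltW// mulr_gt0.
apply: (le_trans (re_char_exponent_le_dir b psdA LN y)); rewrite ler_pM2l//.
have -> : y = l *: (l^-1 *: y) by rewrite scalerA divff ?scale1r// gt_eqF.
have yr : enorm (l^-1 *: y) <= r by rewrite enormZ gtr0_norm ?invr_gt0// ler_pdivrMl.
apply: (le_trans (dirk _ n.+1 (le_lt_trans yr rr0))).
by rewrite ler_wpM2l ?exprn_ge0//; exact: dir_conc_le.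
Qed.

(** Here the time t0 and the cube size are fixed by the data, so one K, with total contribution
    exceeding the finite integral, serves all |x| >= s1. *)
Lemma re_char_exponent_away (t0 s1 : R) : 0 < t0 -> 0 < s1 ->
  (\int[mu]_z (expR (- (t0 * psi z)))%:E < +oo)%E ->
  exists2 delta, 0 < delta & forall x, s1 <= enorm x -> delta <= psi x.
Proof.
move=> t00 s10 foo; have r0 : 0 < s1 / 3 by rewrite divr_gt0.
have fin0 : (0 <= \int[mu]_z (expR (- (t0 * psi z)))%:E)%E.
  by apply: integral_ge0 => z _; rewrite lee_fin expR_ge0.
set I := (\int[mu]_z _)%E in foo fin0 *.
have If : I \is a fin_num by rewrite ge0_fin_numE.
pose M := t0 * (2 * conc (s1 / 3)^-1).
pose v : R := expR (- (2 + 2 * M)) * (2 * (s1 / 3) / d%:R) ^+ d.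
have v0 : 0 < v by rewrite mulr_gt0 ?expR_gt0// exprn_gt0// !divr_gt0 ?mulr_gt0 ?ltr0n.
pose K := (Num.truncn (fine I / v)).+1.
have IK : fine I < K%:R * v by rewrite -ltr_pdivrMr//; exact: truncnS_gt.
have K0 : 0 < 4 ^+ K :> R by rewrite exprn_gt0.
exists (4 ^+ K * t0)^-1 => [|x sx]; first by rewrite invr_gt0 mulr_gt0.
suff : 1 < 4 ^+ K * (t0 * psi x).
  move=> h; rewrite -[leLHS]mulr1 ler_pdivrMl ?mulr_gt0// -mulrA.
  exact: ltW.
rewrite ltNge; apply/negP => small.
have xr : 2 * (s1 / 3) < enorm x.
  by apply: lt_le_trans sx; rewrite mulrA ltr_pdivrMr// mulrC ltr_pM2l// ltr_nat.
have ball w : enorm w <= s1 / 3 -> t0 * psi w <= M.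
  by move=> ws; rewrite ler_pM2l//; exact: re_char_exponent_le.
have := le_integral_expR_packing psdA LN d0 r0 xr t00 ball small.
by rewrite -/v -/I -(fineK If) lee_fin leNgt IK.
Qed.

(** With e = 1/g(t), the integrand is dominated inside |x| <= s1 by a Cauchy product of width e, and
    outside by e^d exp(- t0 psi), each up to a constant. Both integrals are of order e^d. *)
Lemma le_integral_expR_concentration (k r0 t0 : R) : 0 < r0 -> 0 < k -> 0 < t0 ->
  (forall x, 0 < enorm x < r0 -> k * conc (enorm x)^-1 <= U x) ->
  (\int[mu]_z (expR (- (t0 * psi z)))%:E < +oo)%E ->
  exists T c, [/\ 0 < T, 0 < c & forall t, T < t ->
    (\int[mu]_z (expR (- (t * psi z)))%:E <= (c * g t ^- d)%:E)%E].
Proof.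
move=> r00 k0 t00 HU foo.
have [alpha /andP[alpha0 _] Hconc] := dir_trunc_scaling r00 k0 HU.
pose s1 := r0 / 2; have s10 : 0 < s1 by rewrite divr_gt0.
have s1r0 : s1 < r0 by rewrite ltr_pdivrMr// ltr_pMr// ltr1n.
have [delta delta0 Hdelta] := re_char_exponent_away t00 s10 foo.
(* Since (m+1) alpha >= 2d, the term of degree m+1 of the exponential series turns exp(- a w^alpha)
   into a bound of order w^(-2d). *)
pose m := Num.truncn ((2 * d)%:R / alpha).
have malpha : (2 * d)%:R <= m.+1%:R * alpha by rewrite -ler_pdivrMr// ltW// truncnS_gt.
pose B := 2 * conc s1^-1; have sV0 : 0 < s1^-1 by rewrite invr_gt0.
have B0 : 0 < B by rewrite mulr_gt0// conc_gt0.
(* 8 from bounding [dir_trunc] by 8 psi, 2 from the prefactor of the scaling of h. *)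
pose a := k / 16; have a0 : 0 < a by rewrite divr_gt0.
pose fac : R := m.+1`!%:R; have fac0 : 0 < fac by rewrite ltr0n fact_gt0.
pose C1 := 1 + fac / a ^+ m.+1.
have fa0 : 0 < fac / a ^+ m.+1 by rewrite divr_gt0// exprn_gt0.
pose I := fine (\int[mu]_z (expR (- (t0 * psi z)))%:E).
have I0 : 0 <= I by apply: fine_ge0; apply: integral_ge0 => z _; rewrite lee_fin expR_ge0.
have IE : (\int[mu]_z (expR (- (t0 * psi z)))%:E)%E = I%:E.
  rewrite fineK// ge0_fin_numE//.
  by apply: integral_ge0 => z _; rewrite lee_fin expR_ge0.
(* Product of the losses in the outer region: exp(t0 delta) for keeping exp(- t0 psi) aside, the
   series bound of exp(- t delta), and t^-(m+1) rewritten as a multiple of (e/s1)^d. *)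
pose C2 := expR (t0 * delta) * ((B / delta) ^+ m.+1 * fac) / s1 ^+ d.
have C20 : 0 < C2.
  by rewrite divr_gt0 ?exprn_gt0// mulr_gt0 ?expR_gt0// mulr_gt0// exprn_gt0// divr_gt0.
(* Beyond this time t > t0 and h(g(t)) = 1/t < h(1/s1), so e < s1. *)
exists (t0 + (conc s1^-1)^-1), (C1 * 2 ^+ d * pi ^+ d + C2 * I + 1); split.
- by rewrite addr_gt0// invr_gt0 conc_gt0.
- rewrite ltr_wpDl// addr_ge0//; last by rewrite mulr_ge0// ltW.
  by rewrite !mulr_ge0 ?exprn_ge0 ?pi_ge0//; rewrite /C1; lra.
move=> t Tt; have conc1 : 0 < (conc s1^-1)^-1 by rewrite invr_gt0 conc_gt0.
have tt0 : t0 < t by lra.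
have t_gt0 : 0 < t by exact: lt_trans tt0.
have tV0 : 0 < t^-1 by rewrite invr_gt0.
have g0 : 0 < g t by apply: concentration_inv_gt0.
have gE : conc (g t) = t^-1 by apply: concentration_invK.
pose e := (g t)^-1; have e0 : 0 < e by rewrite invr_gt0.
have eE : conc e^-1 = t^-1 by rewrite invrK.
have es1 : e < s1.
  rewrite -[s1]invrK ltf_pV2 ?posrE// ltNge; apply/negP => gs.
  have := concentration_le symA psdA LN g0 gs; rewrite gE leNgt => /negP; apply.
  by rewrite -[ltRHS]invrK ltf_pV2 ?posrE//; lra.
(* Scaling from [r] down to [e], where [conc e^-1 = 1/t]. *)
have Hscale r : e <= r -> r < r0 -> (r / e) `^ alpha <= t * (2 * conc r^-1).
  move=> er rr0; have rp : 0 < r := lt_le_trans e0 er.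
  have l01 : 0 < e / r <= 1 by rewrite divr_gt0//= ler_pdivrMr// mul1r.
  have := Hconc (e / r) r l01; rewrite rp rr0 => /(_ isT).
  have w0 : 0 < (r / e) `^ alpha by rewrite powR_gt0// divr_gt0.
  have -> : (e / r) `^ alpha = ((r / e) `^ alpha)^-1.
    apply: (@mulIf _ ((r / e) `^ alpha)); first by rewrite gt_eqF.
    rewrite mulVf ?gt_eqF//.
    rewrite -powRM; [|by apply: divr_ge0; exact: ltW|by apply: divr_ge0; exact: ltW].
    by rewrite mulrA divfK ?gt_eqF// divff ?gt_eqF// powR1.
  rewrite divfK ?gt_eqF// eE => h.
  have := ler_wpM2l (ltW (mulr_gt0 t_gt0 w0)) h.
  have -> : t * (r / e) `^ alpha * t^-1 = (r / e) `^ alpha by field; rewrite gt_eqF.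
  suff -> : t * (r / e) `^ alpha * (2 * ((r / e) `^ alpha)^-1 * conc r^-1) =
    t * (2 * conc r^-1) by [].
  by field; rewrite gt_eqF.
have inner x : enorm x <= s1 ->
    expR (- (t * psi x)) <= C1 * 2 ^+ d * \prod_(i < d) (e * cauchy e (x ord0 i)).
  move=> xs1; have C1_ge1 : 1 <= C1 by rewrite /C1; lra.
  have C10 : 0 <= C1 by apply: le_trans C1_ge1.
  have kernel (w : R) : 1 <= w -> enorm x <= w * e ->
      C1 * w ^- (2 * d) <= C1 * 2 ^+ d * \prod_(i < d) (e * cauchy e (x ord0 i)).
    move=> w1 xw; have w0 : 0 < w by apply: lt_le_trans w1.
    rewrite -mulrA ler_wpM2l// -ler_pdivrMl ?exprn_gt0//.
    apply: le_trans (cauchy_prod_ge e0 w1 xw).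
    by rewrite exprMn -exprM invfM.
  have [xe|ex] := leP (enorm x) e.
    apply: le_trans (kernel 1 _ _) => //; last by rewrite mul1r.
    rewrite expr1n invr1 mulr1; apply: le_trans C1_ge1.
    by rewrite -expR0 ler_expR oppr_le0 mulr_ge0// ltW.
  have x0 : 0 < enorm x by exact: lt_trans ex.
  have xr0 : enorm x < r0 by exact: le_lt_trans s1r0.
  pose w := enorm x / e; have w1 : 1 <= w by rewrite ler_pdivlMr// mul1r ltW.
  apply: le_trans (kernel w _ _) => //; last by rewrite divfK// gt_eqF.
  have w0 : 0 < w by exact: lt_le_trans w1.
  have wa0 : 0 < w `^ alpha by rewrite powR_gt0.
  have tpsi : a * w `^ alpha <= t * psi x.
    have h1 := Hscale _ (ltW ex) xr0.
    have h2 := HU x; rewrite x0 xr0 in h2; have {}h2 := h2 isT.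
    have h3 := dir_trunc_le_re_char_exponent b psdA LN x.
    have h4 : k * conc (enorm x)^-1 <= 8 * psi x by lra.
    rewrite /a -/w in h1 *; have := ler_wpM2l (ltW t_gt0) h4.
    by have := ler_wpM2l (ltW k0) h1; lra.
  apply: (@le_trans _ _ (expR (- (a * w `^ alpha)))); first by rewrite ler_expR lerN2.
  apply: (le_trans (expRN_le m _)); first by rewrite mulr_gt0.
  rewrite -/fac exprMn invfM mulrA; apply: ler_pM.
  - exact: ltW.
  - by rewrite invr_ge0 exprn_ge0 ?ltW.
  - by rewrite /C1; lra.
  rewrite lef_pV2 ?posrE ?exprn_gt0//; exact: expr_le_powR_expr.
have outer x : s1 <= enorm x ->
    expR (- (t * psi x)) <= C2 * e ^+ d * expR (- (t0 * psi x)).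
  move=> sx; have dx := Hdelta x sx.
  apply: (@le_trans _ _ (expR (- ((t - t0) * delta)) * expR (- (t0 * psi x)))).
    rewrite -expRD ler_expR; have := ler_wpM2l (ltW (_ : 0 < t - t0)) dx.
    by rewrite subr_gt0 => /(_ tt0); lra.
  rewrite ler_pM2r ?expR_gt0//.
  have -> : - ((t - t0) * delta) = t0 * delta + - (t * delta) by ring.
  have C2E : C2 * e ^+ d = expR (t0 * delta) *
      ((B / delta) ^+ m.+1 * (fac * (s1 ^- d * e ^+ d))) by rewrite /C2; ring.
  rewrite expRD C2E ler_pM2l ?expR_gt0//.
  have td0 : 0 < t * delta by rewrite mulr_gt0.
  apply: (le_trans (expRN_le m td0)); rewrite -/fac.
  have se1 : 1 <= s1 / e by rewrite ler_pdivlMr// mul1r ltW.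
  have se0 : 0 < s1 / e by exact: lt_le_trans se1.
  (* The scaling between s1 and e makes t at least of order (s1/e)^alpha, so decay in t becomes
     decay in e. *)
  have hB : (s1 / e) ^+ d <= (t * B) ^+ m.+1.
    apply: (@le_trans _ _ ((s1 / e) ^+ (2 * d))).
      by apply: ler_weXn2l => //; rewrite mul2n -addnn leq_addr.
    apply: (le_trans (expr_le_powR_expr se1 malpha)).
    rewrite lerXn2r ?nnegrE ?powR_ge0//; first by rewrite mulr_ge0 ?ltW.
    exact: Hscale (ltW es1) s1r0.
  have -> : (B / delta) ^+ m.+1 * (fac * (s1 ^- d * e ^+ d)) =
      fac / (t * delta) ^+ m.+1 * ((t * B) ^+ m.+1 / (s1 / e) ^+ d).
    rewrite !expr_div_n [in RHS]exprMn [(t * B) ^+ _]exprMn; field.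
    by rewrite !expf_neq0// gt_eqF.
  rewrite ler_peMr//; first by rewrite divr_ge0 ?exprn_ge0 ?ltW.
  by rewrite ler_pdivlMr ?exprn_gt0// mul1r.
have kernel_ge0 x : 0 <= C1 * 2 ^+ d * \prod_(i < d) (e * cauchy e (x ord0 i)).
  by rewrite mulr_ge0 ?cauchy_prod_ge0// mulr_ge0 ?exprn_ge0//; rewrite /C1; lra.
have C12 : 0 <= C1 * 2 ^+ d by rewrite mulr_ge0 ?exprn_ge0//; rewrite /C1; lra.
have C2e : 0 <= C2 * e ^+ d by rewrite mulr_ge0 ?exprn_ge0 ?ltW.
have mkernel := measurable_cauchy_prod (d := d) e0.
have mexp := measurable_expR_psi A b LN t0.
apply: (@le_trans _ _ (\int[mu]_x ((C1 * 2 ^+ d)%:E *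
    (\prod_(i < d) (e * cauchy e (x ord0 i)))%:E +
    (C2 * e ^+ d)%:E * (expR (- (t0 * psi x)))%:E))%E).
  apply: ge0_le_integral => //.
  - exact: measurable_expR_psi.
  - apply: emeasurable_funD; apply: emeasurable_funM => //; exact/measurable_EFinP.
  move=> x _; rewrite -!EFinM -EFinD lee_fin.
  have [xs|sx] := leP (enorm x) s1.
    by apply: (le_trans (inner x xs)); rewrite lerDl mulr_ge0 ?expR_ge0.
  by apply: (le_trans (outer x (ltW sx))); rewrite lerDr.
rewrite ge0_integralD//; last 4 first.
- by move=> x _; rewrite -EFinM lee_fin.
- by apply: emeasurable_funM => //; exact/measurable_EFinP.
- by move=> x _; rewrite -EFinM lee_fin mulr_ge0 ?expR_ge0.
- exact: emeasurable_funM.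
rewrite ge0_integralZl_EFin//; last 2 first.
- by move=> x _; rewrite lee_fin cauchy_prod_ge0.
- exact/measurable_EFinP.
rewrite ge0_integralZl_EFin// IE.
apply: (@le_trans _ _ ((C1 * 2 ^+ d)%:E * ((pi * e) ^+ d)%:E + (C2 * e ^+ d * I)%:E)%E).
  by apply: leeD => //; rewrite lee_wpmul2l ?lee_fin//; exact: integral_cauchy_prod_le.
rewrite -EFinM -EFinD lee_fin exprMn -exprVn -/e mulrDl mul1r.
by have := exprn_ge0 d (ltW e0); rewrite !mulrDl -!mulrA; lra.
Qed.

End integral_bound.

(** * The law of Y_t *)

Section law.
Context {R : realType} {d : nat} {disp : measure_display}
  {Omega : measurableType disp} (P : probability Omega R)
  (Y : R -> Omega -> 'rV[R]_d) (A : 'M[R]_d)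
  (N : {measure set 'rV[R]_d -> \bar R}) (b : 'rV[R]_d).
Hypothesis (hY : levy_process_with_triplet P Y A N b).
Implicit Types (x z : 'rV[R]_d) (t : R).

Local Notation psi := (re_char_exponent A N b).
Local Notation phi t := (exp_char_exponent A N b t).
Local Notation mu := (lebesgue_rV (R:=R) d).

Let mY t : 0 <= t -> measurable_fun setT (Y t).
Proof. by case: hY => -[mY _ _ _ _ _] _ _ _ /mY. Qed.

Let psdA : nonneg_definite A. Proof. by case: hY => _ []. Qed.

Let LN : levy_measure N. Proof. by case: hY. Qed.

Lemma exp_char_exponent_char t z : 0 <= t ->
  phi t z = (char_re P (Y t) z +i* char_im P (Y t) z)%C.
Proof.
case: hY => _ _ _ h t0; rewrite -h// /cintegral /char_re /char_im.
by congr (_ +i* _)%C; apply: eq_Rintegral => w _ /=;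
  rewrite !mul0r !mul1r subr0 add0r expR0 mul1r.
Qed.

Lemma char_polar t z : 0 <= t -> exists a : R,
  char_re P (Y t) z = expR (- (t * psi z)) * cos a /\
  char_im P (Y t) z = expR (- (t * psi z)) * sin a.
Proof.
move=> t0; have := exp_char_exponent_char z t0.
rewrite /exp_char_exponent /re_char_exponent; case: (char_exponent A N b z) => u v.
by rewrite /cexp /= mul0r subr0 => -[<- <-]; exists (- (t * v + 0 * u)).
Qed.

Lemma char_sqr t z : 0 <= t ->
  char_re P (Y t) z ^+ 2 + char_im P (Y t) z ^+ 2 = expR (- (2 * t * psi z)).
Proof.
move=> t0; have [a [-> ->]] := char_polar z t0.
rewrite !exprMn -mulrDr cos2Dsin2 mulr1 -expRM_natl.
by congr expR; ring.
Qed.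

Lemma norm_char_rotated_le t z (u : R) : 0 <= t ->
  `|cos u * char_re P (Y t) z + sin u * char_im P (Y t) z| <= expR (- (t * psi z)).
Proof.
move=> t0; have [a [-> ->]] := char_polar z t0.
have -> (e : R) : cos u * (e * cos a) + sin u * (e * sin a) = e * cos (u - a).
  by rewrite cosB; ring.
by rewrite normrM ger0_norm ?expR_ge0// ler_piMr ?expR_ge0// norm_cos_le1.
Qed.

(** The modulus of the characteristic function is exp(- t psi). The three implications pass between
    its integral and the integrability of real and imaginary parts. *)
Lemma exp_char_exponent_integrableP t : 0 <= t ->
  [/\ cintegrable mu (phi t) -> (\int[mu]_z (expR (- (t * psi z)))%:E < +oo)%E,
    (\int[mu]_z (expR (- (t * psi z)))%:E < +oo)%E ->
      mu.-integrable setT (EFin \o char_re P (Y t)) /\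
      mu.-integrable setT (EFin \o char_im P (Y t)) &
    mu.-integrable setT (EFin \o char_re P (Y t)) ->
      mu.-integrable setT (EFin \o char_im P (Y t)) -> cintegrable mu (phi t)].
Proof.
move=> t0; have mC := measurable_char_re P (mY t0); have mS := measurable_char_im P (mY t0).
have phiRe : complex.Re (R:=R) \o phi t = char_re P (Y t).
  by apply/funext => z; rewrite /comp exp_char_exponent_char.
have phiIm : complex.Im (R:=R) \o phi t = char_im P (Y t).
  by apply/funext => z; rewrite /comp exp_char_exponent_char.
rewrite /cintegrable phiRe phiIm.
have mexp := measurable_expR_psi A b LN t.
split => // [[iC iS]|foo].
  have iCS := integrableD measurableT (integrable_abse iC) (integrable_abse iS).
  have : mu.-integrable setT (fun z => (expR (- (t * psi z)))%:E).
    apply: (le_integrable _ _ _ iCS) => // z _ /=.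
    rewrite ger0_norm ?expR_ge0// lee_fin ger0_norm ?addr_ge0//.
    have := char_sqr z t0; have [a [-> ->]] := char_polar z t0.
    move=> _; rewrite !normrM ger0_norm ?expR_ge0// -mulrDr ler_peMr ?expR_ge0//.
    (* |cos a| + |sin a| >= 1, seen by squaring. *)
    rewrite -(@ler_pXn2r _ 2)// ?nnegrE ?addr_ge0// expr1n -(cos2Dsin2 a) sqrrD.
    rewrite !real_normK ?num_real// addrAC lerDl.
    by rewrite mulrn_wge0// mulr_ge0.
  case/integrableP => _; under eq_integral do rewrite gee0_abs ?lee_fin ?expR_ge0//.
  by [].
have iexp : mu.-integrable setT (fun z => (expR (- (t * psi z)))%:E).
  apply/integrableP; split => //.
  by under eq_integral do rewrite gee0_abs ?lee_fin ?expR_ge0//.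
split; apply: (le_integrable _ _ _ iexp) => //; try exact/measurable_EFinP.
  move=> z _; rewrite /= lee_fin [leRHS]ger0_norm ?expR_ge0//.
  by have := norm_char_rotated_le z 0 t0; rewrite cos0 sin0 mul1r mul0r addr0.
move=> z _; rewrite /= lee_fin [leRHS]ger0_norm ?expR_ge0//.
by have := norm_char_rotated_le z (pi / 2) t0; rewrite cos_pihalf sin_pihalf mul1r mul0r add0r.
Qed.

Lemma is_density_inversion t : 0 <= t ->
  (\int[mu]_z (expR (- (t * psi z)))%:E < +oo)%E ->
  is_density P (Y t) (phi t) (inversion_density P (Y t)).
Proof.
move=> t0 foo; have [_ /(_ foo)[iC iS] _] := exp_char_exponent_integrableP t0.
have mX := mY t0; split => //.
- exact: measurable_inversion_density.
- by move=> x; exact: inversion_density_ge0.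
- by move=> B; exact: inversion_densityP.
move=> _ x; have rot z : cexp (- ('i%C * (dotrV x z)%:C)%C) * phi t z =
    ((cos (dotrV z x) * char_re P (Y t) z + sin (dotrV z x) * char_im P (Y t) z) +i*
    (cos (dotrV z x) * char_im P (Y t) z - sin (dotrV z x) * char_re P (Y t) z))%C.
  rewrite exp_char_exponent_char// dotrVC /cexp; apply/eqP; rewrite eq_complex /=.
  rewrite !mul0r !mul1r subr0 add0r oppr0 expR0 !mul1r cosN sinN !mulNr opprK eqxx/=.
  by rewrite eqxx.
rewrite /cintegral; under eq_Rintegral do rewrite rot/=.
under [X in (_ +i* X)%C]eq_Rintegral do rewrite rot/=.
rewrite inversion_imaginary//; apply/eqP; rewrite eq_complex /=.
by rewrite !mulr0 !mul0r subr0 addr0 !eqxx.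
Qed.

Lemma inversion_density_le t x (M : R) : 0 <= t ->
  (\int[mu]_z (expR (- (t * psi z)))%:E <= M%:E)%E ->
  inversion_density P (Y t) x <= (2 * pi) ^- d * M.
Proof.
move=> t0 IM; have foo := le_lt_trans IM (ltry M).
have [_ /(_ foo)[iC iS] _] := exp_char_exponent_integrableP t0.
have pid0 : 0 < (2 * pi) ^- d :> R by rewrite invr_gt0 exprn_gt0// mulr_gt0// pi_gt0.
have iexp : mu.-integrable setT (EFin \o (fun z => expR (- (t * psi z)))).
  apply/integrableP; split; first exact: measurable_expR_psi.
  by under eq_integral do rewrite gee0_abs ?lee_fin ?expR_ge0//.
have mdot : measurable_fun setT (fun z => dotrV z x).
  by under eq_fun do rewrite dotrVC; exact: measurable_dotrV.
rewrite /inversion_density ler_pM2l//.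
apply: (@le_trans _ _ (\int[mu]_z expR (- (t * psi z)))).
  apply: le_Rintegral => //; last first.
    by move=> z _; apply: le_trans (norm_char_rotated_le z (dotrV z x) t0); exact: ler_norm.
  apply: (le_integrable _ _ _ iexp) => //.
    apply/measurable_EFinP; apply: measurable_funD; apply: measurable_funM.
    - exact: (measurableT_comp (continuous_measurable_fun (@continuous_cos R)) mdot).
    - exact: measurable_char_re (mY t0).
    - exact: (measurableT_comp (continuous_measurable_fun (@continuous_sin R)) mdot).
    - exact: measurable_char_im (mY t0).
  move=> z _; rewrite /= lee_fin [leRHS]ger0_norm ?expR_ge0//.
  exact: norm_char_rotated_le.
by rewrite -lee_fin /Rintegral fineK//; exact: integrable_fin_num.
Qed.

(** A bounded density makes the law at most M times Lebesgue measure. Squaring the modulus doubles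
    the time. *)
Lemma integral_expR_le_density t (p : 'rV[R]_d -> R) (M : R) : 0 <= t -> 0 <= M ->
  is_density P (Y t) (phi t) p ->
  (ereal_sup [set (p x)%:E | x in setT] <= M%:E)%E ->
  (\int[mu]_z (expR (- (2 * t * psi z)))%:E <= (M * (2 * pi) ^+ d)%:E)%E.
Proof.
move=> t0 M0 [mp p0 pP _] supM.
under eq_integral do rewrite -char_sqr//.
apply: plancherel_le => //; first exact: mY.
move=> B mB; rewrite pP// -integral_cst//; apply: ge0_le_integral => //.
- by move=> x _; rewrite lee_fin.
- exact/measurable_EFinP/measurable_funTS.
- move=> x _; apply: le_trans supM.
  by apply: ereal_sup_ubound; exists x.
Qed.

End law.

Theorem theorem3p10 (R : realType) (d : nat) (hd : (0 < d)%N)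
    (disp : measure_display) (Omega : measurableType disp)
    (P : probability Omega R) (Y : R -> Omega -> 'rV[R]_d)
    (A : 'M[R]_d) (N : {measure set 'rV[R]_d -> \bar R}) (b : 'rV[R]_d)
    (hY : levy_process_with_triplet P Y A N b)
    (hinfty : concentration A N r @[r --> 0^'+] --> +oo) :
  [<->
    (exists T1 c1 : R, [/\ 0 < T1, 0 < c1 &
      exists p : R -> 'rV[R]_d -> R,
        (forall t, T1 < t ->
           is_density P (Y t) (exp_char_exponent A N b t) (p t)) /\
        (forall t, T1 < t ->
           (ereal_sup [set (p t x)%:E | x in setT] <=
            (c1 * concentration_inv A N t^-1 ^- d)%:E)%E)]);

    (exists T2 c2 : R, [/\ 0 < T2, 0 < c2 &
      forall t, T2 < t ->
        (\int[lebesgue_rV d]_z (expR (- (t * re_char_exponent A N b z)))%:E <=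
         (c2 * concentration_inv A N t^-1 ^- d)%:E)%E]);

    (exists T3 c3 alpha3 : R,
      [/\ 0 < T3, 0 < c3 <= 1 & 0 < alpha3 <= 2] /\
      [/\ forall x : 'rV[R]_d, enorm x < T3^-1 ->
            c3 * char_exponent_max A N b (enorm x) <= re_char_exponent A N b x,
          forall lambda r : R, 0 < lambda <= 1 -> 0 < r < T3^-1 ->
            char_exponent_max A N b (lambda * r) <=
            c3^-1 * lambda `^ alpha3 * char_exponent_max A N b r &
          exists2 t0 : R, 0 < t0 &
            cintegrable (lebesgue_rV d) (exp_char_exponent A N b t0)]);

    (exists T4 c4 : R, [/\ 0 < T4, 1 <= c4,
      forall x : 'rV[R]_d, enorm x < T4^-1 ->
        char_exponent_max A N b (enorm x) <=
        c4 * (dotrV x (mxact A x) +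
              \int[N]_(z in [set z | `|dotrV x z| < 1]) (`|dotrV x z| ^+ 2)) &
      exists2 t0 : R, 0 < t0 &
        cintegrable (lebesgue_rV d) (exp_char_exponent A N b t0)])
  ].
Proof.
have [_ [symA psdA] LN _] := hY.
pose cd : R := d%:R ^+ 3 + 24 * d%:R.
have cd0 : 0 < cd by rewrite ltr_wpDl// mulr_gt0// ltr0n.
have pi2 : 0 < (2 * pi) ^+ d :> R by rewrite exprn_gt0// mulr_gt0// pi_gt0.
have g0 t : 0 < t -> 0 < concentration_inv A N t^-1.
  by move=> t0; apply: concentration_inv_gt0; rewrite ?invr_gt0.
tfae.
- move=> [T1 [c1 [T10 c10 [p [pd psup]]]]].
  have H t : T1 < t -> (\int[lebesgue_rV d]_z (expR (- (2 * t * re_char_exponent A N b z)))%:E <=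
      (c1 * (2 * pi) ^+ d * concentration_inv A N t^-1 ^- d)%:E)%E.
    move=> T1t; have t0 : 0 < t := lt_trans T10 T1t.
    rewrite mulrAC; apply: integral_expR_le_density (pd t T1t) (psup t T1t) => //.
      exact: ltW.
    by rewrite mulr_ge0 ?(ltW c10)// invr_ge0 exprn_ge0// ltW// g0.
  (* Plancherel at time t/2 bounds the integral at time t, but in terms of g(t/2); doubling
     exchanges it for g(t) at the price C^d. *)
  have [C C1 gC] := concentration_inv_doubling hd symA psdA LN hinfty (ltr0n _ 2) T10 H.
  have C0 : 0 < C := lt_trans ltr01 C1.
  exists (2 * T1), (c1 * (2 * pi) ^+ d * C ^+ d); split.
  - by rewrite mulr_gt0.
  - by rewrite !mulr_gt0// exprn_gt0.
  move=> t T1t; have T1t2 : T1 < t / 2 by rewrite ltr_pdivlMr// mulrC.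
  have t20 : 0 < t / 2 := lt_trans T10 T1t2.
  have t0 : 0 < t by rewrite -(divfK (_ : 2 != 0 :> R) t)// mulr_gt0.
  have := H _ T1t2; rewrite mulrCA divff// mulr1 => /le_trans; apply.
  rewrite lee_fin -[leRHS]mulrA ler_pM2l ?mulr_gt0//.
  rewrite -exprVn -[in leRHS]exprVn -exprMn lerXn2r ?nnegrE//.
  - by rewrite invr_ge0 ltW// g0.
  - by rewrite mulr_ge0 ?invr_ge0 ?(ltW C0)// ltW// g0.
  rewrite ler_pdivlMr ?g0// ler_pdivrMl ?g0//.
  by rewrite mulrC; apply: gC; lra.
- move=> [T2 [c2 [T20 c20 H]]].
  have [r0 r00 [k k0 Hk]] := char_exponent_max_le_re hd symA psdA LN hinfty T20 H.
  have H1 t : T2 < t -> (\int[lebesgue_rV d]_z (expR (- (1 * t * re_char_exponent A N b z)))%:E <=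
      (c2 * concentration_inv A N t^-1 ^- d)%:E)%E by rewrite mul1r; exact: H.
  have [C C1 gC] := concentration_inv_doubling hd symA psdA LN hinfty ltr01 T20 H1.
  have [r1 r10 [alpha alpha02 Hconc]] := concentration_scaling symA psdA LN hinfty C1 T20 gC.
  have Hscale := char_exponent_max_scaling b symA psdA LN Hconc (ler0n _ 2).
  have psimax_ge0 r : 0 < r -> 0 <= char_exponent_max A N b r.
    move=> r_gt0; apply: le_trans (le_char_exponent_max b symA psdA LN (_ : enorm 0 <= r)).
      exact: re_char_exponent_ge0.
    by rewrite /enorm dotrV0l sqrtr0 ltW.
  (* One constant 1/c must be at most 1, at most k, and have inverse at least the scaling constant 4
     cd. *)
  pose c := 1 + k^-1 + 2 * 2 * cd; have c_gt0 : 0 < c.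
    by rewrite addr_gt0 ?mulr_gt0// addr_gt0// invr_gt0.
  pose m := Num.min r0 r1; have m0 : 0 < m by rewrite lt_min r00.
  have kV0 : 0 < k^-1 by rewrite invr_gt0.
  exists m^-1, c^-1, alpha; split.
    split=> //; first by rewrite invr_gt0.
    by rewrite invr_gt0 c_gt0 invf_le1// /c; lra.
  rewrite !invrK; split.
  - move=> x; rewrite lt_min => /andP[xr0 _].
    have [x0|x0] := eqVneq (enorm x) 0.
      rewrite x0; apply: le_trans (re_char_exponent_ge0 b psdA LN x).
      by rewrite pmulr_rle0 ?invr_gt0// char_exponent_max0.
    apply: le_trans (Hk x xr0); apply: ler_wpM2r.
      by apply: psimax_ge0; rewrite lt0r x0 enorm_ge0.
    by rewrite -[leRHS]invrK lef_pV2 ?posrE//; rewrite /c; lra.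
  - move=> l r l01 /andP[r_gt0]; rewrite lt_min => /andP[_ rr1].
    apply: (le_trans (Hscale l r l01 _)); first by rewrite r_gt0.
    apply: ler_wpM2r; first exact: psimax_ge0.
    by apply: ler_wpM2r; [exact: powR_ge0|rewrite /c /cd; lra].
  have t0 : 0 < T2 + 1 by lra.
  exists (T2 + 1) => //.
  have [_ fooP intP] := exp_char_exponent_integrableP hY (ltW t0).
  have [|iC iS] := fooP; last exact: intP.
  by apply: (le_lt_trans (H _ _)); rewrite ?ltry// ltrDl.
- move=> [T3 [c3 [alpha3 [[T30 /andP[c30 _] /andP[alpha30 _]] [Hre Hscale it0]]]]].
  have [T4 [c4 [T40 c41 H]]] :=
    char_exponent_max_le_dir_trunc hd symA psdA LN T30 c30 alpha30 Hre Hscale.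
  by exists T4, c4; split.
move=> [T4 [c4 [T40 c41 H [t0 t00 it0]]]].
have [fooP _ _] := exp_char_exponent_integrableP hY (ltW t00).
have c40 : 0 < c4 := lt_le_trans ltr01 c41.
have cc0 : 0 < (c4 * cd)^-1 by rewrite invr_gt0 mulr_gt0.
have T4V : 0 < T4^-1 by rewrite invr_gt0.
(* [psimax] is replaced by h at the cost of cd, so the hypothesis becomes one about h and
   [dir_trunc] only. *)
have HU x : 0 < enorm x < T4^-1 ->
    (c4 * cd)^-1 * concentration A N (enorm x)^-1 <= dir_trunc A N x.
  move=> /andP[x0 xT]; rewrite ler_pdivrMl ?mulr_gt0// mulrAC -mulrA.
  apply: (le_trans (conc_le_char_exponent_max b symA psdA LN x0)).
  by rewrite -/cd mulrA [leRHS]mulrC ler_pM2l//; exact: H.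
have [T [c [T0 c0 Hint]]] :=
  le_integral_expR_concentration hd symA psdA LN hinfty T4V cc0 t00 HU (fooP it0).
exists T, ((2 * pi) ^- d * c); split => //; first by rewrite mulr_gt0// invr_gt0.
exists (fun t => inversion_density P (Y t)); split => t Tt;
  have t_ge0 : 0 <= t by apply: ltW; exact: lt_trans Tt.
- apply: is_density_inversion => //.
  by apply: (le_lt_trans (Hint t Tt)); exact: ltry.
- apply: ge_ereal_sup => _ [x _ <-].
  rewrite lee_fin -mulrA; exact: (inversion_density_le hY x t_ge0 (Hint t Tt)).
Qed.
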